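(* Let $k\in\mathbb{Z}_{\ge1}$ be even, $m\in\{0,1\}$, $p\ge3$ a prime and $r\in\mathbb{Z}_{\ge1}$. If $p^r\equiv2m-1\pmod4$, then \begin{multline*} \mathscr{H}_{k,m,2,1}(p^r)=\frac{C_{\frac k2}}{3\cdot2^k}\left(p^{r(\frac k2+1)}-2p^{\frac{rk}2}\right)-\delta_{2\mid r}\frac16p^{\frac{rk}2}(p-1)-2^{-k}\sum_{\mu=0}^{\frac k2-1}T(k,\mu)p^{r\mu}\\ +\sum_{\mu=0}^{\frac k2-1}2^{-2\mu}T(k,\mu)\left(\alpha_{k-2\mu,m,2,1}(p^r)-p^{k-2\mu+1}\alpha_{k-2\mu,m,2,1}(p^{r-2})\right)p^{r\mu}, \end{multline*} where $\alpha_{k-2\mu,m,2,1}(p^{r-2})$ is taken to be $0$ if $r=1$. If $p^r\equiv2m+1\pmod4$, then $\mathscr{H}_{k,m,2,1}(p^r)=0$.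
   Context: $\delta_{\mathcal S}=1$ if the statement $\mathcal S$ is true and $0$ otherwise. $T(k,\mu)=\frac{k-2\mu+1}{k-\mu+1}\binom{k}{\mu}$; $C_n=\frac1{n+1}\binom{2n}{n}$. Hurwitz class numbers: for a negative integer $D\equiv0,1\pmod4$, $H(|D|)=\sum_Q 1/\omega_Q$, the sum over $\mathrm{SL}_2(\mathbb{Z})$-classes of (not necessarily primitive) positive definite integral binary quadratic forms of discriminant $D$, with $\omega_Q=2$ if $Q$ is equivalent to $a(x^2+y^2)$, $\omega_Q=3$ if $Q$ is equivalent to $a(x^2+xy+y^2)$, $\omega_Q=1$ otherwise. $H(0):=-\frac1{12}$, and $H(x):=0$ for every other rational $x$. $\mathscr{H}_{k,m,M,b}(p^r):=\sum_{t\in\mathbb{Z},\,p\nmid t,\,t\equiv m\,(M)}H\left(\frac{p^r-t^2}{b}\right)t^k$. Let $q=e^{2\pi i\tau}$, $\mathcal{H}(\tau)=\sum_{n\ge0}H(n)q^n$, $(\mathcal{H}|V_b)(\tau)=\mathcal{H}(b\tau)$, and $\theta_{j,m,M}(\tau)=\sum_{n\in\mathbb{Z},\,n\equiv m\,(M)}n^jq^{n^2}$ (with $0^0=1$). Rankin–Cohen bracket, for functions $F_1,F_2$ with associated weights $\kappa_1,\kappa_2$: $[F_1,F_2]_k=\frac1{(2\pi i)^k}\sum_{i=0}^k(-1)^i\binom{\kappa_1+k-1}{k-i}\binom{\kappa_2+k-1}{i}\frac{\partial^iF_1}{\partial\tau^i}\frac{\partial^{k-i}F_2}{\partial\tau^{k-i}}$,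 with generalized binomials $\binom{\alpha}{i}=\frac{\Gamma(\alpha+1)}{i!\,\Gamma(\alpha-i+1)}$. In $[\mathcal{H}|V_b,\theta_{j,m,M}]$ the weights are $\kappa_1=\frac32$, $\kappa_2=\frac12+j$. For $\ell\ge0$, $n\ge1$: $\lambda_{\ell,m,M,b}(n)=\sum_{\varepsilon\in\{\pm1\}}\varepsilon^\ell\sum^*(t-\sqrt b\,s)^{\ell+1}$, where $\sum^*$ runs over integers $t\ge1,s\ge0$ with $t^2-bs^2=n$ and $t\equiv\varepsilon m\pmod M$, and terms with $s=0$ have weight $\frac12$. $\Lambda_{\ell,m,M,b}=\sum_{n\ge1}\lambda_{\ell,m,M,b}(n)q^n$. For $\ell\ge0$ and $j\in\{0,1\}$, $j\equiv\ell\pmod2$: $f_{\ell,m,M,b}=[\mathcal{H}|V_b,\theta_{j,m,M}]_{\lfloor\ell/2\rfloor}+b^{-1/2}2^{-1-\ell}\binom{\ell}{\lfloor\ell/2\rfloor}\Lambda_{\ell,m,M,b}=\sum_{n\ge0}\gamma_{\ell,m,M,b}(n)q^n$, and $\alpha_{\ell,m,M,b}(n)=\binom{\ell}{\lfloor\ell/2\rfloor}^{-1}\gamma_{\ell,m,M,b}(n)$. *)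

(* Defs.v *)
From mathcomp Require Import all_boot all_order all_algebra.
From mathcomp Require Import complex.
From mathcomp Require Import all_classical all_reals all_analysis.

Set Implicit Arguments.
Unset Strict Implicit.
Unset Printing Implicit Defensive.

Import Order.TTheory GRing.Theory Num.Theory.
Import numFieldNormedType.Exports.

Local Open Scope classical_set_scope.
Local Open Scope ring_scope.

(* The complex numbers, packed as a [numFieldType] so that MathComp-Analysis
   equips them with the topology of the complex norm. *)
Definition Cplx (R : realType) : numFieldType := R[i].

Definition of_real (R : realType) (x : R) : Cplx R := (x%:C)%C.

Definition re (R : realType) (z : Cplx R) : R := complex.Re z.

Definition im (R : realType) (z : Cplx R) : R := complex.Im z.

Record bqf := Bqf { qf_a : int; qf_b : int; qf_c : int }.

Definition qf_eval (Q : bqf) (x y : int) : int :=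
  qf_a Q * x ^+ 2 + qf_b Q * x * y + qf_c Q * y ^+ 2.

Definition qf_disc (Q : bqf) : int := qf_b Q ^+ 2 - 4 * qf_a Q * qf_c Q.

Definition pos_definite (Q : bqf) : Prop :=
  forall x y : int, (x, y) != (0, 0) -> 0 < qf_eval Q x y.

Definition SL2Z_equiv (Q Q' : bqf) : Prop :=
  exists2 g : 'M[int]_2, \det g = 1 &
    forall x y : int,
      qf_eval Q' x y = qf_eval Q (g 0 0 * x + g 0 1 * y) (g 1 0 * x + g 1 1 * y).

Definition qf_class (Q : bqf) : set bqf := [set Q' | SL2Z_equiv Q Q'].

Definition qf_classes (D : int) : set (set bqf) :=
  [set qf_class Q | Q in [set Q | pos_definite Q /\ qf_disc Q = D]].

(* Since [X] is a full equivalence class, [X (Bqf a b c)] says that its members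
   are equivalent to [a x^2 + b x y + c y^2]. *)
Definition omega (X : set bqf) : nat :=
  if `[< exists a : int, X (Bqf a 0 a) >] then 2%N
  else if `[< exists a : int, X (Bqf a a a) >] then 3%N
  else 1%N.

(* The value is H(x); for x > 0 it counts classes of discriminant D = - x. *)
Definition hurwitz (x : rat) : rat :=
  let D := - numq x in
  if x == 0 then - 12%:R^-1
  else if [&& x \is a Num.int, 0 < x & (D %% 4)%Z \in [:: 0; 1]]
  then \sum_(X \in qf_classes D) ((omega X)%:R^-1 : rat)
  else 0.

(* The support of the summand is finite for b > 0, as H vanishes at negative
   arguments; [\sum_(_ \in _)] therefore is the full sum over t. *)
Definition hurwitz_moment (k : nat) (m M : int) (b p r : nat) : rat :=
  \sum_(t \in [set t : int | ~ (p%:Z %| t)%Z /\ (t = m %[mod M])%Z])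
    hurwitz (((p ^ r)%N%:Z - t ^+ 2)%:~R / b%:R) * t%:~R ^+ k.

Definition ballot (F : fieldType) (k mu : nat) : F :=
  (k%:R - 2 * mu%:R + 1) / (k%:R - mu%:R + 1) * 'C(k, mu)%:R.

Definition catalan (F : fieldType) (n : nat) : F :=
  n.+1%:R^-1 * 'C(n.*2, n)%:R.

(* Gamma(a + 1) / (i! Gamma(a - i + 1)), with the quotient of Gamma values
   written as the falling factorial a (a - 1) ... (a - i + 1). *)
Definition gbinom (F : fieldType) (a : F) (i : nat) : F :=
  (\prod_(l < i) (a - l%:R)) / i`!%:R.

Definition cexp (R : realType) (z : Cplx R) : Cplx R :=
  (expR (re z) * cos (im z)
   +i* (expR (re z) * sin (im z)))%C.

Definition two_pi_i (R : realType) : Cplx R := (0 +i* (2 * pi))%C.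

Definition nome (R : realType) (tau : Cplx R) : Cplx R := cexp (two_pi_i R * tau).

Definition hurwitz_gf (R : realType) (tau : Cplx R) : Cplx R :=
  limn (series (fun n => ratr (hurwitz n%:R) * nome tau ^+ n)).

Definition Vop (R : realType) (b : nat) (F : Cplx R -> Cplx R) (tau : Cplx R) : Cplx R :=
  F (b%:R * tau).

(* The sum over all integers n = m (mod M), absolutely convergent for
   Im tau > 0, as the limit of its symmetric partial sums. *)
Definition theta (R : realType) (j : nat) (m M : int) (tau : Cplx R) : Cplx R :=
  limn (fun N : nat =>
    \sum_(n \in [set n : int | `|n| <= N%:Z /\ (n = m %[mod M])%Z])
      n%:~R ^+ j * nome tau ^+ (absz n ^ 2)%N).

(* [derive1n i F] is the i-th derivative with respect to the complex variable. *)
Definition rankin_cohen (R : realType) (kappa1 kappa2 : Cplx R)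
    (F1 F2 : Cplx R -> Cplx R) (k : nat) (tau : Cplx R) : Cplx R :=
  (two_pi_i R ^+ k)^-1 *
  \sum_(i < k.+1)
    (-1) ^+ i * gbinom (kappa1 + k%:R - 1) (k - i)
    * gbinom (kappa2 + k%:R - 1) i * derive1n i F1 tau * derive1n (k - i) F2 tau.

(* The summands are positive, and for b not a square there may be infinitely
   many of them, hence the sum in the extended reals. *)
Definition lambda_coef (R : realType) (l : nat) (m M : int) (b n : nat) : R :=
  \sum_(e <- [:: 1; -1] : seq int)
    e%:~R ^+ l *
    fine (\esum_(ts in [set ts : int * int |
                 [/\ 1 <= ts.1, 0 <= ts.2,
                     ts.1 ^+ 2 - b%:Z * ts.2 ^+ 2 = n%:Z
                   & (ts.1 = e * m %[mod M])%Z]])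
      ((if ts.2 == 0 then 2^-1 else 1)
       * (ts.1%:~R - Num.sqrt b%:R * ts.2%:~R) ^+ l.+1)%:E).

Definition Lambda_gf (R : realType) (l : nat) (m M : int) (b : nat)
    (tau : Cplx R) : Cplx R :=
  limn (fun N : nat =>
    \sum_(1 <= n < N) of_real (lambda_coef R l m M b n) * nome tau ^+ n).

Definition f_holo (R : realType) (l : nat) (m M : int) (b : nat)
    (tau : Cplx R) : Cplx R :=
  let j := nat_of_bool (odd l) in
  rankin_cohen (3%:R / 2) (2^-1 + j%:R)
    (Vop b (@hurwitz_gf R)) (theta j m M) l./2 tau
  + of_real (Num.sqrt b%:R)^-1 * (2 ^+ l.+1)^-1 * 'C(l, l./2)%:R
    * Lambda_gf l m M b tau.

Definition has_q_expansion (R : realType) (f : Cplx R -> Cplx R)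
    (c : nat -> Cplx R) : Prop :=
  forall tau : Cplx R, 0 < im tau ->
    series (fun n => c n * nome tau ^+ n) @ \oo --> f tau.

(* A q-expansion on the upper half plane is unique when it exists, so [xget]
   picks it; the default value is used only if there is none. *)
Definition q_coef (R : realType) (f : Cplx R -> Cplx R) : nat -> Cplx R :=
  xget (fun=> 0) [set c | has_q_expansion f c].

Definition gamma_coef (R : realType) (l : nat) (m M : int) (b n : nat) : Cplx R :=
  q_coef (@f_holo R l m M b) n.

Definition alpha_coef (R : realType) (l : nat) (m M : int) (b n : nat) : Cplx R :=
  'C(l, l./2)%:R^-1 * gamma_coef R l m M b n.

(* Main.v *)
From HB Require Import structures.
Require Import Defs.
From mathcomp Require Import all_boot all_order all_algebra.
From mathcomp Require Import complex.
From mathcomp Require Import all_classical all_reals all_analysis.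
From mathcomp Require Import zify ring lra.

(* Write n = p^r and S_k(n) for the sum of H(n - t^2) t^k over t = m (mod 2).

   The weights of the Rankin-Cohen bracket collapse to a multiple of
   (-1)^i C(2K+1, 2i+1), so alpha_l(n) - 2^(-l-1) lambda_l(n) is 2^(-l) times the
   sum of H(n - t^2) h_l(x, y), where t = (x + y) / 2, xy = n and h_l is the
   complete homogeneous polynomial.  Inverting by
   (x + y)^k = sum_mu T(k, mu) (xy)^mu h_(k-2mu)(x, y)
   expresses S_k(n) through the alpha's, the lambda's and S_0(n).

   The terms with p | t are p^(k+1) S_k(n / p^2), up to a contribution of
   H(0), because H(p^2 N) = p H(N) for N = p^s - t^2 > 0, t <> 0.  This follows
   from the Hecke relation by induction on s.  Since n = p^r, the pairs with
   t^2 - s^2 = n are explicit, and lambda_l(n) - p^(l+1) lambda_l(n / p^2) = 2.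

   There remains S_0(n), that is Eichler's relation
   6 S_0(n) = 2 sigma(n) - 3 sum_(d | n) min(d, n/d).
   By Selling reduction 6 H(N) counts the (a, b, c) of equal parity with
   ab + bc + ca = N, once with a, b, c >= 0 and once with a, b, c > 0.  The
   substitution e = b + c, f = a + t, g = +-(c - t), h = +-(b - t) turns
   t^2 + ab + bc + ca = n into ef + gh = n, where elementary bijections cancel
   all solutions but those with f = g or f = h. *)

Set Implicit Arguments.
Unset Strict Implicit.
Unset Printing Implicit Defensive.

Import Order.TTheory GRing.Theory Num.Theory.
Import numFieldNormedType.Exports.

Local Open Scope ring_scope.

(** * Solutions of n = ef + gh *)

(** The sums behind [lambda] and behind Eichler's relation run over all divisors of [p^r]. Lowering
    [r] by 2 shifts their index, so subtracting a multiple of the value at [p^(r-2)] leaves boundary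
    terms only. The multiples with [p | t] supply exactly this subtraction: in the inversion [n^mu]
    absorbs [p^(2 mu)] from [p^(k+1)], and [p^(l+1)] with [l = k - 2 mu] remains, which is [p] for
    [S_0]. The congruence on [p^r] makes the restriction on [t] automatic: for the other parity
    [n - t^2] is 1 or 2 modulo 4 and [H] vanishes, so [S_0] is a sum over all [t]. In general the
    Hecke relation contains a Legendre symbol. For [N = p^s - t^2] either [- N] is a nonzero square
    modulo [p], or [N] is [p^2] times a number of the same shape, and the symbol is known. In
    [ef + gh = n] the number [e] is even and [f, g, h] are odd. So [e] never ties with [g] or [h],
    and the case distinctions leave only the ties of [f]. [alpha] is a coefficient of a chosen
    q-expansion. Hence the series must be differentiated termwise, multiplied, and shown to
    determine its coefficients. *)

Lemma reindex_seq (T S : eqType) (V : nmodType) (s : seq T) (s' : seq S)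
    (P : pred T) (Q : pred S) (F : T -> V) (G : S -> V) (f : T -> S) (g : S -> T) :
  uniq s -> uniq s' ->
  (forall x, x \in s -> P x -> [/\ f x \in s', Q (f x), g (f x) = x & F x = G (f x)]) ->
  (forall y, y \in s' -> Q y -> [/\ g y \in s, P (g y) & f (g y) = y]) ->
  \sum_(x <- s | P x) F x = \sum_(y <- s' | Q y) G y.
Proof.
move=> us us' fP gP.
rewrite -big_filter -[RHS]big_filter.
have pe : perm_eq [seq y <- s' | Q y] (map f [seq x <- s | P x]).
  apply: uniq_perm; first exact: filter_uniq.
    rewrite map_inj_in_uniq ?filter_uniq // => x y.
    rewrite !mem_filter => /andP[Px xs] /andP[Py ys] fxy.
    by have [_ _ <- _] := fP _ xs Px; have [_ _ <- _] := fP _ ys Py; rewrite fxy.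
  move=> y; rewrite mem_filter; apply/andP/mapP => [[Qy ys]|[x]].
    by have [gs Pg fg] := gP _ ys Qy; exists (g y); rewrite ?mem_filter ?Pg.
  by rewrite mem_filter => /andP[Px xs] ->; have [] := fP _ xs Px.
rewrite (perm_big _ pe) big_map big_seq [RHS]big_seq; apply: eq_bigr => x.
by rewrite mem_filter => /andP[Px xs]; have [] := fP _ xs Px.
Qed.

Definition irange (n : nat) : seq int := [seq i%:Z - n%:Z | i <- iota 0 (n + n).+1].

Lemma mem_irange n (x : int) : (x \in irange n) = (- n%:Z <= x <= n%:Z).
Proof.
apply/mapP/idP => [[] i|xn].
  by rewrite mem_iota => /andP[_ i_lt] ->; lia.
exists (absz (x + n%:Z)); last by lia.
by rewrite mem_iota; lia.
Qed.

Lemma irange_uniq n : uniq (irange n).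
Proof. by rewrite map_inj_uniq ?iota_uniq // => i j; lia. Qed.

Definition ibox n : seq (int * int * int * int) :=
  allpairs pair (allpairs pair (allpairs pair (irange n) (irange n)) (irange n)) (irange n).

Lemma mem_allpairs_pair (T S : eqType) (s : seq T) (s' : seq S) (x : T) (y : S) :
  ((x, y) \in allpairs pair s s') = (x \in s) && (y \in s').
Proof.
apply/allpairsP/andP => [[[a b] [/= ? ? [-> ->]]]|[? ?]] //.
by exists (x, y).
Qed.

Lemma mem_ibox n (x y z w : int) :
  ((x, y, z, w) \in ibox n) =
  [&& x \in irange n, y \in irange n, z \in irange n & w \in irange n].
Proof. by rewrite !mem_allpairs_pair -!andbA. Qed.

Lemma allpairs_pair_uniq (T S : eqType) (s : seq T) (s' : seq S) :
  uniq s -> uniq s' -> uniq (allpairs pair s s').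
Proof. by move=> us us'; apply: allpairs_uniq => // -[a b] [c d] _ _ [-> ->]. Qed.

Lemma ibox_uniq n : uniq (ibox n).
Proof. by do !apply: allpairs_pair_uniq; apply: irange_uniq. Qed.

Local Notation pred4 := (int -> int -> int -> int -> bool).
Local Notation fun4 := (int -> int -> int -> int -> int).

Definition bcount n (P : pred4) : int :=
  \sum_(x <- ibox n | P x.1.1.1 x.1.1.2 x.1.2 x.2) 1.

(** The box is only a finite carrier. This condition says that it loses no solution, so counts over
    boxes of different size can be compared by bijections. *)
Definition in_ibox n (P : pred4) :=
  forall x y z w, P x y z w ->
    [/\ `|x| <= n%:Z, `|y| <= n%:Z, `|z| <= n%:Z & `|w| <= n%:Z].

Lemma in_iboxP n P x y z w : in_ibox n P -> P x y z w -> (x, y, z, w) \in ibox n.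
Proof.
by move=> nP /nP[? ? ? ?]; rewrite mem_ibox !mem_irange; apply/and4P; split; lia.
Qed.

Definition maps4 (P Q : pred4) (f1 f2 f3 f4 g1 g2 g3 g4 : fun4) : Prop :=
  forall x y z w, P x y z w ->
    let X := f1 x y z w in let Y := f2 x y z w in
    let Z := f3 x y z w in let W := f4 x y z w in
    Q X Y Z W /\
    [/\ g1 X Y Z W = x, g2 X Y Z W = y, g3 X Y Z W = z & g4 X Y Z W = w].

Lemma reindex_ibox n m (P Q : pred4) (F G f1 f2 f3 f4 g1 g2 g3 g4 : fun4) :
  in_ibox n P -> in_ibox m Q ->
  maps4 P Q f1 f2 f3 f4 g1 g2 g3 g4 -> maps4 Q P g1 g2 g3 g4 f1 f2 f3 f4 ->
  (forall x y z w, P x y z w ->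
     F x y z w = G (f1 x y z w) (f2 x y z w) (f3 x y z w) (f4 x y z w)) ->
  \sum_(x <- ibox n | P x.1.1.1 x.1.1.2 x.1.2 x.2) F x.1.1.1 x.1.1.2 x.1.2 x.2 =
  \sum_(x <- ibox m | Q x.1.1.1 x.1.1.2 x.1.2 x.2) G x.1.1.1 x.1.1.2 x.1.2 x.2.
Proof.
move=> bP bQ fP gP FG.
pose ap (h1 h2 h3 h4 : fun4) (x : int * int * int * int) :=
  (h1 x.1.1.1 x.1.1.2 x.1.2 x.2, h2 x.1.1.1 x.1.1.2 x.1.2 x.2,
   h3 x.1.1.1 x.1.1.2 x.1.2 x.2, h4 x.1.1.1 x.1.1.2 x.1.2 x.2).
apply: (reindex_seq (f := ap f1 f2 f3 f4) (g := ap g1 g2 g3 g4)); try exact: ibox_uniq.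
  case=> [[[x y] z] w] _ /= Px; have /= [Qx [e1 e2 e3 e4]] := fP _ _ _ _ Px.
  by split; rewrite /ap //= ?e1 ?e2 ?e3 ?e4 ?(in_iboxP bQ) ?(FG _ _ _ _ Px).
case=> [[[x y] z] w] _ /= Qx; have /= [Px [e1 e2 e3 e4]] := gP _ _ _ _ Qx.
by split; rewrite /ap //= ?e1 ?e2 ?e3 ?e4 ?(in_iboxP bP).
Qed.

Lemma eq_bcount n (P Q : pred4) :
  (forall x y z w, P x y z w = Q x y z w) -> bcount n P = bcount n Q.
Proof. by move=> PQ; apply: eq_bigl => x; rewrite PQ. Qed.

Lemma bcount_bij n m (P Q : pred4) (f1 f2 f3 f4 g1 g2 g3 g4 : fun4) :
  in_ibox n P -> in_ibox m Q ->
  maps4 P Q f1 f2 f3 f4 g1 g2 g3 g4 -> maps4 Q P g1 g2 g3 g4 f1 f2 f3 f4 ->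
  bcount n P = bcount m Q.
Proof.
by move=> bP bQ fP gP; apply: (reindex_ibox (F := fun _ _ _ _ => 1) (G := fun _ _ _ _ => 1) bP bQ fP gP).
Qed.

Lemma sum_bound (n : nat) (x y z : int) :
  0 < x -> 0 < y -> 0 <= z -> x * y + z = n%:Z -> x <= n%:Z /\ y <= n%:Z.
Proof. by move=> x0 y0 z0 e; split; nia. Qed.

(** The parities are those of the image of [quadT], where [a, b, c] are all opposite to [t]. They
    exclude the equalities of [e] with [g], [h] or [f + g + h], and of [f] with [e + g + h]. *)
Definition quadX (n : nat) (e f g h : int) : bool :=
  [&& [&& 0 < e, 0 < f, 0 < g & 0 < h], e * f + g * h == n%:Z &
      [&& (e %% 2)%Z == 0, (f %% 2)%Z == 1, (g %% 2)%Z == 1 & (h %% 2)%Z == 1]].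

Lemma quadX_bound n P : in_ibox n (fun e f g h => quadX n e f g h && P e f g h).
Proof.
move=> e f g h /andP[/and3P[/and4P[e0 f0 g0 h0] /eqP E _] _].
have [||||? ?] := @sum_bound n e f (g * h) => //; first by nia.
have [||||? ?] := @sum_bound n g h (e * f) => //; first 1 [nia|lia].
by split; lia.
Qed.

Lemma quadXP n e f g h : reflect
  [/\ [/\ 0 < e, 0 < f, 0 < g & 0 < h], e * f + g * h = n%:Z &
      [/\ (e %% 2)%Z = 0, (f %% 2)%Z = 1, (g %% 2)%Z = 1 & (h %% 2)%Z = 1]]
  (quadX n e f g h).
Proof.
apply: (iffP and3P) => [[/and4P[? ? ? ?] /eqP E /and4P[/eqP ? /eqP ? /eqP ? /eqP ?]] //|].
by case=> [[? ? ? ?] /eqP ? [/eqP ? /eqP ? /eqP ? /eqP ?]]; split=> //; apply/and4P.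
Qed.

Definition xcount n (P : pred4) :=
  bcount n (fun e f g h => quadX n e f g h && P e f g h).

Lemma xcount_bij n (P Q : pred4) (f1 f2 f3 f4 g1 g2 g3 g4 : fun4) :
  let qX R := fun e f g h => quadX n e f g h && R e f g h in
  maps4 (qX P) (qX Q) f1 f2 f3 f4 g1 g2 g3 g4 ->
  maps4 (qX Q) (qX P) g1 g2 g3 g4 f1 f2 f3 f4 -> xcount n P = xcount n Q.
Proof. by move=> qX; apply: bcount_bij; exact: quadX_bound. Qed.

Ltac xbij :=
  move=> e f g h /andP[/quadXP[[e0 f0 g0 h0] E [? ? ? ?]] c] /=;
  split; [apply/andP; split; [apply/quadXP; split; first 1 [split]|]|];
  try split; try lia; try assumption.

(** The identity is [e f + g h = (h + f) g + f (e - g)]. The map is its own inverse, and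
    [h + f < e - g] is the condition [e < h] of the image. *)
Lemma xcount_cycle n : xcount n (fun e f g h => f + g + h < e) =
  xcount n (fun e f g h => [&& g < e & e < h]).
Proof.
apply: (@xcount_bij n _ _
  (fun e f g h => h + f) (fun e f g h => g) (fun e f g h => f) (fun e f g h => e - g)
  (fun e f g h => h + f) (fun e f g h => g) (fun e f g h => f) (fun e f g h => e - g)); xbij.
Qed.

(** The identity is [e f + g h = e (f - g - h - e) + (h + e) (g + e)]: expanding the last product
    returns what was taken from [f]. *)
Lemma xcount_big_f n : xcount n (fun e f g h => e + g + h < f) =
  xcount n (fun e f g h => [&& e < g & e < h]).
Proof.
apply: (@xcount_bij n _ _
  (fun e f g h => e) (fun e f g h => f - g - h - e) (fun e f g h => h + e) (fun e f g h => g + e)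
  (fun e f g h => e) (fun e f g h => f + g + h - e) (fun e f g h => h - e) (fun e f g h => g - e)); xbij.
Qed.

(** The identity is [e f + g h = (g - f) h + f (e + h)]. *)
Lemma xcount_small_f n : xcount n (fun e f g h => [&& f < g & f < h]) =
  xcount n (fun e f g h => [&& g < f & f < h]).
Proof.
apply: (@xcount_bij n _ _
  (fun e f g h => g - f) (fun e f g h => h) (fun e f g h => f) (fun e f g h => e + h)
  (fun e f g h => h - f) (fun e f g h => g) (fun e f g h => e + g) (fun e f g h => f)); xbij.
Qed.

Lemma xcount_swap n P : xcount n P = xcount n (fun e f g h => P e f h g).
Proof.
apply: (@xcount_bij n _ _
  (fun e f g h => e) (fun e f g h => f) (fun e f g h => h) (fun e f g h => g)
  (fun e f g h => e) (fun e f g h => f) (fun e f g h => h) (fun e f g h => g)); xbij.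
Qed.

Definition bsum n (P : pred4) (F : fun4) : int :=
  \sum_(x <- ibox n | P x.1.1.1 x.1.1.2 x.1.2 x.2) F x.1.1.1 x.1.1.2 x.1.2 x.2.

Lemma eq_bsum n (P Q : pred4) F G : (forall x y z w, P x y z w = Q x y z w) ->
  (forall x y z w, P x y z w -> F x y z w = G x y z w) -> bsum n P F = bsum n Q G.
Proof. by move=> PQ FG; apply: eq_big => x; [rewrite PQ|move=> /FG]. Qed.

Lemma bsumD n P F G : bsum n P (fun x y z w => F x y z w + G x y z w) = bsum n P F + bsum n P G.
Proof. exact: big_split. Qed.

Lemma bsumM n P c F : bsum n P (fun x y z w => c * F x y z w) = c * bsum n P F.
Proof. by rewrite /bsum mulr_sumr. Qed.

Lemma bsum_ind n P (Q : pred4) :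
  bsum n P (fun x y z w => (Q x y z w : nat)%:Z) =
  bcount n (fun x y z w => P x y z w && Q x y z w).
Proof.
rewrite /bcount big_mkcondr; apply: eq_bigr => x _.
by case: (Q _ _ _ _).
Qed.

Lemma xcount_total n P :
  xcount n P = bsum n (quadX n) (fun e f g h => (P e f g h : nat)%:Z).
Proof. by rewrite bsum_ind. Qed.

(** All solutions are counted twice ([T1]), by the position of [e] relative to [g], [h], [f + g + h]
    and by that of [f] relative to [g], [h], [e + g + h]. By the bijections both middle positions of
    [e] equal its top position, the lowest position of [e] cancels the top one of [f], and the
    lowest position of [f] equals each of its middle ones. Only ties of [f] are left. *)
Lemma xcount_balance n :
  xcount n (fun e f g h => [&& g < e, h < e & e < f + g + h])
  + 3 * xcount n (fun e f g h => f + g + h < e)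
  - xcount n (fun e f g h => [&& g < f, h < f & f < e + g + h])
  - 3 * xcount n (fun e f g h => [&& g < f & f <= h])
  = 2 * xcount n (fun e f g h => f == g)
    - xcount n (fun e f g h => [&& f == g & f == h])
    - 3 * xcount n (fun e f g h => [&& g < f & f == h]).
Proof.
have E1 := xcount_cycle n.
have E1' : xcount n (fun e f g h => [&& g < e & e < h]) =
  xcount n (fun e f g h => [&& h < e & e < g]) by rewrite xcount_swap.
have E2 := xcount_big_f n.
have E3 := xcount_small_f n.
have E3' : xcount n (fun e f g h => [&& g < f & f < h]) =
  xcount n (fun e f g h => [&& h < f & f < g]) by rewrite xcount_swap.
have E4 : xcount n (fun e f g h => f == g) = xcount n (fun e f g h => f == h) by rewrite xcount_swap.
have T1 : xcount n (fun e f g h => [&& g < e, h < e & e < f + g + h])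
   + xcount n (fun e f g h => f + g + h < e)
   + xcount n (fun e f g h => [&& g < e & e < h])
   + xcount n (fun e f g h => [&& h < e & e < g])
   + xcount n (fun e f g h => [&& e < g & e < h])
   = xcount n (fun e f g h => [&& g < f, h < f & f < e + g + h])
   + xcount n (fun e f g h => e + g + h < f)
   + xcount n (fun e f g h => [&& g < f & f < h])
   + xcount n (fun e f g h => [&& h < f & f < g])
   + xcount n (fun e f g h => [&& f < g & f < h])
   + xcount n (fun e f g h => f == g) + xcount n (fun e f g h => f == h)
   - xcount n (fun e f g h => [&& f == g & f == h]).
  rewrite !xcount_total -mulN1r -bsumM -!bsumD; apply: eq_bsum => // e f g h.
  move=> /quadXP[[? ? ? ?] _ [? ? ? ?]].
  case: (ltgtP e g) => ?; case: (ltgtP e h) => ?; try lia;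
  case: (ltgtP f g) => ?; case: (ltgtP f h) => ?;
  case: (ltgtP e (f + g + h)) => ?; try lia;
  case: (ltgtP f (e + g + h)) => ?; rewrite /=; lia.
have T2 : xcount n (fun e f g h => [&& g < f & f <= h]) =
   xcount n (fun e f g h => [&& g < f & f < h]) + xcount n (fun e f g h => [&& g < f & f == h]).
  by rewrite !xcount_total -!bsumD; apply: eq_bsum => // e f g h _; lia.
lia.
Qed.

(** * Solutions of n = t^2 + ab + bc + ca *)

Definition quadT (n : nat) (t a b c : int) : bool :=
  [&& t ^+ 2 + a * b + b * c + c * a == n%:Z, ((a + t) %% 2)%Z == 1,
      ((b + t) %% 2)%Z == 1 & ((c + t) %% 2)%Z == 1].

Lemma quadTP n t a b c : reflect
  [/\ t ^+ 2 + a * b + b * c + c * a = n%:Z, ((a + t) %% 2)%Z = 1,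
      ((b + t) %% 2)%Z = 1 & ((c + t) %% 2)%Z = 1] (quadT n t a b c).
Proof.
by apply: (iffP and4P) => [[/eqP ? /eqP ? /eqP ? /eqP ?]|[/eqP ? /eqP ? /eqP ? /eqP ?]].
Qed.

(* The determinant form [t^2 + ab + bc + ca = (b + c)(a + t) + (c - t)(b - t)]. *)
Lemma quadT_phi n (s t a b c : int) : s ^+ 2 = 1 -> quadT n t a b c ->
  0 < b + c -> 0 < a + t -> 0 < s * (c - t) -> 0 < s * (b - t) ->
  quadX n (b + c) (a + t) (s * (c - t)) (s * (b - t)).
Proof.
move=> s2 /quadTP[E ? ? ?] ? ? H1 H2.
have [es|es] : s = 1 \/ s = -1 by nia.
  subst s; rewrite !mul1r in H1 H2 *; apply/quadXP; split; first by split.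
    by rewrite -E; ring.
  by split; lia.
subst s; rewrite !mulN1r in H1 H2 *; apply/quadXP; split; first by split.
  by rewrite -E; ring.
by split; lia.
Qed.

Lemma bcount_phi n (s : int) (P Q : pred4) : s ^+ 2 = 1 ->
  (forall t a b c, quadT n t a b c -> P t a b c ->
    [/\ 0 < b + c, 0 < a + t, 0 < s * (c - t) & 0 < s * (b - t)] /\
    Q (b + c) (a + t) (s * (c - t)) (s * (b - t))) ->
  (forall t a b c, quadT n t a b c ->
    [/\ 0 < b + c, 0 < a + t, 0 < s * (c - t) & 0 < s * (b - t)] ->
    Q (b + c) (a + t) (s * (c - t)) (s * (b - t)) -> P t a b c) ->
  in_ibox (4 * n) (fun t a b c => quadT n t a b c && P t a b c) /\
  bcount (4 * n) (fun t a b c => quadT n t a b c && P t a b c) = xcount n Q.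
Proof.
move=> s2 PQ QP.
have s1 : s = 1 \/ s = -1 by nia.
have bT : in_ibox (4 * n) (fun t a b c => quadT n t a b c && P t a b c).
  move=> t a b c /andP[T Pt]; have [[bc0 at0 g0 h0] Qt] := PQ _ _ _ _ T Pt.
  have X := quadT_phi s2 T bc0 at0 g0 h0.
   have := @quadX_bound n (fun _ _ _ _ => true) (b + c) (a + t) (s * (c - t)) (s * (b - t)).
  rewrite X => /(_ isT)[? ? ? ?].
  have [e|e] : s = 1 \/ s = -1 by nia.
    by subst s; split; lia.
  by subst s; split; lia.
split=> //.
(* Solving the substitution gives [2 t = e - s (g + h)], whose right side is even because [g] and
   [h] are odd. *)
pose tt e g h := ((e - s * (g + h)) %/ 2)%Z.
apply: (bcount_bij (f1 := fun t a b c => b + c) (f2 := fun t a b c => a + t)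
  (f3 := fun t a b c => s * (c - t)) (f4 := fun t a b c => s * (b - t))
  (g1 := fun e f g h => tt e g h) (g2 := fun e f g h => f - tt e g h)
  (g3 := fun e f g h => tt e g h + s * h) (g4 := fun e f g h => tt e g h + s * g)) => //.
- exact: quadX_bound.
- move=> t a b c /andP[T Pt] /=; have [[bc0 at0 g0 h0] Qt] := PQ _ _ _ _ T Pt.
  rewrite (quadT_phi s2 T) //; split=> //; rewrite /tt.
  have -> : b + c - s * (s * (c - t) + s * (b - t)) = t * 2.
    by case: s1 => ->; ring.
  by rewrite mulzK //; split; case: s1 => es; rewrite ?es; ring.
- move=> e f g h /andP[X Qx] /=.
  have [[e0 f0 g0 h0] E [p1 p2 p3 p4]] := quadXP _ _ _ _ _ X.
  have et : e = 2 * tt e g h + s * (g + h).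
    have [es|es] : s = 1 \/ s = -1 by nia.
      by rewrite /tt es; lia.
    by rewrite /tt es; lia.
  move: (tt e g h) et => t et.
  have e1 : t + s * h + (t + s * g) = e by rewrite et; ring.
  have e2 : f - t + t = f by ring.
  have e3 : s * (t + s * g - t) = g by case: s1 => ->; ring.
  have e4 : s * (t + s * h - t) = h by case: s1 => ->; ring.
  have T : quadT n t (f - t) (t + s * h) (t + s * g).
    apply/quadTP; have [es|es] : s = 1 \/ s = -1 by nia.
      by subst s; split; [rewrite -E et; ring|lia|lia|lia].
    by subst s; split; [rewrite -E et; ring|lia|lia|lia].
  split; last by split.
  by rewrite T; apply: QP; rewrite // ?e1 ?e2 ?e3 ?e4.
Qed.

(** * Regions of [(t, a, b, c)] and their images under the determinant form *)

Section Regions.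
Variable n : nat.
Let tcount P := bcount (4 * n) (fun t a b c => quadT n t a b c && P t a b c).
Let T_in_box P := in_ibox (4 * n) (fun t a b c => quadT n t a b c && P t a b c).

(** These four regions are the preimages of the four sets on the left of [xcount_balance]. The first
    two have [b, c > t] and use the sign [1], the last two have [b, c < t] and use the sign [-1]. *)
Let all_large (t a b c : int) := [&& `|t| < a, `|t| < b & `|t| < c].
Let a_small (t a b c : int) := [&& t < b, t < c & `|a| < t].
Let all_small (t a b c : int) :=
  [&& `|a| < t, `|b| < t, `|c| < t, 0 < a + b, 0 < b + c & 0 < c + a].
Let c_flip (t a b c : int) := [&& `|c| < t, 0 < b + c, 0 < c + a & a + b <= 0].

Lemma tcount_all_large : T_in_box all_large /\
  tcount all_large = xcount n (fun e f g h => [&& g < e, h < e & e < f + g + h]).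
Proof.
apply: (@bcount_phi n 1) => // t a b c /quadTP[_ ? ? ?]; rewrite /all_large ?mul1r.
  by move=> ?; split; [split; lia|lia].
by case=> *; lia.
Qed.

Lemma tcount_a_small : T_in_box a_small /\
  tcount a_small = xcount n (fun e f g h => f + g + h < e).
Proof.
apply: (@bcount_phi n 1) => // t a b c /quadTP[_ ? ? ?]; rewrite /a_small ?mul1r.
  by move=> ?; split; [split; lia|lia].
by case=> *; lia.
Qed.

Lemma tcount_all_small : T_in_box all_small /\
  tcount all_small = xcount n (fun e f g h => [&& g < f, h < f & f < e + g + h]).
Proof.
apply: (@bcount_phi n (-1)) => // t a b c /quadTP[_ ? ? ?]; rewrite /all_small ?mulN1r.
  by move=> ?; split; [split; lia|lia].
by case=> *; lia.
Qed.

Lemma tcount_c_flip : T_in_box c_flip /\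
  tcount c_flip = xcount n (fun e f g h => [&& g < f & f <= h]).
Proof.
apply: (@bcount_phi n (-1)) => // t a b c /quadTP[_ ? ? ?]; rewrite /c_flip ?mulN1r.
  by move=> ?; split; [split; lia|lia].
by case=> *; lia.
Qed.

Let wedge (t a b c : int) :=
  [&& [&& 0 < t, - t < a, - t < b & - t < c], 0 < a + b, 0 < b + c & 0 < c + a].
Let c_strip (t a b c : int) := [&& `|c| < t, 0 < b + c & 0 < c + a].
(** For [t^2 = n] the equation becomes [ab + bc + ca = 0], which [(a, 0, 0)] solves with [a]
    unbounded. These degenerate solutions belong to [H(0)] and are treated apart. *)
Let nonneg (t a b c : int) := [&& 0 <= a, 0 <= b, 0 <= c & t ^+ 2 != n%:Z].
Let positive (t a b c : int) := [&& 0 < a, 0 < b & 0 < c].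

(** Two of [a, b, c] lie on the same side of [t]. After a rotation these are [b] and [c], and the
    substitution with sign [1] or [-1] lands in the bounded set [quadX]. *)
Lemma wedge_in_box : T_in_box wedge.
Proof.
have key (t a b c : int) : quadT n t a b c -> wedge t a b c -> (t < b) = (t < c) ->
    [/\ `|t| <= (4 * n)%N%:Z, `|a| <= (4 * n)%N%:Z, `|b| <= (4 * n)%N%:Z & `|c| <= (4 * n)%N%:Z].
  move=> T /and4P[/and4P[? ? ? ?] ? ? ?] same_side.
  have /quadTP[_ _ ? ?] := T.
  have [s [s1 g0 h0]] : exists s : int, [/\ s = 1 \/ s = -1, 0 < s * (c - t) & 0 < s * (b - t)].
    have [ct|ct] := boolP (t < c).
      by exists 1; rewrite !mul1r; split; [left|lia|lia].
    by exists (-1); rewrite !mulN1r; split; [right|lia|lia].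
  have [] := @quadX_bound n (fun _ _ _ _ => true) (b + c) (a + t) (s * (c - t)) (s * (b - t)).
    by rewrite andbT; apply: quadT_phi => //; [nia|lia].
  by move=> ? ? ? ?; case: s1 g0 h0 => es; subst s; split; lia.
move=> t a b c /andP[T Z].
have /quadTP[E ? ? ?] := T; have /and4P[/and4P[? ? ? ?] ? ? ?] := Z.
have [p|[p|p]] : (t < b) = (t < c) \/ (t < c) = (t < a) \/ (t < a) = (t < b).
- by case: (t < a); case: (t < b); case: (t < c); auto.
- exact: key.
- have [|||? ? ? ?] := key t b c a => //; first by apply/quadTP; split; lia.
    by rewrite /wedge; lia.
- have [|||? ? ? ?] := key t c a b => //; first by apply/quadTP; split; lia.
    by rewrite /wedge; lia.
Qed.

(** In [n = (t - c) (t + c) + (b + c) (c + a)] all four factors are positive on the strip, so each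
    of them is at most [n]. *)
Lemma c_strip_in_box : T_in_box c_strip.
Proof.
move=> t a b c /andP[/quadTP[E ? ? ?] /and3P[? ? ?]].
have e0 : 0 <= (t - c) * (t + c) by apply: mulr_ge0; lia.
have f0 : 0 <= (b + c) * (c + a) by apply: mulr_ge0; lia.
have [|||? ?] := @sum_bound n (b + c) (c + a) _ _ _ e0; [lia|lia|by rewrite -E; ring|].
have [|||? ?] := @sum_bound n (t - c) (t + c) _ _ _ f0; [lia|lia|by rewrite -E; ring|].
by split; lia.
Qed.

Lemma pair_sums_gt0 (a b c : int) : 0 <= a -> 0 <= b -> 0 <= c ->
  (0 < a * b + b * c + c * a) = [&& 0 < a + b, 0 < b + c & 0 < c + a].
Proof.
move=> a0 b0 c0; apply/idP/and3P => [H|[]].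
  have [aE|aN] := eqVneq a 0; first by subst a; split; nia.
  have [bE|bN] := eqVneq b 0; first by subst b; split; nia.
  by split; lia.
have ab := mulr_ge0 a0 b0; have bc := mulr_ge0 b0 c0; have ca := mulr_ge0 c0 a0.
have [aE|aN] := eqVneq a 0.
  by move=> ? ? ?; have : 0 < b * c; [apply: mulr_gt0|]; lia.
have [bE|bN] := eqVneq b 0.
  by move=> ? ? ?; have : 0 < c * a; [apply: mulr_gt0|]; lia.
by move=> ? ? ?; have : 0 < a * b; [apply: mulr_gt0|]; lia.
Qed.

Lemma pair_sums_bound (L : nat) (x y z : int) : 0 <= x -> 0 <= y -> 0 <= z ->
  0 < x * y + y * z + z * x -> x * y + y * z + z * x <= L%:Z -> `|x| <= L%:Z.
Proof.
move=> x0 y0 z0; rewrite pair_sums_gt0 // => /and3P[_ yz _].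
have := mulr_ge0 y0 z0; have : 0 <= x * (y + z - 1) by apply: mulr_ge0; lia.
lia.
Qed.

Lemma nonneg_in_box : T_in_box nonneg.
Proof.
move=> t a b c /andP[/quadTP[E ? ? ?] /and4P[? ? ? nt]].
have N0 : 0 <= a * b + b * c + c * a by rewrite !addr_ge0 ?mulr_ge0.
have ? : t ^+ 2 < n%:Z by move/eqP: nt; lia.
have tt : `|t| <= t ^+ 2 by nia.
have ? : `|t| <= n%:Z by lia.
have aux := @pair_sums_bound n.
by split; [lia|have := aux a b c|have := aux b c a|have := aux c a b]; lia.
Qed.

Let B F := bsum (4 * n) (quadT n) F.
Let ind (b : bool) : int := (b : nat)%:Z.

Lemma tcount_ind P : tcount P = B (fun t a b c => ind (P t a b c)).
Proof. by rewrite /B bsum_ind. Qed.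

Lemma B_restrict (P : pred4) F :
  B (fun t a b c => ind (P t a b c) * F t a b c) =
  bsum (4 * n) (fun t a b c => quadT n t a b c && P t a b c) F.
Proof.
rewrite /B /bsum [RHS]big_mkcondr; apply: eq_bigr => x _.
by rewrite /ind; case: (P _ _ _ _); rewrite ?mul1r ?mul0r.
Qed.

Lemma eq_B F G : (forall t a b c, quadT n t a b c -> F t a b c = G t a b c) -> B F = B G.
Proof. by move=> FG; apply: eq_bsum. Qed.

Lemma wedge_rotate F : B (fun t a b c => ind (wedge t a b c) * F t a b c) =
  B (fun t a b c => ind (wedge t a b c) * F t b c a).
Proof.
rewrite !B_restrict.
apply: (reindex_ibox (F := F) (G := fun t a b c => F t b c a)
  (f1 := fun t a b c => t) (f2 := fun t a b c => c) (f3 := fun t a b c => a) (f4 := fun t a b c => b)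
  (g1 := fun t a b c => t) (g2 := fun t a b c => b) (g3 := fun t a b c => c) (g4 := fun t a b c => a) _ _ _ _ (fun _ _ _ _ _ => erefl)).
- exact: wedge_in_box.
- exact: wedge_in_box.
- move=> t a b c /andP[/quadTP[E ? ? ?] Z] /=; split=> //.
  by apply/andP; split; [apply/quadTP; split; lia|move: Z; rewrite /wedge; lia].
- move=> t a b c /andP[/quadTP[E ? ? ?] Z] /=; split=> //.
  by apply/andP; split; [apply/quadTP; split; lia|move: Z; rewrite /wedge; lia].
Qed.

(** The equation is [n = t^2 - c^2 + (a + c) (b + c)]. The involution changes the sign of [c] and
    keeps [a + c] and [b + c], which also define the strip; hence the sum equals its negative. *)
Lemma c_strip_sg : B (fun t a b c => ind (c_strip t a b c) * (ind (0 < c) - ind (c < 0))) = 0.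
Proof.
set S := B _; suff : S = -1 * S by lia.
rewrite /S -bsumM; transitivity (B (fun t a b c => ind (c_strip t a b c) * (ind (c < 0) - ind (0 < c)))); last first.
  by apply: eq_B => t a b c _; ring.
rewrite !B_restrict.
apply: (reindex_ibox (F := fun _ _ _ c => ind (0 < c) - ind (c < 0)) (G := fun _ _ _ c => ind (c < 0) - ind (0 < c))
  (f1 := fun t a b c => t) (f2 := fun t a b c => a + c * 2) (f3 := fun t a b c => b + c * 2) (f4 := fun t a b c => - c)
  (g1 := fun t a b c => t) (g2 := fun t a b c => a + c * 2) (g3 := fun t a b c => b + c * 2) (g4 := fun t a b c => - c)).
- exact: c_strip_in_box.
- exact: c_strip_in_box.
- move=> t a b c /andP[/quadTP[E ? ? ?] Z] /=; split; [|split; lia].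
  by apply/andP; split; [apply/quadTP; split; lia|move: Z; rewrite /c_strip; lia].
- move=> t a b c /andP[/quadTP[E ? ? ?] Z] /=; split; [|split; lia].
  by apply/andP; split; [apply/quadTP; split; lia|move: Z; rewrite /c_strip; lia].
- by move=> t a b c _; rewrite oppr_gt0 oppr_lt0.
Qed.

Lemma t_sign (P : pred4) : T_in_box P ->
  (forall t a b c, P (- t) a b c = P t a b c) ->
  tcount P = tcount (fun t a b c => P t a b c && (t == 0)) + 2 * tcount (fun t a b c => P t a b c && (0 < t)).
Proof.
move=> bP evenP.
have neg : tcount (fun t a b c => P t a b c && (0 < t)) = tcount (fun t a b c => P t a b c && (t < 0)).
  apply: (bcount_bij
    (f1 := fun t a b c => - t) (f2 := fun t a b c => a) (f3 := fun t a b c => b) (f4 := fun t a b c => c)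
    (g1 := fun t a b c => - t) (g2 := fun t a b c => a) (g3 := fun t a b c => b) (g4 := fun t a b c => c)).
  - by move=> t a b c /and3P[T Pt _]; apply: bP; rewrite T.
  - by move=> t a b c /and3P[T Pt _]; apply: bP; rewrite T.
  - move=> t a b c /and3P[/quadTP[E ? ? ?] Pt ?] /=; rewrite evenP Pt; split; last by split; lia.
    by apply/andP; split; [apply/quadTP; split; lia|lia].
  - move=> t a b c /and3P[/quadTP[E ? ? ?] Pt ?] /=; rewrite evenP Pt; split; last by split; lia.
    by apply/andP; split; [apply/quadTP; split; lia|lia].
rewrite (_ : 2 * _ = tcount (fun t a b c => P t a b c && (0 < t)) + tcount (fun t a b c => P t a b c && (t < 0))); last by rewrite -neg; lia.
rewrite !tcount_ind /B -!bsumD; apply: eq_bsum => // t a b c _.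
by case: (P t a b c); case: (ltgtP t 0).
Qed.

(* For [t > 0] and on the wedge, the indicators of [a, b, c >= 0] and of
   [a, b, c > 0] add up to [sgn a + sgn b + sgn c - 1].  Over the larger strip
   [|c| < t] the involution [(t, a + 2c, b + 2c, - c)] cancels [sgn c]. *)
Lemma wedge_count :
  tcount (fun t a b c => nonneg t a b c && (0 < t)) + tcount (fun t a b c => positive t a b c && (0 < t)) =
  2 * tcount (fun t a b c => all_large t a b c && (0 < t)) + 3 * tcount a_small
  - tcount all_small - 3 * tcount c_flip.
Proof.
pose sg (x : int) : int := ind (0 < x) - ind (x < 0).
(* On the wedge at most one of [a, b, c] is not positive. So [sg a + sg b + sg c - 1] is 2, 1 or 0
   when the smallest of them is positive, zero or negative. *)
have E1 : tcount (fun t a b c => nonneg t a b c && (0 < t)) + tcount (fun t a b c => positive t a b c && (0 < t))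
    = B (fun t a b c => ind (wedge t a b c) * (sg a + sg b + sg c - 1)).
  rewrite !tcount_ind -bsumD; apply: eq_B => t a b c /quadTP[E ? ? ?].
  rewrite /nonneg /positive /wedge /sg /ind.
  case: (ltgtP 0 t) => // t0; rewrite ?andbF ?mul0r //= ?andbT.
  have [abc|] := boolP [&& 0 <= a, 0 <= b & 0 <= c]; last by lia.
  case/and3P: abc => a0 b0 c0.
  have -> : (t ^+ 2 != n%:Z) = [&& 0 < a + b, 0 < b + c & 0 < c + a].
    by have := mulr_ge0 a0 b0; have := mulr_ge0 b0 c0; have := mulr_ge0 c0 a0;
       rewrite -pair_sums_gt0 //; lia.
  lia.
have E2 : B (fun t a b c => ind (wedge t a b c) * (sg a + sg b + sg c - 1)) =
    3 * B (fun t a b c => ind (wedge t a b c) * sg c) - B (fun t a b c => ind (wedge t a b c) * 1).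
  have r1 := wedge_rotate (fun t a b c => sg a).
  have r2 := wedge_rotate (fun t a b c => sg b).
  have -> : 3 * B (fun t a b c => ind (wedge t a b c) * sg c) - B (fun t a b c => ind (wedge t a b c) * 1)
     = B (fun t a b c => ind (wedge t a b c) * sg a) + B (fun t a b c => ind (wedge t a b c) * sg b)
     + B (fun t a b c => ind (wedge t a b c) * sg c) + -1 * B (fun t a b c => ind (wedge t a b c) * 1) by lia.
  by rewrite /B -bsumM -!bsumD; apply: eq_bsum => // t a b c _; ring.
(* Above [t] the sign of [c] is 1. Below [t], the strip consists of wedge points and of [c_flip]. On
   [c_flip] one has [2 c > - (a + b) >= 0], so the sign is 1 there too, and the total over the strip
   is 0. *)
have E3 : B (fun t a b c => ind (wedge t a b c) * sg c) =
    B (fun t a b c => ind (wedge t a b c) * ind (t < c)) - tcount c_flip.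
  have := c_strip_sg; rewrite -/sg => s0.
  rewrite -[RHS]addr0 -s0 tcount_ind -mulN1r /B -bsumM -!bsumD.
  apply: eq_bsum => // t a b c /quadTP[_ ? ? ?].
  rewrite /wedge /c_strip /c_flip /sg /ind.
  by case: (ltgtP c t) => ?; case: (ltgtP 0 c) => ?; lia.
(* If [k] of the three numbers [a, b, c] exceed [t], the point contributes [k - 1]. This is 2 on
   [all_large], 1 on [a_small] and its rotations, 0 for [k = 1], and -1 on [all_small]. *)
have E4 : 3 * B (fun t a b c => ind (wedge t a b c) * ind (t < c)) - B (fun t a b c => ind (wedge t a b c) * 1) =
    2 * tcount (fun t a b c => all_large t a b c && (0 < t)) + 3 * tcount a_small - tcount all_small.
  have r1 := wedge_rotate (fun t a b c => ind (t < a)).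
  have r2 := wedge_rotate (fun t a b c => ind (t < b)).
  have r3 := wedge_rotate (fun t a b c => ind (a_small t a b c)).
  have r4 := wedge_rotate (fun t a b c => ind (a_small t b c a)).
  have e3 : tcount a_small = B (fun t a b c => ind (wedge t a b c) * ind (a_small t a b c)).
    by rewrite tcount_ind; apply: eq_B => t a b c _; rewrite /a_small /wedge /ind; lia.
  have -> : 3 * B (fun t a b c => ind (wedge t a b c) * ind (t < c)) - B (fun t a b c => ind (wedge t a b c) * 1)
     = B (fun t a b c => ind (wedge t a b c) * ind (t < a)) + B (fun t a b c => ind (wedge t a b c) * ind (t < b))
     + B (fun t a b c => ind (wedge t a b c) * ind (t < c)) + -1 * B (fun t a b c => ind (wedge t a b c) * 1) by lia.
  have -> : 2 * tcount (fun t a b c => all_large t a b c && (0 < t)) + 3 * tcount a_small - tcount all_small =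
     2 * tcount (fun t a b c => all_large t a b c && (0 < t)) +
     B (fun t a b c => ind (wedge t a b c) * ind (a_small t a b c)) +
     B (fun t a b c => ind (wedge t a b c) * ind (a_small t b c a)) +
     B (fun t a b c => ind (wedge t a b c) * ind (a_small t c a b)) + -1 * tcount all_small by lia.
  rewrite !tcount_ind /B -!bsumM -!bsumD.
  apply: eq_bsum => // t a b c /quadTP[_ ? ? ?].
  have [/and4P[/and4P[t0 ta tb tc] ab bc ca]|Z] := boolP (wedge t a b c); last first.
    have -> : all_large t a b c && (0 < t) = false.
      by apply: contraNF Z; rewrite /wedge /all_large; lia.
    have -> : all_small t a b c = false.
      by apply: contraNF Z; rewrite /wedge /all_small; lia.
    by rewrite /ind /=; lia.
  rewrite /all_large /a_small /all_small t0 ab bc ca !ltr_norml ta tb tc /= !andbT.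
  have -> : - a < t by lia.
  have -> : - b < t by lia.
  have -> : - c < t by lia.
  by rewrite /ind; case: (ltgtP a t) => ?; case: (ltgtP b t) => ?; case: (ltgtP c t) => ?; rewrite //=; lia.
lia.
Qed.

(** The symmetry [t -> - t] doubles [wedge_count]. For [t = 0] the numbers [a, b, c] are odd, so
    [nonneg], [positive] and [all_large] coincide there. *)
Lemma quadT_count :
  tcount nonneg + tcount positive =
  2 * xcount n (fun e f g h => [&& g < e, h < e & e < f + g + h])
  + 6 * xcount n (fun e f g h => f + g + h < e)
  - 2 * xcount n (fun e f g h => [&& g < f, h < f & f < e + g + h])
  - 6 * xcount n (fun e f g h => [&& g < f & f <= h]).
Proof.
have [bL <-] := tcount_all_large; have [_ <-] := tcount_a_small.
have [_ <-] := tcount_all_small; have [_ <-] := tcount_c_flip.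
have bP : T_in_box positive.
  move=> t a b c /andP[T Pt]; apply: nonneg_in_box; rewrite T /=.
  move: T Pt => /quadTP[E _ _ _] /and3P[a0 b0 c0]; rewrite /nonneg.
  by have := mulr_gt0 a0 b0; have := mulr_gt0 b0 c0; have := mulr_gt0 c0 a0; lia.
rewrite (t_sign nonneg_in_box) ?(t_sign bP) ?(t_sign bL); last 3 first.
- by move=> *; rewrite /all_large normrN.
- by [].
- by move=> *; rewrite /nonneg sqrrN.
have W := wedge_count.
have Z1 : tcount (fun t a b c => nonneg t a b c && (t == 0)) =
          tcount (fun t a b c => all_large t a b c && (t == 0)).
  rewrite !tcount_ind; apply: eq_B => t a b c /quadTP[E ? ? ?]; congr ind.
  rewrite /nonneg /all_large; apply/idP/idP.
    by case/andP=> /and4P[? ? ? ?] /eqP t0; subst t; lia.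
  case/andP => /and3P[ta tb tc] /eqP t0; subst t; rewrite normr0 in ta tb tc.
  by have := mulr_gt0 ta tb; have := mulr_gt0 tb tc; have := mulr_gt0 tc ta; lia.
have Z2 : tcount (fun t a b c => positive t a b c && (t == 0)) =
          tcount (fun t a b c => all_large t a b c && (t == 0)).
  by rewrite !tcount_ind; apply: eq_B => t a b c _; congr ind; rewrite /positive /all_large; lia.
lia.
Qed.
End Regions.

(** Here [j] and [c] encode the odd numbers [h = 2 j + 1] and [f = 2 c + 1], and [m] is the number
    of admissible [h]. *)
Lemma sum_odd_indicator (m c : nat) :
  \sum_(j <- iota 0 m) (2 - (j == c)%:Z - 3 * (j < c)%:Z) =
  2 * m%:Z - (c < m)%:Z - 3 * (minn c m)%:Z.
Proof.
elim: m => [|m IHm]; first by rewrite big_nil /=; lia.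
by rewrite -addn1 iotaD big_cat /= IHm big_seq1; lia.
Qed.

(** For [f = g] the equation is [f (e + h) = p^r]. So [f = p^i], [e + h = p^(r - i)], and [h] is any
    odd number below [p^(r - i)]. *)
Lemma xcount_diagonal p r : prime p -> odd p ->
  2 * (2 * xcount (p ^ r) (fun e f g h => f == g)
    - xcount (p ^ r) (fun e f g h => [&& f == g & f == h])
    - 3 * xcount (p ^ r) (fun e f g h => [&& f == g & h < f])) =
  \sum_(i < r.+1) (2 * (p ^ i)%N%:Z - 3 * (p ^ minn i (r - i))%N%:Z) + (~~ odd r)%:Z.
Proof.
move=> p_pr p_odd; have p0 : (0 < p)%N := prime_gt0 p_pr.
have odd_pow i : exists c, (p ^ i = (2 * c).+1)%N.
  by exists (p ^ i)./2; have := odd_double_half (p ^ i); rewrite oddX p_odd orbT; lia.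
have -> : 2 * xcount (p ^ r) (fun e f g h => f == g)
    - xcount (p ^ r) (fun e f g h => [&& f == g & f == h])
    - 3 * xcount (p ^ r) (fun e f g h => [&& f == g & h < f]) =
   bsum (p ^ r) (fun e f g h => quadX (p ^ r) e f g h && (f == g))
     (fun e f g h => 2 - (h == f)%R%:Z - 3 * (h < f)%R%:Z).
  rewrite !xcount_total -[- bsum _ _ _]mulN1r -[- (3 * bsum _ _ _)]mulNr -!bsumM -!bsumD.
  rewrite /bsum [RHS]big_mkcondr; apply: eq_bigr => -[[[e f] g] h] _ /=.
  by rewrite (eq_sym h); case: (f == g) => //=; lia.
pose pr := [seq (i, j) | i <- iota 0 r.+1, j <- iota 0 (p ^ (r - i))./2].
have -> : bsum (p ^ r) (fun e f g h => quadX (p ^ r) e f g h && (f == g))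
     (fun e f g h => 2 - (h == f)%R%:Z - 3 * (h < f)%R%:Z) =
   \sum_(x <- pr | true) (2 - (x.2 == (p ^ x.1)./2)%:Z - 3 * (x.2 < (p ^ x.1)./2)%:Z).
  apply: (reindex_seq
    (f := fun x : int * int * int * int => (logn p (absz x.1.1.2), (absz x.2)./2))
    (g := fun x : nat * nat => ((p ^ (r - x.1))%N%:Z - (2 * x.2).+1%:Z, (p ^ x.1)%N%:Z, (p ^ x.1)%N%:Z, (2 * x.2).+1%:Z))).
  - exact: ibox_uniq.
  - by apply: allpairs_uniq_dep => [|i _|[a b] [c d] _ _ /= [-> ->]] //; apply: iota_uniq.
  - case=> [[[e f] g] h] _ /= /andP[/quadXP[[e0 f0 g0 h0] E [? ? ? ?]] /eqP fg]; subst g.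
    have fE : ((absz f) * absz (e + h)%R = p ^ r)%N by apply/eqP; rewrite -eqz_nat PoszM; apply/eqP; rewrite -E; lia.
    have /(dvdn_pfactor _ _ p_pr)[i i_le fi] : (absz f %| p ^ r)%N by rewrite -fE dvdn_mulr.
    have fi' : f = (p ^ i)%N%:Z by rewrite -fi; lia.
    have eh : absz (e + h) = (p ^ (r - i))%N.
      apply/eqP; rewrite -(@eqn_pmul2l (p ^ i)) ?expn_gt0 ?p0 // -expnD subnKC // -fi; exact/eqP.
    have [c cE] := odd_pow i; have [d dE] := odd_pow (r - i)%N.
    rewrite fi pfactorK //; split=> //.
    + apply/allpairsPdep; exists i, (absz h)./2; split=> //; rewrite ?mem_iota //.
      by lia.
    + rewrite -eh fi' {2}(_ : (2 * (absz h)./2).+1%:Z = h); last by lia.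
      by congr (_, _, _, _); lia.
    + by rewrite fi' cE; lia.
  - case=> i0 j0 /allpairsPdep[i [j [i_le j_lt [-> ->]]]] _.
    rewrite !mem_iota in i_le j_lt.
    have [c cE] := odd_pow i; have [d dE] := odd_pow (r - i)%N.
    have pE : (p ^ r = p ^ i * p ^ (r - i))%N by rewrite -expnD subnKC //; lia.
    have X : quadX (p ^ r) ((p ^ (r - i))%N%:Z - (2 * j).+1%:Z) (p ^ i)%N%:Z (p ^ i)%N%:Z (2 * j).+1%:Z.
      apply/quadXP; split; last by split; lia.
        by split; lia.
      by rewrite pE PoszM; ring.
    split=> /=.
    + by apply: (in_iboxP (@quadX_bound (p ^ r) (fun _ _ _ _ => true))); rewrite X.
    + by rewrite X eqxx.
    + by rewrite /= pfactorK //; congr (_, _); lia.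
rewrite big_allpairs_dep /=.
have -> : \sum_(i < r.+1) (2 * (p ^ i)%N%:Z - 3 * (p ^ minn i (r - i))%N%:Z) =
   \sum_(i < r.+1) (2 * (p ^ (r - i))%N%:Z - 3 * (p ^ minn i (r - i))%N%:Z).
  rewrite !sumrB; congr (_ - _); rewrite [LHS](reindex_inj rev_ord_inj) /=.
  by apply: eq_bigr => i _; rewrite subSS.
(* Rounding the halves of odd powers leaves [1 - 2 [i < r - i]] for each [i]. Indices below and
   above the middle cancel, and the middle one exists for even [r] only. *)
have -> : ((~~ odd r)%:Z : int) = \sum_(i < r.+1) (1 - 2 * (i < r - i)%N%:Z).
  rewrite -(big_mkord xpredT (fun i => 1 - 2 * (i < r - i)%N%:Z)).
  rewrite (@big_cat_nat _ _ _ (r.+1)./2) //=; last by lia.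
  rewrite big_nat (eq_bigr (fun=> -1)); last by move=> i Hi; lia.
  rewrite -big_nat [X in _ + X]big_nat [X in _ + X](eq_bigr (fun=> 1)); last by move=> i Hi; lia.
  by rewrite -big_nat !sumr_const_nat; lia.
rewrite -big_split /= -(big_mkord xpredT (fun i => 2 * (p ^ (r - i))%N%:Z - 3 * (p ^ minn i (r - i))%N%:Z + (1 - 2 * (i < r - i)%N%:Z))).
rewrite mulr_sumr /index_iota subn0; rewrite big_seq [RHS]big_seq.
apply: eq_bigr => i; rewrite -[_ :: _]/(iota 0 r.+1) mem_iota => i_le.
rewrite sum_odd_indicator.
have [c cE] := odd_pow i; have [d dE] := odd_pow (r - i)%N.
have p1 : (1 < p)%N := prime_gt1 p_pr.
have := ltn_exp2l i (r - i) p1; rewrite cE dE => lt_cd.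
have -> : (p ^ minn i (r - i) = minn (p ^ i) (p ^ (r - i)))%N.
  by rewrite /minn ltn_exp2l //; case: ifP.
rewrite cE dE; lia.
Qed.

(** * Reduced binary quadratic forms *)

Definition bqf_tuple (Q : bqf) : int * int * int := (qf_a Q, qf_b Q, qf_c Q).
Definition tuple_bqf (t : int * int * int) : bqf := Bqf t.1.1 t.1.2 t.2.
Lemma bqf_tupleK : cancel bqf_tuple tuple_bqf. Proof. by case. Qed.
HB.instance Definition _ := Choice.copy bqf (can_type bqf_tupleK).

Lemma bqf_eqP a b c a' b' c' : Bqf a b c = Bqf a' b' c' <-> [/\ a = a', b = b' & c = c'].
Proof. by split=> [[]|[-> -> ->]]. Qed.

(* [(x, y, z, w)] is the matrix with rows [(x, y)] and [(z, w)]. *)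
Notation mat2 := (int * int * int * int)%type.
Definition mdet (g : mat2) : int := let: (x, y, z, w) := g in x * w - y * z.
Definition mmul (g h : mat2) : mat2 :=
  let: (x, y, z, w) := g in let: (x', y', z', w') := h in
  (x * x' + y * z', x * y' + y * w', z * x' + w * z', z * y' + w * w').
Definition madj (g : mat2) : mat2 := let: (x, y, z, w) := g in (w, - y, - z, x).
Definition mone : mat2 := (1, 0, 0, 1).

(** This is the substitution [Q(x u + y v, z u + w v)], a right action. Plain quadruples keep every
    identity within reach of [ring]. *)
Definition act (Q : bqf) (g : mat2) : bqf :=
  let: Bqf a b c := Q in let: (x, y, z, w) := g in
  Bqf (a * x ^+ 2 + b * x * z + c * z ^+ 2)
      (2 * a * x * y + b * (x * w + y * z) + 2 * c * z * w)
      (a * y ^+ 2 + b * y * w + c * w ^+ 2).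

Definition bqf_scale (k : int) (Q : bqf) : bqf :=
  Bqf (k * qf_a Q) (k * qf_b Q) (k * qf_c Q).

Lemma act1 Q : act Q mone = Q.
Proof. by case: Q => a b c; apply/bqf_eqP; split; ring. Qed.

Lemma actM Q g h : act Q (mmul g h) = act (act Q g) h.
Proof.
by case: Q g h => a b c [[[? ?] ?] ?] [[[? ?] ?] ?]; apply/bqf_eqP; split; ring.
Qed.

Lemma act_scale k Q g : act (bqf_scale k Q) g = bqf_scale k (act Q g).
Proof. by case: Q g => a b c [[[? ?] ?] ?]; apply/bqf_eqP; split=> /=; ring. Qed.

Lemma mmulA g h k : mmul g (mmul h k) = mmul (mmul g h) k.
Proof.
by case: g h k => [[[? ?] ?] ?] [[[? ?] ?] ?] [[[? ?] ?] ?]; congr (_, _, _, _); ring.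
Qed.

Lemma mdetM g h : mdet (mmul g h) = mdet g * mdet h.
Proof. by case: g h => [[[? ?] ?] ?] [[[? ?] ?] ?] /=; ring. Qed.

Lemma mmul1m g : mmul mone g = g.
Proof. by case: g => [[[? ?] ?] ?]; congr (_, _, _, _); ring. Qed.

Lemma mdet_adj g : mdet (madj g) = mdet g.
Proof. by case: g => [[[? ?] ?] ?] /=; ring. Qed.

Lemma madjK : involutive madj.
Proof. by case=> [[[? ?] ?] ?] /=; rewrite !opprK. Qed.

Lemma mmul_adj g : mdet g = 1 -> mmul g (madj g) = mone.
Proof. by case: g => [[[x y] z] w] /= e; congr (_, _, _, _); lia. Qed.

Lemma mmul_adj_l g : mdet g = 1 -> mmul (madj g) g = mone.
Proof. by case: g => [[[x y] z] w] /= e; congr (_, _, _, _); lia. Qed.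

Lemma act_adj Q g : act (act Q g) (madj g) = bqf_scale (mdet g ^+ 2) Q.
Proof. by case: Q g => a b c [[[x y] z] w]; apply/bqf_eqP; split=> /=; ring. Qed.

Lemma qf_disc_act Q g : qf_disc (act Q g) = mdet g ^+ 2 * qf_disc Q.
Proof. by case: Q g => a b c [[[x y] z] w]; rewrite /qf_disc /=; ring. Qed.

Lemma qf_disc_scale k Q : qf_disc (bqf_scale k Q) = k ^+ 2 * qf_disc Q.
Proof. by rewrite /qf_disc /=; ring. Qed.

Lemma bqf_scale_inj k : k != 0 -> injective (bqf_scale k).
Proof.
by move=> k0 [a b c] [a' b' c'] /bqf_eqP[/(mulfI k0) /= -> /(mulfI k0) /= -> /(mulfI k0) /= ->].
Qed.

Definition reduced (Q : bqf) : bool :=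
  let: Bqf a b c := Q in
  [&& 0 < a, - a < b, b <= a, a <= c & (a == c) ==> (0 <= b)].

Definition square_type (Q : bqf) : bool := (qf_b Q == 0) && (qf_a Q == qf_c Q).
Definition hexagonal_type (Q : bqf) : bool := (qf_a Q == qf_b Q) && (qf_b Q == qf_c Q).

(** These are the proper automorphs of a reduced form: [1] and [-1], two elements of order 4 for the
    square type, and four of order 3 or 6 for the hexagonal type. *)
Definition auts (Q : bqf) : seq mat2 :=
  [:: (1, 0, 0, 1); (-1, 0, 0, -1)] ++
  (if square_type Q then [:: (0, -1, 1, 0); (0, 1, -1, 0)] else [::]) ++
  (if hexagonal_type Q then
     [:: (0, -1, 1, 1); (0, 1, -1, -1); (1, 1, -1, 0); (-1, -1, 1, 0)] else [::]).

(** The new leading coefficient is [a x^2 + b x z + c z^2 >= a (x^2 - |x z| + z^2)]. If it is at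
    most [a], then [|x|] and [|z|] are at most 1, and a finite check remains. *)
Lemma reduced_act_le Q g : reduced Q -> reduced (act Q g) -> mdet g = 1 ->
  qf_a (act Q g) <= qf_a Q -> act Q g = Q /\ g \in auts Q.
Proof.
case: Q g => a b c [[[x y] z] w] /and5P[a0 lb ub ac bnd] red' /= det1 le_a.
have [xs zs] : `|x| <= 1 /\ `|z| <= 1.
  have h1 : - a * `|x * z| <= b * x * z.
    have : `|b * (x * z)| <= a * `|x * z| by rewrite normrM ler_wpM2r //; lia.
    rewrite -mulrA; lia.
  have h2 : a * z ^+ 2 <= c * z ^+ 2 by rewrite ler_wpM2r // sqr_ge0.
  have h3 : a * (x ^+ 2 - `|x * z| + z ^+ 2) <= a * 1 by lia.
  move: h3; rewrite ler_pM2l // normrM.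
  rewrite -[x ^+ 2]real_normK ?num_real // -[z ^+ 2]real_normK ?num_real //.
  have := normr_ge0 x; have := normr_ge0 z; move: `|x| `|z| => p q q0 p0 h.
  have h4 := sqr_ge0 (p - q).
  have p2 : p ^+ 2 + q ^+ 2 <= 2 by lia.
  have := sqr_ge0 p; have := sqr_ge0 q.
  by clear - p2 q0 p0; split; nia.
move: red'; rewrite /reduced /=; 
move: le_a; move a'E : (a * x ^+ 2 + b * x * z + c * z ^+ 2) => a'.
move b'E : (2 * a * x * y + b * (x * w + y * z) + 2 * c * z * w) => b'.
move c'E : (a * y ^+ 2 + b * y * w + c * w ^+ 2) => c' le_a.
case/and5P=> a0' lb' ub' ac' bnd'.
rewrite /auts /square_type /hexagonal_type /= in_cons.
have [z0|z0] := eqVneq z 0.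
  subst z; have [xw|xw] : (x = 1 /\ w = 1) \/ (x = -1 /\ w = -1).
    have [e|[e|e]] : x = 0 \/ x = 1 \/ x = -1 by lia.
    - by subst x; lia.
    - by subst x; left; lia.
    - by subst x; right; lia.
  - case: xw => ? ?; subst x w.
    have y0 : y = 0 by nia.
    by subst y; rewrite eqxx; split=> //; apply/bqf_eqP; rewrite -a'E -b'E -c'E; split; ring.
  - case: xw => ? ?; subst x w.
    have y0 : y = 0 by nia.
    by subst y; rewrite !in_cons; split=> //; apply/bqf_eqP; rewrite -a'E -b'E -c'E; split; ring.
have z12 : z = 1 \/ z = -1 by clear - zs z0; lia.
have [x0|x0] := eqVneq x 0.
  subst x; have z2 : z ^+ 2 = 1 by case: z12 => ->.
  have aE : a' = c by rewrite -a'E z2; ring.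
  have ca : c = a by lia.
  have b0' : 0 <= b by move: bnd; rewrite ca eqxx.
  rewrite ca in aE; subst c.
  have yz : y = - z by case: z12 => e; subst z; lia.
  subst y; set k := z * w.
  have bE : b' = - b * z ^+ 2 + 2 * a * k by rewrite -b'E /k; ring.
  have cE : c' = a * z ^+ 2 - b * k + a * k ^+ 2.
    have w2 : w ^+ 2 = k ^+ 2 by rewrite /k exprMn z2 mul1r.
    by rewrite -c'E w2 /k; ring.
  rewrite z2 in bE cE.
  have [k0|k1] : k = 0 \/ k = 1 by clear cE; nia.
    have w0 : w = 0 by move/eqP: k0; rewrite mulf_eq0 (negbTE z0) => /eqP.
    have c'a : c' = a by rewrite cE k0; ring.
    have b0 : b = 0 by move: bnd'; rewrite aE c'a eqxx /= bE k0; lia.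
    subst b w; rewrite eqxx /= aE c'a bE k0 !(oppr0, mul0r, mulr0, addr0); split=> //.
    case: z12 => ->.
      by rewrite !in_cons !eqxx !orbT.
    by rewrite !in_cons !eqxx !orbT.
  have ba : b = a by move: ub' ; rewrite aE bE k1; lia.
  have wz : w = z by case: z12 => e; subst z; rewrite /k in k1; lia.
  subst b w; rewrite aE bE cE k1; split; first by apply/bqf_eqP; split; ring.
  by rewrite !eqxx (gt_eqF a0) /=; case: z12 => ->; rewrite !in_cons !eqxx !orbT.
have xz : x = - z.
  have [//|xz] : x = - z \/ x = z by clear - xs z12 x0; case: z12; lia.
  subst x; have : a' = a + b + c by rewrite -a'E; case: z12 => ->; ring.
  by lia.
subst x; have aE : a' = a - b + c.
  by rewrite -a'E; case: z12 => ->; ring.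
have [ba ca] : b = a /\ c = a by lia.
subst b c; have wz : w = - z - y by case: z12 => e; subst z; lia.
subst w; have bE : b' = a * (- 2 * y * z - 1).
  by rewrite -b'E; case: z12 => ->; ring.
have yz : y = - z.
  by rewrite bE aE in lb' ub'; clear - lb' ub' a0 z12; case: z12 => e; subst z; nia.
subst y; split.
  by apply/bqf_eqP; rewrite -a'E -b'E -c'E; case: z12 => ->; split; ring.
rewrite !eqxx (gt_eqF a0) /=.
by case: z12 => ->; rewrite !in_cons !eqxx !orbT.
Qed.

(** If the leading coefficient grows, the inverse [madj g] lowers it, and the preceding lemma
    applied to the inverse gives a contradiction. *)
Lemma reduced_act Q g : reduced Q -> reduced (act Q g) -> mdet g = 1 ->
  act Q g = Q /\ g \in auts Q.
Proof.
move=> red red' det1.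
have [le|lt] := leP (qf_a (act Q g)) (qf_a Q); first exact: reduced_act_le.
have Qg : act (act Q g) (madj g) = Q by rewrite -actM mmul_adj // act1.
have [||//|Q_eq _] := reduced_act_le red' (g := madj g); rewrite ?Qg ?mdet_adj //.
  exact: ltW.
by move: lt; rewrite -Q_eq Qg ltxx.
Qed.

Lemma auts_det Q g : g \in auts Q -> mdet g = 1.
Proof.
by rewrite /auts !mem_cat !in_cons orbF; case: ifP => _; case: ifP => _;
  rewrite ?in_cons ?in_nil ?orbF -?orbA; do ?case/predU1P => [->//|]; move/eqP=> ->.
Qed.

Lemma auts_act Q g : g \in auts Q -> act Q g = Q.
Proof.
case: Q => a b c; rewrite /auts !mem_cat => /or3P[]; first last.
- case: ifP => // /andP[/= /eqP <- /eqP <-]; rewrite !in_cons orbF.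
  by case/or4P => /eqP ->; apply/bqf_eqP; split; ring.
- case: ifP => // /andP[/= /eqP -> /eqP <-]; rewrite !in_cons orbF.
  by case/orP => /eqP ->; apply/bqf_eqP; split; ring.
by rewrite !in_cons orbF; case/orP => /eqP ->; apply/bqf_eqP; split; ring.
Qed.

Definition weight (Q : bqf) : nat :=
  if square_type Q then 2 else if hexagonal_type Q then 3 else 1.

Lemma size_auts Q : reduced Q -> size (auts Q) = (2 * weight Q)%N.
Proof.
case: Q => a b c /and5P[a0 _ _ _ _]; rewrite /auts /weight !size_cat.
case: (boolP (square_type _)) => [/andP[/= /eqP b0 _]|_]; last by case: ifP.
by rewrite ifF // /hexagonal_type /= b0 (gt_eqF a0).
Qed.

Lemma auts_uniq Q : reduced Q -> uniq (auts Q).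
Proof.
case: Q => a b c /and5P[a0 _ _ _ _]; rewrite /auts.
case: (boolP (square_type _)) => [/andP[/= /eqP b0 _]|_]; last by case: ifP.
by rewrite ifF // /hexagonal_type /= b0 (gt_eqF a0).
Qed.

Lemma reduce_bqf Q : 0 < qf_a Q -> qf_disc Q < 0 ->
  exists2 g, mdet g = 1 & reduced (act Q g).
Proof.
have [n] := ubnP (absz (qf_a Q)); elim: n Q => // n IHn Q Qn a0 D0.
have [k red_b] : exists k, - qf_a Q < qf_b Q + 2 * qf_a Q * k <= qf_a Q.
  (* With [b + a - 1 = 2 a q + m] and [0 <= m < 2 a], the number [b - 2 a q = m - a + 1] lies in the
     interval from [- a] (excluded) to [a]. *)
  exists (- ((qf_b Q + qf_a Q - 1) %/ (2 * qf_a Q))%Z).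
  have := divz_eq (qf_b Q + qf_a Q - 1) (2 * qf_a Q).
  have := @modz_ge0 (qf_b Q + qf_a Q - 1) (2 * qf_a Q).
  have := @ltz_pmod (qf_b Q + qf_a Q - 1) (2 * qf_a Q).
  move: (_ %/ _)%Z (_ %% _)%Z => q m; lia.
pose Q1 := act Q (1, k, 0, 1).
have a1 : qf_a Q1 = qf_a Q by rewrite /Q1; case: (Q) => a b c /=; ring.
have b1 : qf_b Q1 = qf_b Q + 2 * qf_a Q * k by rewrite /Q1; case: (Q) => a b c /=; ring.
have D1 : qf_disc Q1 = qf_disc Q by rewrite qf_disc_act /=; ring.
have wlog_red : (exists2 g, mdet g = 1 & reduced (act Q1 g)) ->
    exists2 g, mdet g = 1 & reduced (act Q g).
  case=> g g1 redg; exists (mmul (1, k, 0, 1) g); last by rewrite actM.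
  by rewrite mdetM g1 /=; ring.
apply: wlog_red; move: D0; rewrite -D1; move: red_b; rewrite -b1 -a1 => red_b D0.
move: a0 Qn; rewrite -a1; move: Q1 red_b D0 {a1 b1 D1} => [a b c] /andP[lb ub] D0 a0 an.
rewrite /qf_disc /= in lb ub D0 a0 an.
have [ca|ac] := ltP c a.
  have c0 : 0 < c by nia.
  have [|||g g1 redg] := IHn (act (Bqf a b c) (0, -1, 1, 0)).
  - by rewrite /=; lia.
  - by rewrite /=; lia.
  - by rewrite qf_disc_act /qf_disc /=; lia.
  exists (mmul (0, -1, 1, 0) g); last by rewrite actM.
  by rewrite mdetM g1.
have [/andP[/eqP ac' b0]|nb] := boolP ((a == c) && (b < 0)).
  by exists (0, -1, 1, 0) => //; rewrite /reduced /=; lia.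
by exists mone => //; rewrite act1 /reduced /=; lia.
Qed.

Definition reduced_forms (N : nat) : seq bqf :=
  [seq Q <- [seq tuple_bqf t | t <- allpairs pair (allpairs pair (irange N) (irange N)) (irange N)]
   | reduced Q && (qf_disc Q == - N%:Z)].

Lemma reduced_forms_uniq N : uniq (reduced_forms N).
Proof.
rewrite filter_uniq // map_inj_uniq; last by case=> [[? ?] ?] [[? ?] ?] [-> -> ->].
by do 2?apply: allpairs_pair_uniq; apply: irange_uniq.
Qed.

(** A reduced form satisfies [b^2 <= a^2 <= a c], so [3 a c <= N] and the finite box of
    [reduced_forms] misses nothing. *)
Lemma mem_reduced_forms N Q :
  (Q \in reduced_forms N) = reduced Q && (qf_disc Q == - N%:Z).
Proof.
rewrite mem_filter andbC; apply: andb_idl => /andP[].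
case: Q => a b c /and5P[a0 lb ub ac _] /eqP D; rewrite /qf_disc /= in D.
apply/mapP; exists (a, b, c) => //; rewrite !mem_allpairs_pair !mem_irange.
have h : b ^+ 2 <= a ^+ 2 by clear - lb ub a0; nia.
have h2 : a * a <= a * c by rewrite ler_pM2l.
have h3 : c <= a * c by clear - a0 ac; nia.
lia.
Qed.

Lemma det_mx22 (R : comPzRingType) (M : 'M[R]_2) : \det M = M 0 0 * M 1 1 - M 0 1 * M 1 0.
Proof.
rewrite (expand_det_row _ 0) !big_ord_recl big_ord0 /cofactor !det_mx11 !mxE /=.
have -> : lift 0 0 = 1 :> 'I_2 by apply/val_inj.
have -> : lift 1 0 = 0 :> 'I_2 by apply/val_inj.
by rewrite addr0 expr0 expr1 mul1r mulN1r mulrN.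
Qed.

Lemma SL2Z_equivP Q Q' : SL2Z_equiv Q Q' <-> exists2 g, mdet g = 1 & Q' = act Q g.
Proof.
split=> [[g g1 gQ]|[[[[x y] z] w] g1 ->]].
  exists (g 0 0, g 0 1, g 1 0, g 1 1); first by rewrite -g1 det_mx22.
  have := gQ 1 0; have := gQ 0 1; have := gQ 1 1.
  case: Q Q' {gQ} => a b c [a' b' c']; rewrite /qf_eval /= {g1}.
  move: (g 0 0) (g 0 1) (g 1 0) (g 1 1) => x y z w e1 e2 e3.
  have eA : a' = a * x ^+ 2 + b * x * z + c * z ^+ 2 by transitivity (a' * 1 ^+ 2 + b' * 1 * 0 + c' * 0 ^+ 2); [ring|rewrite e3; ring].
  have eC : c' = a * y ^+ 2 + b * y * w + c * w ^+ 2 by transitivity (a' * 0 ^+ 2 + b' * 0 * 1 + c' * 1 ^+ 2); [ring|rewrite e2; ring].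
  apply/bqf_eqP; split=> //.
  transitivity (a' * 1 ^+ 2 + b' * 1 * 1 + c' * 1 ^+ 2 - a' - c'); first ring.
  by rewrite e1 eA eC; ring.
pose M : 'M[int]_2 := \matrix_(i, j) if i == 0 then if j == 0 then x else y else if j == 0 then z else w.
exists M; first by rewrite det_mx22 !mxE.
by case: Q => a b c u v; rewrite !mxE /qf_eval /=; ring.
Qed.

Lemma pos_definiteP Q : qf_disc Q < 0 -> pos_definite Q <-> 0 < qf_a Q.
Proof.
case: Q => a b c; rewrite /qf_disc /pos_definite /qf_eval /= => D0; split=> [pd|a0 x y xy].
  by have := pd 1 0 isT; lia.
have [y0|y0] := eqVneq y 0.
  have x0 : x != 0 by move: xy; rewrite y0 xpair_eqE eqxx andbT.
  by have : 0 < a * x ^+ 2; [rewrite mulr_gt0 // exprn_even_gt0|subst y; lia].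
have y2 : 0 < y ^+ 2 by rewrite exprn_even_gt0.
have h1 := sqr_ge0 (2 * a * x + b * y).
have h2 : 0 < (4 * a * c - b ^+ 2) * y ^+ 2 by rewrite mulr_gt0 //; lia.
have : 0 < 4 * a * (a * x ^+ 2 + b * x * y + c * y ^+ 2) by lia.
by rewrite pmulr_rgt0 //; lia.
Qed.

Lemma reduced_pos_definite N Q : (0 < N)%N -> Q \in reduced_forms N ->
  pos_definite Q /\ qf_disc Q = - N%:Z.
Proof.
move=> N0; rewrite mem_reduced_forms => /andP[red /eqP D]; split=> //.
apply/pos_definiteP; first by rewrite D; lia.
by case: Q red {D} => a b c /and5P[].
Qed.

Lemma qf_classE Q Q' : SL2Z_equiv Q Q' -> qf_class Q = qf_class Q'.
Proof.
case/SL2Z_equivP => g g1 ->; apply/seteqP; split=> P /SL2Z_equivP[h h1 ->]; apply/SL2Z_equivP.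
  by exists (mmul (madj g) h); rewrite ?mdetM ?mdet_adj ?g1 ?h1 // -actM mmulA mmul_adj // mmul1m.
by exists (mmul g h); rewrite ?mdetM ?g1 ?h1 // actM.
Qed.

Lemma qf_class_reduced_inj Q Q' : reduced Q -> reduced Q' -> qf_class Q = qf_class Q' -> Q = Q'.
Proof.
move=> red red' cE.
have : qf_class Q Q' by rewrite cE; apply/SL2Z_equivP; exists mone; rewrite ?act1.
by case/SL2Z_equivP => g g1 Q'E; subst Q'; have [] := reduced_act red red' g1.
Qed.

Lemma qf_classes_image N : (0 < N)%N ->
  qf_classes (- N%:Z) = (@qf_class @` [set` reduced_forms N])%classic.
Proof.
move=> N0; apply/seteqP; split=> _ [Q /= Qp <-]; last first.
  by exists Q => //=; apply: reduced_pos_definite.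
case: Qp => pd D; have D0 : qf_disc Q < 0 by rewrite D; lia.
have [|g g1 red] := @reduce_bqf Q _ D0; first exact/pos_definiteP.
exists (act Q g); first by rewrite /= mem_reduced_forms red qf_disc_act g1 D expr1n mul1r eqxx.
by apply/esym/qf_classE/SL2Z_equivP; exists g.
Qed.

(** The forms [a (x^2 + y^2)] and [a (x^2 + x y + y^2)] are themselves reduced once [a > 0]. By
    uniqueness of the reduced form, a class contains one of them only as its reduced
    representative. *)
Lemma omega_reduced Q : reduced Q -> omega (qf_class Q) = weight Q.
Proof.
move=> red.
have a0 (Q' : bqf) g : mdet g = 1 -> Q' = act Q g -> 0 < qf_a Q'.
  move=> g1 ->; have := red; case: (Q) g g1 => a b c [[[x y] z] w] /= g1 /and5P[a0 lb ub ac _].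
  have [z0|z0] := eqVneq z 0.
    have x0 : x != 0 by apply: contra_eq_neq g1 => ->; rewrite z0; lia.
    by have : 0 < a * x ^+ 2; [rewrite mulr_gt0 // exprn_even_gt0|subst z; lia].
  have z2 : 0 < z ^+ 2 by rewrite exprn_even_gt0.
  have h1 := sqr_ge0 (2 * a * x + b * z).
  have h3 : 0 < 4 * a * c - b ^+ 2 by clear - a0 lb ub ac; nia.
  have h2 : 0 < (4 * a * c - b ^+ 2) * z ^+ 2 by rewrite mulr_gt0.
  have : 0 < 4 * a * (a * x ^+ 2 + b * x * z + c * z ^+ 2) by lia.
  by rewrite pmulr_rgt0 //; lia.
rewrite /omega /weight.
have -> : `[< exists a, qf_class Q (Bqf a 0 a) >] = square_type Q.
  apply/asboolP/idP => [[a /SL2Z_equivP[g g1 QE]]|].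
    have /= a1 := a0 _ _ g1 QE; have [|<- _] := reduced_act red _ g1.
      by rewrite -QE /reduced /= eqxx /=; lia.
    by rewrite -QE /square_type /= !eqxx.
  case: Q {red a0} => a b c /andP[/= /eqP -> /eqP <-]; exists a.
  by apply/SL2Z_equivP; exists mone; rewrite ?act1.
have -> : `[< exists a, qf_class Q (Bqf a a a) >] = hexagonal_type Q.
  apply/asboolP/idP => [[a /SL2Z_equivP[g g1 QE]]|].
    have /= a1 := a0 _ _ g1 QE; have [|<- _] := reduced_act red _ g1.
      by rewrite -QE /reduced /= eqxx /=; lia.
    by rewrite -QE /hexagonal_type /= !eqxx.
  case: Q {red a0} => a b c /andP[/= /eqP <- /eqP <-]; exists a.
  by apply/SL2Z_equivP; exists mone; rewrite ?act1.
by [].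
Qed.

Definition class_number (N : nat) : rat := \sum_(Q <- reduced_forms N) (weight Q)%:R^-1.

Lemma hurwitz0 : hurwitz 0 = - 12%:R^-1.
Proof. by rewrite /hurwitz eqxx. Qed.

Lemma hurwitz_neg (x : int) : x < 0 -> hurwitz x%:~R = 0.
Proof.
move=> x0; rewrite /hurwitz ifF ?ifF //; first by rewrite ltr0z; lia.
by rewrite intr_eq0; lia.
Qed.

Lemma disc_mod4 (N : nat) Q : qf_disc Q = - N%:Z -> (- N%:Z %% 4)%Z \in [:: 0; 1].
Proof.
case: Q => a b c; rewrite /qf_disc /= => <-.
have -> : (b ^+ 2 - 4 * a * c)%R = (- a * c) * 4 + b ^+ 2 by ring.
rewrite modzMDl !in_cons orbF.
have : b = 2 * (b %/ 2)%Z \/ b = 2 * (b %/ 2)%Z + 1 by lia.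
move: (b %/ 2)%Z => q [->|->].
  by rewrite (_ : _ ^+ 2 = q ^+ 2 * 4) ?modzMl //; ring.
by rewrite (_ : _ ^+ 2 = (q ^+ 2 + q) * 4 + 1) ?modzMDl ?orbT //; ring.
Qed.

Lemma hurwitz_class_number N : (0 < N)%N -> hurwitz N%:R = class_number N.
Proof.
move=> N0; rewrite /hurwitz pnatr_eq0 eqn0Ngt N0 /= natr_int ltr0n N0 /=.
rewrite -[N%:R]/(N%:~R : rat) numq_int.
case: ifP => [_|D4].
  rewrite qf_classes_image // fsbig_image; last first.
    move=> Q Q'; rewrite !mem_setE !mem_reduced_forms => /andP[? _] /andP[? _].
    exact: qf_class_reduced_inj.
  rewrite -fsbig_seq ?reduced_forms_uniq //= [LHS]big_seq [RHS]big_seq.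
  by apply: eq_bigr => Q; rewrite mem_reduced_forms => /andP[red _]; rewrite omega_reduced.
rewrite /class_number big_seq big1 // => Q; rewrite mem_reduced_forms => /andP[_ /eqP /disc_mod4].
by rewrite D4.
Qed.

(** * The Hecke relation for class numbers *)

(** One reducing matrix is fixed for each form; the default [mone] is never taken for a positive
    definite form. *)
Definition reducer (Q : bqf) : mat2 :=
  xget mone [set g : mat2 | mdet g = 1 /\ reduced (act Q g)]%classic.

Definition reduction (Q : bqf) : bqf := act Q (reducer Q).

Definition posdef (Q : bqf) := (0 < qf_a Q) && (qf_disc Q < 0).

Lemma reducerP Q : posdef Q -> mdet (reducer Q) = 1 /\ reduced (reduction Q).
Proof.
case/andP=> a0 D0; have [g g1 red] := reduce_bqf a0 D0.
by rewrite /reduction /reducer; case: xgetP => [h -> []|/(_ g)] //; case.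
Qed.

Lemma reduced_posdef Q : reduced Q -> posdef Q.
Proof.
case: Q => a b c /and5P[a0 lb ub ac _]; rewrite /posdef /qf_disc /= a0 /=.
by clear - a0 lb ub ac; nia.
Qed.

Lemma posdef_act Q g : mdet g != 0 -> posdef Q -> posdef (act Q g).
Proof.
move=> g0 /andP[a0 D0]; rewrite /posdef qf_disc_act pmulr_rlt0 ?exprn_even_gt0 // D0 andbT.
case: Q g a0 D0 g0 => a b c [[[x y] z] w]; rewrite /qf_disc /= => a0 D0 g0.
have [z0|z0] := eqVneq z 0.
  have x0 : x != 0 by apply: contraNneq g0 => ->; rewrite z0; lia.
  by have : 0 < a * x ^+ 2; [rewrite mulr_gt0 // exprn_even_gt0|subst z; lia].
have z2 : 0 < z ^+ 2 by rewrite exprn_even_gt0.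
have h1 := sqr_ge0 (2 * a * x + b * z).
have h2 : 0 < (4 * a * c - b ^+ 2) * z ^+ 2 by rewrite mulr_gt0 //; lia.
have : 0 < 4 * a * (a * x ^+ 2 + b * x * z + c * z ^+ 2) by lia.
by rewrite pmulr_rgt0 //; lia.
Qed.

Section Prime.
Variables (p : nat) (p_pr : prime p).

(* Right coset representatives of the integral matrices of determinant [p]
   modulo [SL2(Z)], indexed by the projective line over [F_p]. *)
Definition hecke_rep (i : nat) : mat2 :=
  if i == p then (1, 0, 0, p%:Z) else (p%:Z, i%:Z, 0, 1).

Lemma mdet_hecke_rep i : mdet (hecke_rep i) = p%:Z.
Proof. by rewrite /hecke_rep; case: ifP => _ /=; ring. Qed.

Let p_neq0 : p%:Z != 0. Proof. by rewrite eqz_nat -lt0n prime_gt0. Qed.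

Lemma prime_dvdzM (x y : int) : (p %| x * y)%Z = (p %| x)%Z || (p %| y)%Z.
Proof. by rewrite !dvdzE abszM Euclid_dvdM. Qed.

Lemma modp_inverse (x : int) : ~~ (p %| x)%Z -> exists u, (p %| u * x - 1)%Z.
Proof.
move=> px; have cop : coprimez p x by rewrite coprimezE prime_coprime.
have [[u v] /= e] := coprimezP _ _ cop.
by exists v; apply/dvdzP; exists (- u); rewrite -e; ring.
Qed.

Lemma dvdz_small (x : int) : `|x| < p%:Z -> (p %| x)%Z -> x = 0.
Proof.
move=> xp; rewrite dvdzE => px; apply/eqP; rewrite -absz_eq0.
by apply: contraTT px; rewrite -lt0n => x0; rewrite gtnNdvd //; lia.
Qed.

Lemma unique_root (u v : int) : ~~ (p %| u)%Z ->
  exists2 i, (i < p)%N & forall j, (j < p)%N -> (p %| u * j%:Z + v)%Z = (j == i).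
Proof.
move=> pu; have [w pw] := modp_inverse pu.
pose i := absz ((- v * w) %% p)%Z.
have iE : i%:Z = ((- v * w) %% p)%Z by rewrite /i gez0_abs // modz_ge0.
have ip : (i < p)%N by rewrite -ltz_nat iE ltz_pmod // ltz_nat prime_gt0.
have pi : (p %| u * i%:Z + v)%Z.
  have -> : u * i%:Z + v = - (u * ((- v * w) %/ p)%Z) * p%:Z - v * (w * u - 1).
    rewrite iE {1}(_ : (- v * w %% p)%Z = - v * w - (- v * w %/ p)%Z * p%:Z); first ring.
    by rewrite [in X in X - _](divz_eq (- v * w) p); ring.
  by rewrite rpredB // ?dvdz_mull.
exists i => // j jp; apply/idP/eqP => [pj|-> //].
have : (p %| u * (j%:Z - i%:Z))%Z.
  by rewrite (_ : _ * _ = u * j%:Z + v - (u * i%:Z + v)); [rewrite rpredB|ring].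
rewrite prime_dvdzM (negbTE pu) /= => /dvdz_small h.
have : j%:Z - i%:Z = 0 by apply: h; clear - ip jp; lia.
by clear; lia.
Qed.

Lemma count_root (u v : int) : ~~ (p %| u)%Z ->
  count (fun i : nat => (p %| u * i%:Z + v)%Z) (iota 0 p) = 1%N.
Proof.
move=> /(@unique_root u v)[i ip iP].
rewrite (@eq_in_count _ _ (pred1 i)); last by move=> j; rewrite mem_iota => /andP[_ /iP].
by rewrite count_uniq_mem ?iota_uniq // mem_iota ip.
Qed.

(** The determinant vanishes modulo [p]. If the bottom row is nonzero modulo [p], the top row is [i]
    times it modulo [p]; otherwise [(1, 0, 0, p)] splits off. *)
Lemma hecke_rep_decomp g : mdet g = p%:Z ->
  exists i h, [/\ (i <= p)%N, mdet h = 1 & g = mmul (hecke_rep i) h].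
Proof.
case: g => [[[x y] z] w] /= det_g.
have main i q s : (i < p)%N -> x = q * p%:Z + i%:Z * z -> y = s * p%:Z + i%:Z * w ->
    exists i h, [/\ (i <= p)%N, mdet h = 1 & (x, y, z, w) = mmul (hecke_rep i) h].
  move=> ip ex ey; exists i, (q, s, z, w); split; [exact: ltnW| |].
    by apply: (mulfI p_neq0); rewrite /= mulr1 -[RHS]det_g ex ey; ring.
  by rewrite /hecke_rep ltn_eqF //=; congr (_, _, _, _); rewrite ?ex ?ey; ring.
have [pz|pz] := boolP (p %| z)%Z; last first.
  have [i ip /(_ i ip)] := @unique_root z (- x) pz; rewrite eqxx => pi.
  have pi' : (p %| w * i%:Z - y)%Z.
    have : (p %| z * (w * i%:Z - y))%Z.
      rewrite (_ : _ * _ = w * (z * i%:Z - x) + (x * w - y * z)); last ring.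
      by rewrite det_g rpredD ?dvdz_mull // dvdzz.
    by rewrite prime_dvdzM (negbTE pz).
  have /dvdzP[q eq] := pi; have /dvdzP[s es] := pi'.
  by apply: (main i (- q) (- s)) => //; lia.
have [pw|pw] := boolP (p %| w)%Z; last first.
  have [i ip /(_ i ip)] := @unique_root w (- y) pw; rewrite eqxx => pi.
  have pi' : (p %| z * i%:Z - x)%Z.
    have : (p %| w * (z * i%:Z - x))%Z.
      rewrite (_ : _ * _ = z * (w * i%:Z - y) - (x * w - y * z)); last ring.
      by rewrite det_g rpredB ?dvdz_mull // dvdzz.
    by rewrite prime_dvdzM (negbTE pw).
  have /dvdzP[q eq] := pi'; have /dvdzP[s es] := pi.
  by apply: (main i (- q) (- s)) => //; lia.
have /dvdzP[z' ez] := pz; have /dvdzP[w' ew] := pw.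
exists p, (x, y, z', w'); split=> //.
  by apply: (mulfI p_neq0); rewrite /= mulr1 -[RHS]det_g ez ew; ring.
by rewrite /hecke_rep eqxx /=; congr (_, _, _, _); rewrite ?ez ?ew; ring.
Qed.

Lemma hecke_rep_inj i j g h : (i <= p)%N -> (j <= p)%N -> mdet g = 1 -> mdet h = 1 ->
  mmul (hecke_rep i) g = mmul (hecke_rep j) h -> i = j /\ g = h.
Proof.
have not_p_1 (x : int) : x * p%:Z = 1 -> False.
  move=> e; have : (p %| 1)%Z by apply/dvdzP; exists x.
  by rewrite dvdz1 => /eqP /= p1; have := prime_gt1 p_pr; rewrite p1.
case: g h => [[[x y] z] w] [[[x' y'] z'] w'] ip jp.
rewrite /mdet /hecke_rep; case: (eqVneq i p) => [->|ip']; case: (eqVneq j p) => [->|jp'] g1 h1 /=;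
  rewrite !(mul0r, mul1r, addr0, add0r).
- by case=> -> -> /(mulfI p_neq0) -> /(mulfI p_neq0) ->.
- case=> e1 e2 e3 e4; exfalso; apply: (not_p_1 (x' * w - y' * z)).
  by rewrite -h1 -e3 -e4; ring.
- case=> e1 e2 e3 e4; exfalso; apply: (not_p_1 (x * w' - y * z')).
  by rewrite -g1 e3 e4; ring.
case=> e1 e2 ez ew; subst z' w'.
have ij : (p %| i%:Z - j%:Z)%Z.
  apply/dvdzP; exists (x * (y' - y) - y * (x' - x)).
  transitivity (x * ((i%:Z - j%:Z) * w) - y * ((i%:Z - j%:Z) * z)).
    by rewrite -[LHS]mulr1 -g1; ring.
  have -> : (i%:Z - j%:Z) * z = (x' - x) * p%:Z by lia.
  have -> : (i%:Z - j%:Z) * w = (y' - y) * p%:Z by lia.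
  by ring.
have eij : i = j by have := dvdz_small _ ij; lia.
subst j; split=> //; congr (_, _, _, _); apply: (mulfI p_neq0); lia.
Qed.

(** Once the representative and the reduction are fixed, the remaining freedom is an automorph of
    [G]. This yields every integral matrix of determinant [p] from [F] to [G] exactly once. *)
Definition transporter (F G : bqf) : seq mat2 :=
  [seq mmul (hecke_rep i) (mmul (reducer (act F (hecke_rep i))) u)
  | i <- [seq i <- iota 0 p.+1 | reduction (act F (hecke_rep i)) == G], u <- auts G].

Lemma posdef_hecke F i : posdef F -> posdef (act F (hecke_rep i)).
Proof. by move=> pF; apply: posdef_act => //; rewrite mdet_hecke_rep. Qed.

Lemma mem_transporter F G g : posdef F -> reduced G ->
  (g \in transporter F G) = (mdet g == p%:Z) && (act F g == G).
Proof.
move=> pF redG; apply/allpairsP/andP => [[[i u] []]|[/eqP g_p /eqP gG]].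
  rewrite mem_filter => /andP[/eqP /= iG _] uG ->.
  have [r1 _] := reducerP (posdef_hecke i pF).
  rewrite !mdetM mdet_hecke_rep r1 (auts_det uG) !mulr1 eqxx; split=> //.
  by rewrite !actM -/(reduction _) iG (auts_act uG).
have [i [h [ip h1 gE]]] := hecke_rep_decomp g_p.
have [r1 red] := reducerP (posdef_hecke i pF).
pose u := mmul (madj (reducer (act F (hecke_rep i)))) h.
have hE : h = mmul (reducer (act F (hecke_rep i))) u by rewrite mmulA mmul_adj // mmul1m.
have u1 : mdet u = 1 by rewrite mdetM mdet_adj r1 h1.
have Gu : act (reduction (act F (hecke_rep i))) u = G.
  by rewrite /reduction -!actM -hE -gE.
have [|Gr uG] := reduced_act red (g := u) _ u1; first by rewrite Gu.
exists (i, u); split.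
- by rewrite mem_filter mem_iota add0n ltnS ip andbT /= -Gu Gr eqxx.
- by rewrite /=  -Gu Gr; apply: uG.
- by rewrite gE {1}hE.
Qed.

Lemma transporter_uniq F G : posdef F -> reduced G -> uniq (transporter F G).
Proof.
move=> pF redG; apply: allpairs_uniq; rewrite ?filter_uniq ?iota_uniq ?auts_uniq //.
move=> [i' u'] [j' v']; rewrite !mem_allpairs_pair => /andP[ip uG] /andP[jp vG].
move: ip jp; rewrite !mem_filter !mem_iota !add0n !ltnS => /andP[_ ip] /andP[_ jp].
have [r1 _] := reducerP (posdef_hecke i' pF); have [s1 _] := reducerP (posdef_hecke j' pF).
move=> e; have [||ij] := hecke_rep_inj ip jp _ _ e; rewrite ?mdetM ?r1 ?s1 ?(auts_det uG) ?(auts_det vG) //.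
subst j' => /(congr1 (mmul (madj (reducer (act F (hecke_rep i')))))).
by rewrite !mmulA !mmul_adj_l // !mmul1m => ->.
Qed.

Lemma sum_nat_count (T : Type) (s : seq T) (P : pred T) :
  (\sum_(x <- s) P x = count P s)%N.
Proof. by rewrite -sum1_count [RHS]big_mkcond; apply: eq_bigr => x _; case: (P x). Qed.

Definition isogenies (F G : bqf) : nat :=
  count (fun i => reduction (act F (hecke_rep i)) == G) (iota 0 p.+1).

Lemma size_transporter F G : reduced G ->
  size (transporter F G) = (isogenies F G * (2 * weight G))%N.
Proof. by move=> redG; rewrite size_allpairs size_filter size_auts. Qed.

Lemma reduced_scale k Q : 0 < k -> reduced (bqf_scale k Q) = reduced Q.
Proof.
case: Q => a b c k0; rewrite /reduced /= pmulr_rgt0 // -mulrN !ltr_pM2l // !ler_pM2l //.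
by rewrite pmulr_rge0 // (inj_eq (mulfI _)) // gt_eqF.
Qed.

Lemma weight_scale k Q : 0 < k -> weight (bqf_scale k Q) = weight Q.
Proof.
case: Q => a b c k0; have k1 : k != 0 by rewrite gt_eqF.
rewrite /weight /square_type /hexagonal_type /= mulf_eq0 (negbTE k1) /=.
by rewrite !(inj_eq (mulfI k1)).
Qed.

Lemma dual_isogeny F G g : act F g = G -> act G (madj g) = bqf_scale (mdet g ^+ 2) F.
Proof. by move=> <-; rewrite act_adj. Qed.

(** The adjugate turns the matrices from [Q] to [Q'] into those from [Q'] to [p^2 Q], bijectively,
    so the two transporters have the same length. *)
Lemma isogenies_dual Q Q' : reduced Q -> reduced Q' ->
  (isogenies Q Q' * weight Q' = isogenies Q' (bqf_scale (p%:Z ^+ 2) Q) * weight Q)%N.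
Proof.
move=> red red'; have p2 : 0 < p%:Z ^+ 2 by rewrite exprn_gt0 // ltz_nat prime_gt0.
have redp : reduced (bqf_scale (p%:Z ^+ 2) Q) by rewrite reduced_scale.
have pQ := reduced_posdef red; have pQ' := reduced_posdef red'.
suff /eqP : size (transporter Q Q') == size (transporter Q' (bqf_scale (p%:Z ^+ 2) Q)).
  rewrite !size_transporter // (weight_scale _ p2) => e; apply/eqP.
  by rewrite -(eqn_pmul2l (isT : (0 < 2)%N)) !(mulnCA 2); apply/eqP; lia.
rewrite eqn_leq -(size_map madj (transporter Q Q')).
apply/andP; split; apply: uniq_leq_size; rewrite ?(map_inj_uniq (can_inj madjK)) ?transporter_uniq //.
  move=> _ /mapP[g + ->]; rewrite !mem_transporter // => /andP[/eqP gp /eqP gQ].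
  by rewrite mdet_adj gp eqxx (dual_isogeny gQ) gp /=.
move=> g; rewrite mem_transporter // => /andP[/eqP gp /eqP gQ].
apply/mapP; exists (madj g); last by rewrite madjK.
rewrite mem_transporter // mdet_adj gp eqxx /=; apply/eqP.
apply: (@bqf_scale_inj (p%:Z ^+ 2)); first by rewrite gt_eqF.
by rewrite -act_scale -gQ act_adj gp.
Qed.

Lemma Posz_sqr : (p ^ 2)%N%:Z = p%:Z ^+ 2.
Proof. by rewrite expnS expn1 PoszM. Qed.

Definition bqf_dvd (k : int) (Q : bqf) : bool :=
  [&& (k %| qf_a Q)%Z, (k %| qf_b Q)%Z & (k %| qf_c Q)%Z].

Lemma bqf_dvdP k Q : reflect (exists F, Q = bqf_scale k F) (bqf_dvd k Q).
Proof.
apply: (iffP and3P) => [[/dvdzP[a ea] /dvdzP[b eb] /dvdzP[c ec]]|[F ->]].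
  by exists (Bqf a b c); case: Q ea eb ec => ? ? ? /= -> -> ->; apply/bqf_eqP; split; rewrite mulrC.
by rewrite /= !dvdz_mulr.
Qed.

Definition lift_count (Q : bqf) : nat :=
  count (fun i => bqf_dvd (p%:Z ^+ 2) (act Q (hecke_rep i))) (iota 0 p.+1).

(** Each of the [p + 1] representatives leads to exactly one reduced form of discriminant
    [- p^2 N]. *)
Lemma sum_isogenies N Q : (0 < N)%N -> Q \in reduced_forms N ->
  (\sum_(Q' <- reduced_forms (p ^ 2 * N)) isogenies Q Q' = p.+1)%N.
Proof.
move=> N0; rewrite mem_reduced_forms => /andP[red /eqP D].
transitivity (\sum_(i <- iota 0 p.+1) 1)%N; last by rewrite sum1_size size_iota.
transitivity (\sum_(i <- iota 0 p.+1) \sum_(Q' <- reduced_forms (p ^ 2 * N))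
   (reduction (act Q (hecke_rep i)) == Q'))%N.
  rewrite exchange_big /=; apply: eq_bigr => Q' _; rewrite /isogenies -sum_nat_count.
  by apply: eq_bigr.
apply: eq_bigr => i _; have [r1 redi] := reducerP (posdef_hecke i (reduced_posdef red)).
have mem : reduction (act Q (hecke_rep i)) \in reduced_forms (p ^ 2 * N).
  rewrite mem_reduced_forms redi /reduction !qf_disc_act r1 mdet_hecke_rep D expr1n mul1r.
  by rewrite PoszM Posz_sqr mulrN eqxx.
rewrite (eq_bigr (fun Q' => (Q' == reduction (act Q (hecke_rep i))) : nat)); last first.
  by move=> Q' _; rewrite eq_sym.
by rewrite sum_nat_count count_uniq_mem ?reduced_forms_uniq // mem.
Qed.

(** Divisibility by [p^2] is invariant under [SL2(Z)]. Hence a representative leads from [Q'] to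
    [p^2 Q] for exactly one reduced [Q] if [p^2] divides the transformed form, and for none
    otherwise. *)
Lemma sum_isogenies_dual N Q' : (0 < N)%N -> Q' \in reduced_forms (p ^ 2 * N) ->
  (\sum_(Q <- reduced_forms N) isogenies Q' (bqf_scale (p%:Z ^+ 2) Q) = lift_count Q')%N.
Proof.
move=> N0; rewrite mem_reduced_forms => /andP[red' /eqP D'].
have p2 : 0 < p%:Z ^+ 2 by rewrite exprn_gt0 // ltz_nat prime_gt0.
transitivity (\sum_(i <- iota 0 p.+1) \sum_(Q <- reduced_forms N)
   (reduction (act Q' (hecke_rep i)) == bqf_scale (p%:Z ^+ 2) Q))%N.
  rewrite exchange_big /=; apply: eq_bigr => Q _; rewrite /isogenies -sum_nat_count.
  by apply: eq_bigr.
rewrite /lift_count -sum_nat_count; apply: eq_bigr => i _.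
have [r1 redi] := reducerP (posdef_hecke i (reduced_posdef red')).
have Di : qf_disc (reduction (act Q' (hecke_rep i))) = - (p%:Z ^+ 4 * N%:Z).
  rewrite /reduction !qf_disc_act r1 mdet_hecke_rep D' PoszM Posz_sqr expr1n; ring.
have [/bqf_dvdP[F FE]|ndvd] := boolP (bqf_dvd _ _).
  have EF : reduction (act Q' (hecke_rep i)) = bqf_scale (p%:Z ^+ 2) (act F (reducer (act Q' (hecke_rep i)))).
    by rewrite /reduction {1}FE act_scale.
  set G := act F _ in EF.
  have memG : G \in reduced_forms N.
    move: redi Di; rewrite mem_reduced_forms EF reduced_scale // qf_disc_scale => -> /= e.
    apply/eqP; apply: (@mulfI _ ((p%:Z ^+ 2) ^+ 2)); first by rewrite expf_neq0 // gt_eqF.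
    by rewrite e; ring.
  rewrite EF (eq_bigr (fun Q => (Q == G) : nat)); last first.
    by move=> Q _; rewrite (inj_eq (bqf_scale_inj _)) ?gt_eqF // eq_sym.
  by rewrite sum_nat_count count_uniq_mem ?reduced_forms_uniq // memG.
rewrite big1 // => Q _; case: eqP => // e; case/bqf_dvdP: ndvd.
exists (act Q (madj (reducer (act Q' (hecke_rep i))))).
by rewrite -act_scale -e /reduction -actM mmul_adj // act1.
Qed.

(* Double counting of the integral [g] of determinant [p] carrying one class to
   another: [g |-> adj g] reverses the direction. *)
Lemma hecke_sum N : (0 < N)%N ->
  p.+1%:R * class_number N =
  \sum_(Q' <- reduced_forms (p ^ 2 * N)) (lift_count Q')%:R / (weight Q')%:R.
Proof.
move=> N0; have wN0 Q : (weight Q)%:R != 0 :> rat.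
  by rewrite pnatr_eq0 /weight; case: ifP => // _; case: ifP.
transitivity (\sum_(Q <- reduced_forms N) \sum_(Q' <- reduced_forms (p ^ 2 * N))
   (isogenies Q Q')%:R / (weight Q)%:R : rat).
  rewrite /class_number mulr_sumr big_seq [RHS]big_seq; apply: eq_bigr => Q memQ.
  by rewrite -mulr_suml -natr_sum sum_isogenies.
rewrite exchange_big /= big_seq [RHS]big_seq; apply: eq_bigr => Q' memQ'.
rewrite -(sum_isogenies_dual N0 memQ') natr_sum mulr_suml big_seq [RHS]big_seq.
apply: eq_bigr => Q memQ.
apply/eqP; rewrite eqr_div // -!natrM isogenies_dual //.
  by move: memQ; rewrite mem_reduced_forms => /andP[].
by move: memQ'; rewrite mem_reduced_forms => /andP[].
Qed.
End Prime.

(** * Local lifting counts at an odd prime *)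

Section OddPrime.
Variables (p : nat) (p_pr : prime p) (p_odd : odd p).
Let p_neq0 : p%:Z != 0. Proof. by rewrite eqz_nat -lt0n prime_gt0. Qed.
Let p_dvdM x y : (p %| x * y)%Z = (p %| x)%Z || (p %| y)%Z. Proof. exact: prime_dvdzM. Qed.

Lemma dvdz2F : (p %| 2)%Z = false.
Proof.
apply/negbTE/negP; rewrite dvdzE /= => /dvdn_leq h; have := prime_gt1 p_pr.
have := h isT; move: p_odd; lia.
Qed.

Lemma dvdz_sqr x : (p %| x ^+ 2)%Z = (p %| x)%Z.
Proof. by rewrite expr2 p_dvdM orbb. Qed.

Lemma dvdz_pM x : (p%:Z ^+ 2 %| p%:Z * x)%Z = (p %| x)%Z.
Proof. by rewrite expr2 dvdz_mul2l. Qed.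

Lemma count_pS (P : pred nat) : count P (iota 0 p.+1) = (count P (iota 0 p) + P p)%N.
Proof. by rewrite -addn1 iotaD count_cat /= addn0. Qed.

Lemma bqf_dvd_rep_lt a b c i : (i < p)%N -> bqf_dvd (p%:Z ^+ 2) (act (Bqf a b c) (hecke_rep p i)) =
  (p %| 2 * a * i%:Z + b)%Z && (p%:Z ^+ 2 %| a * i%:Z ^+ 2 + b * i%:Z + c)%Z.
Proof.
move=> ip; rewrite /bqf_dvd /hecke_rep ltn_eqF //=.
have -> : a * p%:Z ^+ 2 + b * p%:Z * 0 + c * 0 ^+ 2 = a * p%:Z ^+ 2 by ring.
have -> : 2 * a * p%:Z * i%:Z + b * (p%:Z * 1 + i%:Z * 0) + 2 * c * 0 * 1 = p%:Z * (2 * a * i%:Z + b) by ring.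
have -> : a * i%:Z ^+ 2 + b * i%:Z * 1 + c * 1 ^+ 2 = a * i%:Z ^+ 2 + b * i%:Z + c by ring.
by rewrite dvdz_mull // dvdz_pM.
Qed.

Lemma bqf_dvd_rep_p a b c : bqf_dvd (p%:Z ^+ 2) (act (Bqf a b c) (hecke_rep p p)) =
  (p%:Z ^+ 2 %| a)%Z && (p %| b)%Z.
Proof.
rewrite /bqf_dvd /hecke_rep eqxx /=.
have -> : a * 1 ^+ 2 + b * 1 * 0 + c * 0 ^+ 2 = a by ring.
have -> : 2 * a * 1 * 0 + b * (1 * p%:Z + 0 * 0) + 2 * c * 0 * p%:Z = p%:Z * b by ring.
have -> : a * 0 ^+ 2 + b * 0 * p%:Z + c * p%:Z ^+ 2 = c * p%:Z ^+ 2 by ring.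
by rewrite dvdz_pM [(_ %| c * _)%Z]dvdz_mull // andbT.
Qed.

Lemma count_eq0 (P : pred nat) : (forall i, (i < p)%N -> P i = false) -> count P (iota 0 p) = 0%N.
Proof.
move=> P0; apply/eqP; rewrite -leqn0 leqNgt -has_count; apply/hasPn => i.
by rewrite mem_iota => /andP[_ /P0 ->].
Qed.

Lemma eq_count_lt (P Q : pred nat) : (forall i, (i < p)%N -> P i = Q i) ->
  count P (iota 0 p) = count Q (iota 0 p).
Proof. by move=> PQ; apply: eq_in_count => i; rewrite mem_iota => /andP[_ /PQ]. Qed.

(** If [p] does not divide [a], the condition [p | 2 a i + b] has one solution [i], and [4 a (a i^2
    + b i + c) = (2 a i + b)^2 - D] makes the condition modulo [p^2] automatic. If [p | a], then
    [p | b] and [p^2 | a] follow, and only the last representative works. *)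
Lemma lift_count_primitive Q : ~~ bqf_dvd p Q -> (p%:Z ^+ 2 %| qf_disc Q)%Z -> lift_count p Q = 1%N.
Proof.
case: Q => a b c; rewrite /bqf_dvd /qf_disc /= => prim pD.
rewrite /lift_count count_pS bqf_dvd_rep_p.
have [pa|pa] := boolP (p %| a)%Z; last first.
  have -> : (p%:Z ^+ 2 %| a)%Z = false.
    by apply: contraNF pa; apply: dvdz_trans; rewrite expr2 dvdz_mulr.
  rewrite addn0 -[RHS](@count_root p p_pr (2 * a) b); last by rewrite p_dvdM dvdz2F.
  apply: eq_count_lt => i ip; rewrite [X in X = _](bqf_dvd_rep_lt _ _ _ ip); apply: andb_idr => pi.
  have : (p%:Z ^+ 2 %| 2 * 2 * a * (a * i%:Z ^+ 2 + b * i%:Z + c))%Z.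
    rewrite (_ : _ * _ = (2 * a * i%:Z + b) ^+ 2 - (b ^+ 2 - 4 * a * c)); last ring.
    by rewrite rpredB // dvdz_exp2r.
  rewrite Gauss_dvdzr // coprimezXl // coprimezE prime_coprime // -!dvdzE.
  by rewrite !p_dvdM dvdz2F.
have pb : (p %| b)%Z.
  rewrite -dvdz_sqr (_ : b ^+ 2 = b ^+ 2 - 4 * a * c + 4 * c * a); last ring.
  rewrite rpredD ?dvdz_mull //; apply: dvdz_trans pD; rewrite expr2 dvdz_mulr //.
have pc : ~~ (p %| c)%Z by move: prim; rewrite pa pb.
have p2a : (p%:Z ^+ 2 %| a)%Z.
  have : (p%:Z ^+ 2 %| 2 * 2 * c * a)%Z.
    rewrite (_ : _ * a = b ^+ 2 - (b ^+ 2 - 4 * a * c)); last ring.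
    by rewrite rpredB // dvdz_exp2r.
  rewrite Gauss_dvdzr // coprimezXl // coprimezE prime_coprime // -!dvdzE.
  by rewrite !p_dvdM dvdz2F.
rewrite p2a pb count_eq0 // => i ip; rewrite [X in X = _](bqf_dvd_rep_lt _ _ _ ip); apply/negP => /andP[_ h].
case/negP: pc; rewrite (_ : c = a * i%:Z ^+ 2 + b * i%:Z + c - a * i%:Z ^+ 2 - b * i%:Z); last ring.
rewrite !rpredB ?dvdz_mulr //; apply: dvdz_trans h; rewrite expr2 dvdz_mulr //.
Qed.

(** For a form [p Q] one factor [p] cancels, and what remains is the number of zeros of [Q] on the
    projective line over [F_p]; the last summand is the point at infinity. *)
Lemma lift_count_scale a b c : lift_count p (bqf_scale p (Bqf a b c)) =
  addn (count (fun i : nat => (p %| a * i%:Z ^+ 2 + b * i%:Z + c)%Z) (iota 0 p)) (p %| a)%Z.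
Proof.
rewrite /lift_count count_pS bqf_dvd_rep_p /= dvdz_pM dvdz_mulr // andbT; congr (_ + _)%N.
apply: eq_count_lt => i ip; rewrite [X in X = _](bqf_dvd_rep_lt _ _ _ ip).
have -> : 2 * (p%:Z * a) * i%:Z + p%:Z * b = p%:Z * (2 * a * i%:Z + b) by ring.
have -> : p%:Z * a * i%:Z ^+ 2 + p%:Z * b * i%:Z + p%:Z * c = p%:Z * (a * i%:Z ^+ 2 + b * i%:Z + c) by ring.
by rewrite dvdz_mulr // dvdz_pM.
Qed.

Lemma root_discriminant a b c (i : int) : ~~ (p %| a)%Z ->
  (p %| a * i ^+ 2 + b * i + c)%Z = (p %| (2 * a * i + b) ^+ 2 - (b ^+ 2 - 4 * a * c))%Z.
Proof.
move=> pa; rewrite (_ : _ - _ = 2 * 2 * a * (a * i ^+ 2 + b * i + c)); last ring.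
by rewrite !p_dvdM dvdz2F (negbTE pa).
Qed.

(** The discriminant is a nonzero square modulo [p]. The two zeros solve [2 a i + b = t] and
    [2 a i + b = - t], or one of them is at infinity when [p | a]. *)
Lemma lift_count_split Q t : (p %| qf_disc Q - t ^+ 2)%Z -> ~~ (p %| t)%Z ->
  lift_count p (bqf_scale p Q) = 2%N.
Proof.
case: Q => a b c; rewrite /qf_disc /= => pD pt; rewrite lift_count_scale.
have [pa|pa] := boolP (p %| a)%Z.
  have pb : ~~ (p %| b)%Z.
    apply: contra pt => pb; rewrite -dvdz_sqr.
    rewrite (_ : t ^+ 2 = b * b - 4 * c * a - (b ^+ 2 - 4 * a * c - t ^+ 2)); last ring.
    by rewrite rpredB // rpredB ?dvdz_mull.
  rewrite addn1; congr _.+1; rewrite -[RHS](@count_root p p_pr b c pb); apply: eq_count_lt => i ip.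
  rewrite (_ : _ + c = i%:Z ^+ 2 * a + (b * i%:Z + c)); last ring.
  by rewrite rpredDl // dvdz_mull.
have pa2 : ~~ (p %| 2 * a)%Z by rewrite p_dvdM dvdz2F.
rewrite addn0; transitivity (addn (count (fun i : nat => (p %| 2 * a * i%:Z + (b - t))%Z) (iota 0 p))
  (count (fun i : nat => (p %| 2 * a * i%:Z + (b + t))%Z) (iota 0 p))); last by rewrite !count_root.
rewrite -count_predUI [X in (_ + X)%N]count_eq0 ?addn0.
  apply: eq_count_lt => i ip; rewrite root_discriminant //= -p_dvdM.
  rewrite (_ : _ - (b ^+ 2 - 4 * a * c) = (2 * a * i%:Z + (b - t)) * (2 * a * i%:Z + (b + t)) - (b ^+ 2 - 4 * a * c - t ^+ 2)); last ring.
  by rewrite rpredBr.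
move=> i ip; apply/negP => /andP[h1 h2]; case/negP: pt.
have : (p %| 2 * t)%Z.
  rewrite (_ : 2 * t = 2 * a * i%:Z + (b + t) - (2 * a * i%:Z + (b - t))); last ring.
  exact: rpredB.
by rewrite p_dvdM dvdz2F.
Qed.

Lemma lift_count_ramified Q : (p %| qf_disc Q)%Z -> ~~ bqf_dvd p Q ->
  lift_count p (bqf_scale p Q) = 1%N.
Proof.
case: Q => a b c; rewrite /qf_disc /bqf_dvd /= => pD prim; rewrite lift_count_scale.
have [pa|pa] := boolP (p %| a)%Z.
  have pb : (p %| b)%Z.
    rewrite -dvdz_sqr (_ : b ^+ 2 = b ^+ 2 - 4 * a * c + 4 * c * a); last ring.
    by rewrite rpredD ?dvdz_mull.
  have pc : ~~ (p %| c)%Z by move: prim; rewrite pa pb.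
  rewrite count_eq0 // => i ip; apply/negbTE.
  by rewrite rpredDl // rpredD ?dvdz_mulr.
rewrite addn0 -[RHS](@count_root p p_pr (2 * a) b); last by rewrite p_dvdM dvdz2F.
by apply: eq_count_lt => i ip; rewrite root_discriminant // rpredBr // dvdz_sqr.
Qed.

Lemma lift_count_divisible Q : bqf_dvd p Q -> lift_count p (bqf_scale p Q) = p.+1.
Proof.
case: Q => a b c; rewrite /bqf_dvd /= => /and3P[pa pb pc]; rewrite lift_count_scale pa addn1.
congr _.+1; rewrite -[RHS](size_iota 0); apply/eqP; rewrite -all_count; apply/allP => i _.
by rewrite !rpredD ?dvdz_mulr.
Qed.
End OddPrime.

(** * Class numbers of discriminants multiplied by [p^2] *)

Section Hecke.
Variables (p : nat) (p_pr : prime p) (p_odd : odd p).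
Let p_gt0 : (0 < p)%N. Proof. exact: prime_gt0. Qed.

Lemma divisible_forms N : perm_eq [seq Q <- reduced_forms (p ^ 2 * N) | bqf_dvd p Q]
  (map (bqf_scale p) (reduced_forms N)).
Proof.
have p0 : 0 < p%:Z by rewrite ltz_nat.
have inj_p : injective (bqf_scale p) by apply: (@bqf_scale_inj p%:Z); rewrite gt_eqF.
apply: uniq_perm; first exact/filter_uniq/reduced_forms_uniq.
  by rewrite (map_inj_uniq inj_p) reduced_forms_uniq.
have memE Q : (bqf_scale p Q \in reduced_forms (p ^ 2 * N)) = (Q \in reduced_forms N).
  rewrite !mem_reduced_forms reduced_scale // qf_disc_scale PoszM Posz_sqr -mulrN.
  by rewrite (inj_eq (mulfI _)) // expf_neq0 // gt_eqF.
move=> Q; rewrite mem_filter; apply/andP/mapP => [[/bqf_dvdP[F ->]]|[F F_N ->]].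
  by rewrite memE; exists F.
by rewrite memE F_N; split=> //; apply/bqf_dvdP; exists F.
Qed.

Lemma class_number_primitive N : class_number (p ^ 2 * N) =
  \sum_(Q <- reduced_forms (p ^ 2 * N) | ~~ bqf_dvd p Q) (weight Q)%:R^-1 + class_number N.
Proof.
rewrite /class_number (bigID (bqf_dvd p)) /= addrC; congr (_ + _).
rewrite -big_filter (perm_big _ (divisible_forms N)) big_map.
by apply: eq_bigr => Q _; rewrite weight_scale.
Qed.

(** In [hecke_sum] the forms of discriminant [- p^2 N] not divisible by [p] have one lift each, with
    weighted number [class_number (p ^ 2 * N) - class_number N]. The divisible ones are [p Q] with
    [Q] of discriminant [- N]. *)
Lemma hecke_relation N : (0 < N)%N ->
  p.+1%:R * class_number N = class_number (p ^ 2 * N) - class_number N +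
    \sum_(Q <- reduced_forms N) (lift_count p (bqf_scale p Q))%:R / (weight Q)%:R.
Proof.
move=> N0; rewrite hecke_sum // class_number_primitive addrK (bigID (bqf_dvd p)) /= addrC.
congr (_ + _); last first.
  rewrite -big_filter (perm_big _ (divisible_forms N)) big_map.
  by apply: eq_bigr => Q _; rewrite weight_scale.
rewrite big_seq_cond [RHS]big_seq_cond; apply: eq_bigr => Q /andP[].
rewrite mem_reduced_forms => /andP[_ /eqP D] prim.
by rewrite lift_count_primitive // ?mul1r // D PoszM Posz_sqr -mulrN dvdz_mulr.
Qed.

Lemma class_number_split N (t : int) : (0 < N)%N -> (p %| N%:Z + t ^+ 2)%Z -> ~~ (p %| t)%Z ->
  class_number (p ^ 2 * N) = p%:R * class_number N.
Proof.
move=> N0 pN pt; have := hecke_relation N0.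
have -> : \sum_(Q <- reduced_forms N) (lift_count p (bqf_scale p Q))%:R / (weight Q)%:R =
   2 * class_number N :> rat.
  rewrite mulr_sumr big_seq [RHS]big_seq; apply: eq_bigr => Q.
  rewrite mem_reduced_forms => /andP[_ /eqP D]; rewrite (@lift_count_split _ p_pr p_odd _ t) //.
  by rewrite D -opprD rpredN.
by rewrite -addn1 natrD; lra.
Qed.

(** Here [p] divides the discriminant [- p^2 N]. A form not divisible by [p] then has one zero
    modulo [p], while a divisible one vanishes at all [p + 1] points. *)
Lemma class_number_ramified N : (0 < N)%N -> class_number (p ^ 2 * (p ^ 2 * N)) =
  p.+1%:R * class_number (p ^ 2 * N) - p%:R * class_number N.
Proof.
move=> N0; have N1 : (0 < p ^ 2 * N)%N by rewrite muln_gt0 expn_gt0 p_gt0.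
have := hecke_relation N1.
have -> : \sum_(Q <- reduced_forms (p ^ 2 * N)) (lift_count p (bqf_scale p Q))%:R / (weight Q)%:R =
   class_number (p ^ 2 * N) + p%:R * class_number N :> rat.
  rewrite (bigID (bqf_dvd p)) /= addrC class_number_primitive -addrA; congr (_ + _).
    rewrite big_seq_cond [RHS]big_seq_cond; apply: eq_bigr => Q /andP[].
    rewrite mem_reduced_forms => /andP[_ /eqP D] prim.
    rewrite lift_count_ramified ?mul1r // D PoszM Posz_sqr -mulrN dvdz_mulr //.
    by rewrite expr2 dvdz_mulr.
  rewrite -big_filter (perm_big _ (divisible_forms N)) big_map.
  rewrite -{1}[class_number N]mul1r -mulrDl nat1r mulr_sumr.
  apply: eq_bigr => Q _; rewrite lift_count_divisible ?weight_scale //.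
  by apply/bqf_dvdP; exists Q.
rewrite -addn1 natrD; lra.
Qed.

(** If [p] does not divide [t], then [- N = t^2] modulo [p] and the split case applies. If
    [t = p u], then [s >= 2] and [N = p^2 N'] with [N' = p^(s-2) - u^2]; by induction [H(p^4 N') =
    (p + 1) p H(N') - p H(N') = p^2 H(N') = p H(N)]. *)
Lemma class_number_shifted_power s (t : nat) : (0 < t)%N -> (t ^ 2 < p ^ s)%N ->
  class_number (p ^ 2 * (p ^ s - t ^ 2)) = p%:R * class_number (p ^ s - t ^ 2).
Proof.
have [n] := ubnP s; elim: n s t => // n IHn s t s_n t0 ts.
have N0 : (0 < p ^ s - t ^ 2)%N by rewrite subn_gt0.
have [/dvdnP[u tE]|pt] := boolP (p %| t)%N; last first.
  apply: (@class_number_split _ t%:Z) => //.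
  have -> : (p ^ s - t ^ 2)%N%:Z + t%:Z ^+ 2 = (p ^ s)%N%:Z.
    by rewrite -subzn ?(ltnW ts) // -(Posz_sqr t) subrK.
  case: s ts {s_n N0} => [|s] ts; last by rewrite expnS PoszM dvdz_mulr.
  by move: ts; rewrite expn0 ltnS leqn0 expn_eq0 (gtn_eqF t0).
have u0 : (0 < u)%N by move: t0; rewrite tE muln_gt0 => /andP[].
case: s ts N0 s_n => [|[|s]] ts N0 s_n.
- by move: ts; rewrite expn0 ltnS leqn0 expn_eq0 (gtn_eqF t0).
- move: ts; rewrite tE expnMn expn1 ltnNge (leq_trans _ (leq_pmull _ _)) ?expn_gt0 ?u0 //.
  by rewrite -{1}[p]expn1 leq_pexp2l.
have us : (u ^ 2 < p ^ s)%N.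
  move: ts; by rewrite tE expnMn -[s.+2]addn2 expnD ltn_pmul2r // expn_gt0 p_gt0.
have NE : (p ^ s.+2 - t ^ 2 = p ^ 2 * (p ^ s - u ^ 2))%N.
  by rewrite tE mulnBr -expnD add2n expnMn [(u ^ 2 * _)%N]mulnC.
have IH := IHn s u _ u0 us.
rewrite NE class_number_ramified ?subn_gt0 // -IH; last by lia.
by rewrite -natr1; lra.
Qed.
End Hecke.

(** * Selling parameters *)

(* [(a, b, c)] stands for the form with outer coefficients [(a + c) / 2] and
   [(b + c) / 2] and middle coefficient [- c], of discriminant
   [- (ab + bc + ca)]. *)
Section Selling.
Variables (N M : nat) (t0 : int).
Hypotheses (N_gt0 : (0 < N)%N) (NM : (N <= M)%N) (t0M : `|t0| <= M%:Z).

(** The constant coordinate [t0] turns triples into quadruples, so the counting lemmas for boxes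
    apply and the count is literally a fibre of [quadT]. *)
Let sell (t a b c : int) :=
  [&& t == t0, a * b + b * c + c * a == N%:Z, ((a - b) %% 2)%Z == 0,
      ((b - c) %% 2)%Z == 0 & [&& 0 <= a, 0 <= b & 0 <= c]].
Let scount P := bcount M (fun t a b c => sell t a b c && P t a b c).
Let fcount (P : pred bqf) : int := \sum_(Q <- reduced_forms N | P Q) 1.

Let sellP t a b c : reflect
  [/\ t = t0, a * b + b * c + c * a = N%:Z,
      ((a - b) %% 2)%Z = 0 /\ ((b - c) %% 2)%Z = 0 & [/\ 0 <= a, 0 <= b & 0 <= c]] (sell t a b c).
Proof.
by apply: (iffP and5P) => [[/eqP ? /eqP ? /eqP ? /eqP ? /and3P ?]|[-> -> [-> ->] /and3P ->]].
Qed.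

Lemma sell_in_box P : in_ibox M (fun t a b c => sell t a b c && P t a b c).
Proof.
move=> t a b c /andP[/sellP[-> E _ [a0 b0 c0]] _].
have aux := @pair_sums_bound M.
by split=> //; [have := aux a b c|have := aux b c a|have := aux c a b]; lia.
Qed.

Lemma scount_bij (P Q : pred4)
    (f1 f2 f3 g1 g2 g3 : int -> int -> int -> int) :
  (forall t a b c, sell t a b c -> P t a b c ->
    let A := f1 a b c in let B := f2 a b c in let C := f3 a b c in
    [/\ sell t A B C, Q t A B C & [/\ g1 A B C = a, g2 A B C = b & g3 A B C = c]]) ->
  (forall t a b c, sell t a b c -> Q t a b c ->
    let A := g1 a b c in let B := g2 a b c in let C := g3 a b c in
    [/\ sell t A B C, P t A B C & [/\ f1 A B C = a, f2 A B C = b & f3 A B C = c]]) ->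
  scount P = scount Q.
Proof.
move=> PQ QP; apply: (bcount_bij (f1 := fun t _ _ _ => t) (g1 := fun t _ _ _ => t)
  (f2 := fun=> f1) (f3 := fun=> f2) (f4 := fun=> f3) (g2 := fun=> g1) (g3 := fun=> g2) (g4 := fun=> g3)).
- exact: sell_in_box.
- exact: sell_in_box.
- by move=> t a b c /andP[S Pt] /=; have /= [-> -> []] := PQ _ _ _ _ S Pt.
- by move=> t a b c /andP[S Pt] /=; have /= [-> -> []] := QP _ _ _ _ S Pt.
Qed.

Lemma scount_rotate P : scount P = scount (fun t a b c => P t b c a).
Proof.
apply: (scount_bij (f1 := fun a b c => c) (f2 := fun a b c => a) (f3 := fun a b c => b)
  (g1 := fun a b c => b) (g2 := fun a b c => c) (g3 := fun a b c => a)).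
all: by move=> t a b c /sellP[-> E [? ?] [? ? ?]] Pt /=; split=> //; first [apply/sellP; split=> //; first [lia|by split; lia] | lia].
Qed.

Lemma scount_reduced (P : pred4) (Q : pred bqf)
    (f : int -> int -> int -> bqf) (g1 g2 g3 : bqf -> int) :
  (forall a b c, sell t0 a b c -> P t0 a b c ->
    [/\ reduced (f a b c), qf_disc (f a b c) = - N%:Z, Q (f a b c) &
    [/\ g1 (f a b c) = a, g2 (f a b c) = b & g3 (f a b c) = c]]) ->
  (forall F, reduced F -> qf_disc F = - N%:Z -> Q F ->
    [/\ sell t0 (g1 F) (g2 F) (g3 F), P t0 (g1 F) (g2 F) (g3 F) & f (g1 F) (g2 F) (g3 F) = F]) ->
  scount P = fcount Q.
Proof.
move=> fP gP; apply: (reindex_seq (f := fun x => f x.1.1.2 x.1.2 x.2)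
  (g := fun F => (t0, g1 F, g2 F, g3 F))).
- exact: ibox_uniq.
- exact: reduced_forms_uniq.
- case=> [[[t a] b] c] _ /= /andP[S Pt].
  have /sellP[tE _ _ _] := S; subst t.
  have [red D QF [-> -> ->]] := fP _ _ _ S Pt.
  by split=> //; rewrite mem_reduced_forms red D eqxx.
- move=> F; rewrite mem_reduced_forms => /andP[red /eqP D] QF /=.
  have [S Pt fE] := gP F red D QF; split=> //; last by rewrite S.
  by apply: (in_iboxP (@sell_in_box (fun _ _ _ _ => true))); rewrite S.
Qed.

Let generic (Q : bqf) := (qf_b Q != 0) && ~~ hexagonal_type Q.

(** The conditions [c < a] and [c <= b] select one rotation of each positive triple that is not
    constant. Reading off a middle coefficient [- c] for [a < b] and [c] otherwise matches the
    boundary conventions of [reduced]. *)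
Lemma scount_c_min : scount (fun t a b c => [&& 0 < c, c < a & c <= b]) = fcount generic.
Proof.
apply: (scount_reduced
  (f := fun a b c => if a < b then Bqf ((a + c) %/ 2)%Z (- c) ((b + c) %/ 2)%Z
                     else Bqf ((b + c) %/ 2)%Z c ((a + c) %/ 2)%Z)
  (g1 := fun Q => if qf_b Q < 0 then 2 * qf_a Q + qf_b Q else 2 * qf_c Q - qf_b Q)
  (g2 := fun Q => if qf_b Q < 0 then 2 * qf_c Q + qf_b Q else 2 * qf_a Q - qf_b Q)
  (g3 := fun Q => `|qf_b Q|)).
- move=> a b c /sellP[_ E [p1 p2] _] /and3P[c0 ca cb].
  have [A aE] : exists A, a = 2 * A - c by exists ((a + c) %/ 2)%Z; lia.
  have [B bE] : exists B, b = 2 * B - c by exists ((b + c) %/ 2)%Z; lia.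
  have -> : ((a + c) %/ 2)%Z = A by lia.
  have -> : ((b + c) %/ 2)%Z = B by lia.
  rewrite /reduced /generic /hexagonal_type /qf_disc; case: ifP => ab /=.
    have -> : (- c < 0) = true by lia.
    by split; [lia|rewrite -E aE bE; ring|lia|split; lia].
  have -> : (c < 0) = false by lia.
  by split; [lia|rewrite -E aE bE; ring|lia|split; lia].
- case=> A B C /and5P[A0 lb ub AC bnd]; rewrite /qf_disc /= => D.
  rewrite /generic /hexagonal_type /= => BQ.
  have [B0|B0] := ltP B 0.
    have -> : (2 * A + B < 2 * C + B) = true by lia.
    have -> : `|B| = - B by lia.
    split; [apply/sellP; split=> //; first [lia|by split; lia]|lia|].
    by apply/bqf_eqP; split; lia.
  have -> : (2 * C - B < 2 * A - B) = false by lia.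
  have -> : `|B| = B by lia.
  split; [apply/sellP; split=> //; first [lia|by split; lia]|lia|].
  by apply/bqf_eqP; split; lia.
Qed.

Lemma scount_equal : scount (fun t a b c => [&& 0 < c, a == c & b == c]) = fcount hexagonal_type.
Proof.
apply: (scount_reduced (f := fun a b c => Bqf c c c) (g1 := qf_a) (g2 := qf_a) (g3 := qf_a)).
- move=> a b c /sellP[_ E [p1 p2] _] /and3P[c0 /eqP ca /eqP cb]; subst a b.
  by rewrite /reduced /hexagonal_type /qf_disc /= !eqxx /=; split=> //; lia.
- case=> A B C /and5P[A0 lb ub AC bnd]; rewrite /qf_disc /hexagonal_type /= => D /andP[/eqP AB /eqP BC].
  by subst B C; rewrite !eqxx; split; [apply/sellP; split=> //; first [lia|by split; lia]|lia|].
Qed.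

Lemma scount_c_zero_lt : scount (fun t a b c => [&& c == 0, 0 < a & a < b]) =
  fcount (fun Q => (qf_b Q == 0) && (qf_a Q < qf_c Q)).
Proof.
apply: (scount_reduced (f := fun a b c => Bqf (a %/ 2)%Z 0 (b %/ 2)%Z)
  (g1 := fun Q => 2 * qf_a Q) (g2 := fun Q => 2 * qf_c Q) (g3 := fun Q => 0)).
- move=> a b c /sellP[_ E [p1 p2] _] /and3P[/eqP c0 a0 ab]; subst c.
  have [A aE] : exists A, a = 2 * A by exists (a %/ 2)%Z; lia.
  have [B bE] : exists B, b = 2 * B by exists (b %/ 2)%Z; lia.
  have -> : (a %/ 2)%Z = A by lia.
  have -> : (b %/ 2)%Z = B by lia.
  by rewrite /reduced /qf_disc /=; split; [lia|rewrite -E aE bE; ring|lia|split; lia].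
- case=> A B C /and5P[A0 lb ub AC bnd]; rewrite /qf_disc /= => D /andP[/eqP B0 AC'].
  subst B; split; [apply/sellP; split=> //; first [lia|by split; lia]|lia|].
  by apply/bqf_eqP; split; lia.
Qed.

Lemma scount_c_zero_eq : scount (fun t a b c => [&& c == 0, 0 < a & a == b]) = fcount square_type.
Proof.
apply: (scount_reduced (f := fun a b c => Bqf (a %/ 2)%Z 0 (b %/ 2)%Z)
  (g1 := fun Q => 2 * qf_a Q) (g2 := fun Q => 2 * qf_c Q) (g3 := fun Q => 0)).
- move=> a b c /sellP[_ E [p1 p2] _] /and3P[/eqP c0 a0 /eqP ab]; subst c b.
  have [A aE] : exists A, a = 2 * A by exists (a %/ 2)%Z; lia.
  have -> : (a %/ 2)%Z = A by lia.
  by rewrite /reduced /square_type /qf_disc /=; split; [lia|rewrite -E aE; ring|lia|split; lia].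
- case=> A B C /and5P[A0 lb ub AC bnd]; rewrite /qf_disc /square_type /= => D /andP[/eqP B0 /eqP AC'].
  subst B C; split; [apply/sellP; split=> //; first [lia|by split; lia]|lia|].
  by apply/bqf_eqP; split; lia.
Qed.

Lemma scount_c_zero_gt : scount (fun t a b c => [&& c == 0, 0 < b & b < a]) =
  fcount (fun Q => (qf_b Q == 0) && (qf_a Q < qf_c Q)).
Proof.
rewrite -scount_c_zero_lt; apply: (scount_bij (f1 := fun a b c => b) (f2 := fun a b c => a)
  (f3 := fun a b c => c) (g1 := fun a b c => b) (g2 := fun a b c => a) (g3 := fun a b c => c)).
all: by move=> t a b c /sellP[-> E [? ?] [? ? ?]] Pt /=; split=> //; first [apply/sellP; split=> //; first [lia|by split; lia] | lia].
Qed.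

Lemma scount_ind P : scount P = bsum M sell (fun t a b c => (P t a b c : nat)%:Z).
Proof. by rewrite bsum_ind. Qed.

(** A form of weight [w] must occur [6 / w] times. In general it has three rotations in each of the
    two counts; the hexagonal type is fixed by rotation and occurs twice. Forms with [b = 0] have a
    zero parameter and occur in the first count only: in two orders with three rotations, or in one
    order for the square type. *)
Lemma scount_class_number :
  (scount (fun _ _ _ _ => true) + scount (fun t a b c => [&& 0 < a, 0 < b & 0 < c]))%:~R
  = 6 * class_number N :> rat.
Proof.
have -> : 6 * class_number N = (6 * fcount generic + 2 * fcount hexagonal_type + 3 * fcount square_type
    + 6 * fcount (fun Q => (qf_b Q == 0%R) && (qf_a Q < qf_c Q)%R))%:~R :> rat.
  rewrite /class_number mulr_sumr /fcount !rmorphD !rmorphM !rmorph_sum /= !rmorph_nat !mulr_sumr.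
  rewrite [X in _ = X + _ + _ + _]big_mkcond [X in _ = _ + X + _ + _]big_mkcond.
  rewrite [X in _ = _ + X + _]big_mkcond [X in _ = _ + X]big_mkcond -!big_split /= big_seq [RHS]big_seq.
  apply: eq_bigr => -[A B C]; rewrite mem_reduced_forms => /andP[/and5P[A0 _ _ AC bnd] _].
  rewrite /generic /weight /square_type /hexagonal_type /=.
  have [->|B0] := eqVneq B 0.
    rewrite (gt_eqF A0) /=; have [->|AC'] := eqVneq A C; first by rewrite ltxx; lra.
    by rewrite lt_neqAle AC' AC /=; lra.
  have [->|AB] := eqVneq A B => /=; last by lra.
  by case: (B == C) => /=; lra.
rewrite -scount_c_min -scount_equal -scount_c_zero_eq -{1}scount_c_zero_lt; congr (_%:~R).
have r1 := scount_rotate (fun t a b c => [&& 0 < a, a < b & a <= c]).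
have r2 := scount_rotate (fun t a b c => [&& 0 < b, b < c & b <= a]).
have z1 := scount_rotate (fun t a b c => [&& a == 0, 0 < b & 0 < c]).
have z2 := scount_rotate (fun t a b c => [&& b == 0, 0 < c & 0 < a]).
have z3 := scount_c_zero_gt; rewrite -scount_c_zero_lt in z3.
have E1 : scount (fun t a b c => [&& 0 < a, 0 < b & 0 < c]) =
   scount (fun t a b c => [&& 0 < c, c < a & c <= b]) +
   scount (fun t a b c => [&& 0 < a, a < b & a <= c]) +
   scount (fun t a b c => [&& 0 < b, b < c & b <= a]) +
   scount (fun t a b c => [&& 0 < c, a == c & b == c]).
  rewrite !scount_ind -!bsumD; apply: eq_bsum => // t a b c _.
  by case: (ltgtP a b) => ?; case: (ltgtP b c) => ?; case: (ltgtP a c) => ?; lia.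
have E2 : scount (fun _ _ _ _ => true) = scount (fun t a b c => [&& 0 < a, 0 < b & 0 < c]) +
   scount (fun t a b c => [&& a == 0, 0 < b & 0 < c]) +
   scount (fun t a b c => [&& b == 0, 0 < c & 0 < a]) +
   scount (fun t a b c => [&& c == 0, 0 < a & 0 < b]).
  rewrite !scount_ind -!bsumD; apply: eq_bsum => // t a b c /sellP[_ E _ [a0 b0 c0]].
  have := pair_sums_gt0 a0 b0 c0; rewrite E ltz_nat N_gt0; move: a0 b0 c0.
  by case: (ltgtP a 0) => ?; case: (ltgtP b 0) => ?; case: (ltgtP c 0) => ?; lia.
have E3 : scount (fun t a b c => [&& c == 0, 0 < a & 0 < b]) =
   scount (fun t a b c => [&& c == 0, 0 < a & a < b]) +
   scount (fun t a b c => [&& c == 0, 0 < a & a == b]) +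
   scount (fun t a b c => [&& c == 0, 0 < b & b < a]).
  rewrite !scount_ind -!bsumD; apply: eq_bsum => // t a b c /sellP[_ E _ [a0 b0 c0]].
  by case: (ltgtP a b) => ?; lia.
move: r1 r2 z1 z2 => /= r1 r2 z1 z2; lia.
Qed.
End Selling.

Lemma bcount_fibers L P : in_ibox L P ->
  bcount L P = \sum_(t0 <- irange L) bcount L (fun t a b c => P t a b c && (t == t0)).
Proof.
move=> bP; rewrite /bcount big_mkcond.
rewrite [RHS](eq_bigr (fun t0 => \sum_(x <- ibox L)
  if P x.1.1.1 x.1.1.2 x.1.2 x.2 && (x.1.1.1 == t0) then 1 else 0)); last by move=> t0 _; rewrite big_mkcond.
rewrite exchange_big /=; apply: eq_bigr => -[[[t a] b] c] _ /=.
case: ifP => [Pt|]; last by rewrite big1.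
rewrite -big_mkcond /= -big_filter (eq_bigl (fun i => xpredT i)) //.
rewrite big_filter (eq_bigl (pred1 t)); last by move=> i; rewrite eq_sym.
have ti : t \in irange L.
  by have := in_iboxP bP Pt; rewrite mem_ibox => /and4P[].
by rewrite -big_filter filter_pred1_uniq ?irange_uniq // big_seq1.
Qed.

Definition hz (x : int) : rat := hurwitz x%:~R.

Lemma hz0 : hz 0 = - 12%:R^-1. Proof. exact: hurwitz0. Qed.

Lemma hz_neg x : x < 0 -> hz x = 0. Proof. exact: hurwitz_neg. Qed.

Lemma hz_pos (N : nat) : (0 < N)%N -> hz N%:Z = class_number N.
Proof. exact: hurwitz_class_number. Qed.

(** * Eichler's class number relation *)

Section Eichler.
Variable n : nat.
Hypothesis n_odd : odd n.

Lemma quadT_fiber (t0 : int) (N : nat) : n%:Z - t0 ^+ 2 = N%:Z -> (0 < N)%N ->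
  `|t0| <= (4 * n)%N%:Z ->
  (bcount (4 * n) (fun t a b c => quadT n t a b c &&
      [&& 0 <= a, 0 <= b, 0 <= c & t ^+ 2 != n%:Z] && (t == t0)) +
   bcount (4 * n) (fun t a b c => quadT n t a b c && [&& 0 < a, 0 < b & 0 < c] && (t == t0)))%:~R
  = 6 * hz (n%:Z - t0 ^+ 2).
Proof.
move=> NE N0 t0n; have t02 := sqr_ge0 t0.
have NM : (N <= 4 * n)%N by lia.
rewrite NE hz_pos // -(@scount_class_number N (4 * n) t0 N0 NM t0n).
(* Modulo 2 the form [ab + bc + ca] is [3 c^2]. As [n] is odd, [c] and [t0] have opposite parity,
   which is the condition in [quadT]. *)
have parity (a b c : int) : a * b + b * c + c * a = N%:Z ->
    ((a - b) %% 2)%Z = 0 -> ((b - c) %% 2)%Z = 0 -> ((c + t0) %% 2)%Z = 1.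
  move=> E ab bc.
  have [q qE] : exists q, a = c + 2 * q by exists ((a - c) %/ 2)%Z; lia.
  have [s sE] : exists s, b = c + 2 * s by exists ((b - c) %/ 2)%Z; lia.
  have [c' cE] : exists c', c = 2 * c' \/ c = 2 * c' + 1 by exists (c %/ 2)%Z; lia.
  have [t' tE] : exists t', t0 = 2 * t' \/ t0 = 2 * t' + 1 by exists (t0 %/ 2)%Z; lia.
  have [n' nE] : exists n', n%:Z = 2 * n' + 1 by exists (n./2)%:Z; lia.
  move: E; have -> : N%:Z = 2 * n' + 1 - t0 ^+ 2 by rewrite -NE nE.
  rewrite qE sE; case: cE => ->; case: tE => ->; lia.
congr (_%:~R); congr (_ + _).
  apply: eq_bcount => t a b c; apply/idP/idP.
    case/andP=> /andP[/quadTP[E ? ? ?] /and4P[? ? ? ?] /eqP tE]; subst t.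
    by rewrite eqxx andbT /=; apply/and4P; split; lia.
  rewrite andbT => /and5P[/eqP tE /eqP E /eqP ab /eqP bc abc]; subst t.
  have ct := parity _ _ _ E ab bc.
  rewrite eqxx andbT; apply/andP; split; first by apply/quadTP; split; lia.
  by lia.
apply: eq_bcount => t a b c; apply/idP/idP.
  case/andP=> /andP[/quadTP[E ? ? ?] /and3P[? ? ?] /eqP tE]; subst t.
  by apply/andP; split; [apply/and5P; split; lia|lia].
case/andP => /and5P[/eqP tE /eqP E /eqP ab /eqP bc _] abc; subst t.
have ct := parity _ _ _ E ab bc.
by rewrite eqxx andbT; apply/andP; split=> //; apply/quadTP; split; lia.
Qed.

Lemma quadT_class_numbers :
  (bcount (4 * n) (fun t a b c => quadT n t a b c && [&& 0 <= a, 0 <= b, 0 <= c & t ^+ 2 != n%:Z]) +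
   bcount (4 * n) (fun t a b c => quadT n t a b c && [&& 0 < a, 0 < b & 0 < c]))%:~R
  = 6 * \sum_(t <- irange (4 * n) | t ^+ 2 != n%:Z) hz (n%:Z - t ^+ 2).
Proof.
have b0 := @nonneg_in_box n.
have b1 : in_ibox (4 * n) (fun t a b c => quadT n t a b c && [&& 0 < a, 0 < b & 0 < c]).
  move=> t a b c /andP[T Pt]; apply: b0; rewrite T /=.
  move: T Pt => /quadTP[E _ _ _] /and3P[a0 b0 c0].
  by have := mulr_gt0 a0 b0; have := mulr_gt0 b0 c0; have := mulr_gt0 c0 a0; lia.
rewrite (bcount_fibers b0) (bcount_fibers b1) -big_split /= rmorph_sum /= mulr_sumr.
rewrite [RHS]big_mkcond big_seq [RHS]big_seq; apply: eq_bigr => t.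
rewrite mem_irange => tM; have {}tM : `|t| <= (4 * n)%N%:Z by lia.
have none (x : int) : x <= 0 -> n%:Z - t ^+ 2 = x ->
   bcount (4 * n) (fun t1 a b c => quadT n t1 a b c &&
      [&& 0 <= a, 0 <= b, 0 <= c & t1 ^+ 2 != n%:Z] && (t1 == t)) +
   bcount (4 * n) (fun t1 a b c => quadT n t1 a b c && [&& 0 < a, 0 < b & 0 < c] && (t1 == t)) = 0.
  move=> x0 xE; rewrite /bcount !big1 ?addr0 // => -[[[t1 a] b] c] /=.
    case/andP=> /andP[/quadTP[E _ _ _] /and3P[a0 c0 d0]] /eqP e; subst t1.
    by have := mulr_gt0 a0 c0; have := mulr_gt0 c0 d0; have := mulr_gt0 d0 a0; lia.
  case/andP=> /andP[/quadTP[E _ _ _] /and4P[a0 c0 d0 nt]] /eqP e; subst t1.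
  by have := mulr_ge0 a0 c0; have := mulr_ge0 c0 d0; have := mulr_ge0 d0 a0; lia.
have [nt|/negPn/eqP nt] := boolP (t ^+ 2 != n%:Z); last by rewrite (none 0) ?nt ?subrr.
case: (ltgtP (n%:Z - t ^+ 2) 0) => [lt0|gt0|eq0]; last by lia.
  by rewrite (none (n%:Z - t ^+ 2)) ?hz_neg ?mulr0 // ltW.
have NE : n%:Z - t ^+ 2 = (absz (n%:Z - t ^+ 2))%:Z by lia.
by apply: quadT_fiber NE _ tM; lia.
Qed.
End Eichler.

Lemma square_terms p r L : prime p -> (p ^ r <= L)%N ->
  \sum_(t <- irange L | t ^+ 2 == (p ^ r)%N%:Z) (1 : int) = 2 * (~~ odd r : nat)%:Z.
Proof.
move=> p_pr pL; have p0 := prime_gt0 p_pr.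
have [r_odd|r_even] := boolP (odd r).
  rewrite mulr0 big1_seq // => t /andP[/eqP e _]; exfalso.
  have e' : (absz t ^ 2 = p ^ r)%N by rewrite -abszX e.
  by move/(congr1 (logn p)): e'; rewrite lognX pfactorK // => re; move: r_odd; rewrite -re oddM.
have rE : r = (r./2 * 2)%N by move: (odd_double_half r); rewrite (negbTE r_even); lia.
set q := (p ^ r./2)%N.
have qE : (p ^ r = q ^ 2)%N by rewrite {1}rE expnM.
have q0 : (0 < q)%N by rewrite expn_gt0 p0.
rewrite -big_filter (perm_big [:: q%:Z; - q%:Z]); first by rewrite !big_cons big_nil.
apply: uniq_perm; rewrite ?filter_uniq ?irange_uniq //.
  by rewrite /= in_cons orbF andbT; lia.
move=> t; rewrite mem_filter mem_irange !in_cons orbF qE.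
have q_le : (q <= L)%N by apply: leq_trans pL; rewrite qE; nia.
have -> : (q ^ 2)%N%:Z = q%:Z ^+ 2 by rewrite expnS expn1 PoszM.
rewrite eqf_sqr; apply/andP/orP => [[/orP //]|h]; split; first exact/orP.
by case: h => /eqP ->; lia.
Qed.

Lemma eichler p r : prime p -> odd p ->
  6 * \sum_(t <- irange (4 * p ^ r)) hz ((p ^ r)%N%:Z - t ^+ 2) =
  (\sum_(i < r.+1) (2 * (p ^ i)%N%:Z - 3 * (p ^ minn i (r - i))%N%:Z))%:~R.
Proof.
move=> p_pr p_odd; have n_odd : odd (p ^ r) by rewrite oddX p_odd orbT.
rewrite (bigID (fun t : int => t ^+ 2 == (p ^ r)%N%:Z)) /= mulrDr -quadT_class_numbers //.
rewrite quadT_count.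
have B := xcount_balance (p ^ r); have D := @xcount_diagonal p r p_pr p_odd.
have sw : xcount (p ^ r) (fun e f g h => [&& g < f & f == h]) =
  xcount (p ^ r) (fun e f g h => [&& f == g & h < f]).
  rewrite xcount_swap; apply: eq_bcount => e f g h.
  by congr (_ && _); rewrite andbC.
(* For even [r] the two roots of [t^2 = p^r] contribute [6 * 2 * (- 1/12) = - 1], which cancels the
   term [~~ odd r] of [xcount_diagonal]. *)
rewrite (eq_bigr (fun=> - 12%:R^-1)); last by move=> t /eqP ->; rewrite subrr hz0.
have -> : \sum_(t <- irange (4 * p ^ r) | t ^+ 2 == (p ^ r)%N%:Z) - 12%:R^-1 =
  - 12%:R^-1 * (2 * (~~ odd r : nat)%:Z)%:~R :> rat.
  rewrite -(@square_terms p r (4 * p ^ r)) ?leq_pmull // rmorph_sum /= mulr_sumr.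
  by apply: eq_bigr => t _; rewrite mulr1.
set A := bigop _ _ _ in D *.
have -> : 2 * xcount (p ^ r) (fun e f g h => [&& g < e, h < e & e < f + g + h])
  + 6 * xcount (p ^ r) (fun e f g h => f + g + h < e)
  - 2 * xcount (p ^ r) (fun e f g h => [&& g < f, h < f & f < e + g + h])
  - 6 * xcount (p ^ r) (fun e f g h => [&& g < f & f <= h]) = A + (~~ odd r : nat)%:Z by lia.
by rewrite rmorphD rmorphM /=; lra.
Qed.

Local Open Scope classical_set_scope.
Local Open Scope ring_scope.

(** * Power series in the nome *)

Section ComplexNorm.
Variable R : realType.
Implicit Types z w : Cplx R.

(** The norm of [Cplx R] takes its values in [Cplx R]; [cabs] is the same modulus as a real number,
    so that estimates take place in an ordered field. *)
Definition cabs z : R := re `|z|.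

Lemma normr_cabs z : `|z| = of_real (cabs z).
Proof. by rewrite /cabs normc_def. Qed.

Lemma cabsE z : cabs z = Num.sqrt (re z ^+ 2 + im z ^+ 2).
Proof. by rewrite /cabs normc_def. Qed.

Lemma of_real_le (x y : R) : (of_real x <= of_real y) = (x <= y).
Proof. exact: lecR. Qed.

Lemma of_real_lt (x y : R) : (of_real x < of_real y) = (x < y).
Proof. exact: ltcR. Qed.

Lemma of_realD (x y : R) : of_real (x + y) = of_real x + of_real y.
Proof. exact: (rmorphD (real_complex R)). Qed.

Lemma of_realM (x y : R) : of_real (x * y) = of_real x * of_real y.
Proof. exact: (rmorphM (real_complex R)). Qed.

Lemma of_realX (x : R) n : of_real (x ^+ n) = of_real x ^+ n.
Proof. exact: (rmorphXn (real_complex R)). Qed.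

Lemma of_real_nat n : of_real n%:R = n%:R :> Cplx R.
Proof. exact: (rmorph_nat (real_complex R)). Qed.

Lemma cabs_ge0 z : 0 <= cabs z.
Proof. by rewrite cabsE sqrtr_ge0. Qed.

Lemma cabsM z w : cabs (z * w) = cabs z * cabs w.
Proof. by rewrite {1}/cabs normrM !normr_cabs -of_realM. Qed.

Lemma cabsX z n : cabs (z ^+ n) = cabs z ^+ n.
Proof. by rewrite {1}/cabs normrX !normr_cabs -of_realX. Qed.

Lemma cabsD z w : cabs (z + w) <= cabs z + cabs w.
Proof. by rewrite -of_real_le of_realD -!normr_cabs ler_normD. Qed.

Lemma cabsN z : cabs (- z) = cabs z.
Proof. by rewrite /cabs normrN. Qed.

Lemma cabs0 : cabs 0 = 0. Proof. by rewrite /cabs normr0. Qed.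

Lemma cabs1 : cabs 1 = 1. Proof. by rewrite /cabs normr1. Qed.

Lemma cabs_eq0 z : (cabs z == 0) = (z == 0).
Proof.
by apply/eqP/eqP => [h|->]; [apply: normr0_eq0; rewrite normr_cabs h|rewrite cabs0].
Qed.

Lemma cabs_gt0 z : (0 < cabs z) = (z != 0).
Proof. by rewrite lt_neqAle cabs_ge0 andbT eq_sym cabs_eq0. Qed.

Lemma cabs_of_real (x : R) : cabs (of_real x) = `|x|.
Proof. by rewrite cabsE /= expr0n addr0 sqrtr_sqr. Qed.

Lemma cabs_nat n : cabs n%:R = n%:R.
Proof. by rewrite -of_real_nat cabs_of_real ger0_norm. Qed.

Lemma cabs_sum I (s : seq I) P (F : I -> Cplx R) :
  cabs (\sum_(i <- s | P i) F i) <= \sum_(i <- s | P i) cabs (F i).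
Proof.
elim/big_ind2 : _ => [|x1 x2 y1 y2 h1 h2|i _]; rewrite ?cabs0 //.
exact: (le_trans (cabsD _ _) (lerD h1 h2)).
Qed.

Lemma re_le_cabs z : `|re z| <= cabs z.
Proof. by rewrite -of_real_le -normr_cabs; exact: normc_ge_Re. Qed.

Lemma im_le_cabs z : `|im z| <= cabs z.
Proof.
by rewrite cabsE -[`|im z|]sqrtr_sqr ler_wsqrtr // lerDr sqr_ge0.
Qed.

Lemma cabs_le_re_im z : cabs z <= `|re z| + `|im z|.
Proof.
have -> : z = of_real (re z) + (0 +i* 1)%C * of_real (im z).
  by case: z => x y; rewrite /of_real /=; simpc.
rewrite (le_trans (cabsD _ _)) // cabsM !cabs_of_real.
have -> : re (of_real (re z) + (0 +i* 1)%C * of_real (im z)) = re z by case: z => x y /=; simpc.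
have -> : im (of_real (re z) + (0 +i* 1)%C * of_real (im z)) = im z by case: z => x y /=; simpc.
by rewrite lerD2l (cabsE (0 +i* 1)%C) /= expr0n add0r expr1n sqrtr1 mul1r.
Qed.

Lemma reD z w : re (z + w) = re z + re w. Proof. by case: z w => ? ? []. Qed.
Lemma imD z w : im (z + w) = im z + im w. Proof. by case: z w => ? ? []. Qed.
Lemma reB z w : re (z - w) = re z - re w. Proof. by case: z w => ? ? []. Qed.
Lemma imB z w : im (z - w) = im z - im w. Proof. by case: z w => ? ? []. Qed.

Lemma re_sum I (s : seq I) P (F : I -> Cplx R) : re (\sum_(i <- s | P i) F i) = \sum_(i <- s | P i) re (F i).
Proof. by elim/big_rec2 : _ => // i x y _ <-; rewrite reD. Qed.
Lemma im_sum I (s : seq I) P (F : I -> Cplx R) : im (\sum_(i <- s | P i) F i) = \sum_(i <- s | P i) im (F i).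
Proof. by elim/big_rec2 : _ => // i x y _ <-; rewrite imD. Qed.

Lemma cvg_cabsP T (F : set_system T) (FF : Filter F) (f : T -> Cplx R) (l : Cplx R) :
  f @ F --> l <-> (fun x => cabs (l - f x)) @ F --> (0 : R).
Proof.
split=> [/cvgrPdist_lt h|/cvgrPdist_lt h]; apply/cvgrPdist_lt => e e0.
  have e0' : 0 < of_real e by rewrite (of_real_lt 0).
  apply: filterS (h _ e0') => x.
  by rewrite normr_cabs of_real_lt sub0r normrN ger0_norm ?cabs_ge0.
have eE : e = of_real (re e).
  by move: e0; case: e => a b; rewrite ltcE /= => /andP[/eqP -> _].
have e1 : 0 < re e by move: e0; rewrite {1}eE (of_real_lt 0).
apply: filterS (h _ e1) => x.
by rewrite sub0r normrN ger0_norm ?cabs_ge0 // normr_cabs {2}eE of_real_lt.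
Qed.

Definition geom_bounded (a : nat -> Cplx R) (M y : R) :=
  [/\ 0 <= y < 1 & forall n, cabs (a n) <= M * y ^+ n].

Lemma geom_bounded_ge0 a M y : geom_bounded a M y -> 0 <= M.
Proof. by case=> _ /(_ 0%N); rewrite expr0 mulr1; apply: le_trans; apply: cabs_ge0. Qed.

Lemma geom_sum_le (y M : R) n : 0 <= y < 1 -> 0 <= M ->
  \sum_(0 <= k < n) M * y ^+ k <= M / (1 - y).
Proof.
move=> /andP[y0 y1] M0; have y1' : 0 < 1 - y by rewrite subr_gt0.
rewrite -mulr_sumr ler_wpM2l // -[leRHS]div1r ler_pdivlMr //.
suff -> : (\sum_(0 <= k < n) y ^+ k) * (1 - y) = 1 - y ^+ n by rewrite gerBl exprn_ge0.
elim: n => [|n IHn]; first by rewrite big_geq // mul0r expr0 subrr.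
by rewrite big_nat_recr //= mulrDl IHn exprS; ring.
Qed.

Lemma geom_bounded_partial a M y n : geom_bounded a M y -> cabs (series a n) <= M / (1 - y).
Proof.
move=> bd; have M0 := geom_bounded_ge0 bd; case: bd => y01 aM.
apply: le_trans (cabs_sum _ _ _) (le_trans _ (geom_sum_le n y01 M0)).
exact: ler_sum.
Qed.

Lemma geom_bounded_cvg a M y : geom_bounded a M y -> cvgn (series a).
Proof.
move=> bd; have M0 := geom_bounded_ge0 bd; case: bd => /andP[y0 y1] aM.
have cv (u : nat -> R) : (forall n, `|u n| <= cabs (a n)) -> cvgn (series u).
  move=> ua; apply: normed_cvg.
  apply: (@series_le_cvg _ _ (geometric M y)) => [n|n|n|] //=.
  - by rewrite mulr_ge0 ?exprn_ge0.
  - exact: le_trans (ua n) (aM n).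
  - by apply: is_cvg_geometric_series; rewrite ger0_norm.
have /cvg_ex[/= x xP] := cv (fun n => re (a n)) (fun n => re_le_cabs (a n)).
have /cvg_ex[/= z zP] := cv (fun n => im (a n)) (fun n => im_le_cabs (a n)).
apply: (cvgP ((x +i* z)%C : Cplx R)); apply/cvg_cabsP.
move/cvgrPdist_lt: xP => xP; move/cvgrPdist_lt: zP => zP; apply/cvgrPdist_lt => e e0.
have e2 : 0 < e / 2 by rewrite divr_gt0.
have h1 := xP _ e2; have h2 := zP _ e2; near=> n.
rewrite sub0r normrN ger0_norm ?cabs_ge0 // (le_lt_trans (cabs_le_re_im _)) //.
rewrite reB imB /= re_sum im_sum [ltRHS]splitr ltrD //; by near: n.
Unshelve. all: by end_near. Qed.

Lemma cabs_lim_le (u : nat -> Cplx R) (B : R) l :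
  u @ \oo --> l -> (forall n, cabs (u n) <= B) -> cabs l <= B.
Proof.
move=> /cvg_cabsP /cvgrPdist_lt ul uB; apply/ler_addgt0Pr => e e0.
have [N _ /(_ N (leqnn N))] := ul e e0.
rewrite /= sub0r normrN ger0_norm ?cabs_ge0 // => h.
rewrite -[l](subrK (u N)) addrC (le_trans (cabsD _ _)) // lerD ?uB //; exact: ltW.
Qed.

Lemma series_sum_le a M y l : geom_bounded a M y -> series a @ \oo --> l ->
  cabs l <= M / (1 - y).
Proof. by move=> bd /cabs_lim_le; apply=> n; apply: geom_bounded_partial. Qed.

End ComplexNorm.

Section RealBounds.
Variable R : realType.
Implicit Types x y : R.

Lemma abs_sin_le y : `|sin y| <= `|y|.
Proof.
wlog y0 : y / 0 < y => [hw|].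
  case: (ltgtP 0 y) => [|y0|<-]; [exact: hw| |by rewrite sin0 !normr0].
  by rewrite -normrN -sinN -[leRHS]normrN; apply: hw; rewrite oppr_gt0.
have [c _] := MVT y0 (fun x _ => is_derive_sin x) (continuous_subspaceT (@continuous_sin R)).
rewrite sin0 !subr0 => ->; rewrite normrM -[leRHS]mul1r ler_wpM2r //; exact: cos_max.
Qed.

Lemma abs_cosB1_le y : `|cos y - 1| <= y ^+ 2.
Proof.
have -> : cos y - 1 = - (2 * sin (y / 2) ^+ 2).
  have -> : cos y = cos (y / 2 + y / 2) by rewrite -splitr.
  by rewrite cosD; have := cos2Dsin2 (y / 2); lra.
rewrite normrN normrM normrX ger0_norm //.
have h := abs_sin_le (y / 2).
have h2 : `|sin (y / 2)| ^+ 2 <= `|y / 2| ^+ 2 by rewrite ler_pXn2r // nnegrE.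
have h3 : `|y / 2| ^+ 2 = y ^+ 2 / 4 by rewrite real_normK ?num_real //; field.
have := sqr_ge0 y; rewrite h3 in h2; lra.
Qed.

Lemma abs_cosB1_le1 y : `|cos y - 1| <= 2 * `|y|.
Proof.
have [y1|y1] := leP `|y| 1.
  rewrite (le_trans (abs_cosB1_le y)) // -[y ^+ 2]real_normK ?num_real //.
  have := normr_ge0 y; nra.
have h : `|cos y - 1| <= 2 by rewrite (le_trans (ler_normB _ _)) // normr1; have := cos_max y; lra.
lra.
Qed.

Lemma abs_sinB_le y : `|sin y - y| <= 2 * y ^+ 2.
Proof.
wlog y0 : y / 0 < y => [hw|].
  case: (ltgtP 0 y) => [|y0|<-]; [exact: hw| |by rewrite sin0 subrr normr0 expr0n /= mulr0].
  have := hw (- y); rewrite oppr_gt0 sinN sqrrN opprK => /(_ y0).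
  by rewrite (_ : - sin y + y = - (sin y - y)) ?normrN //; ring.
have [c] := MVT y0 (fun x _ => is_derive_sin x) (continuous_subspaceT (@continuous_sin R)).
rewrite in_itv /= => /andP[c0 cy]; rewrite sin0 !subr0 => ->.
rewrite (_ : cos c * y - y = (cos c - 1) * y); last ring.
have := abs_cosB1_le1 c; rewrite normrM (ger0_norm (ltW c0)) (ger0_norm (ltW y0)) => h.
rewrite expr2 mulrA; apply: ler_wpM2r; first exact: ltW.
by apply: le_trans h _; lra.
Qed.

Lemma expR_le_abs x : expR x <= expR `|x|.
Proof. by rewrite ler_expR ler_norm. Qed.

Lemma abs_expRB1_le x : `|expR x - 1| <= `|x| * expR `|x|.
Proof.
have h1 := expR_ge1Dx x; have h2 := expR_ge1Dx (- x).
have eE : expR x * expR (- x) = 1 by rewrite -expRD subrr expR0.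
have e0 := expR_gt0 x.
case: (leP 0 x) => x0.
  rewrite (ger0_norm x0) ger0_norm; last by lra.
  nra.
rewrite (ltr0_norm x0) ler0_norm; last by nra.
have : 1 <= expR (- x) by lra.
nra.
Qed.

Lemma abs_expRB1B_le x : `|expR x - 1 - x| <= x ^+ 2 * expR `|x|.
Proof.
have h1 := expR_ge1Dx x; have h2 := expR_ge1Dx (- x).
have eE : expR x * expR (- x) = 1 by rewrite -expRD subrr expR0.
have e0 := expR_gt0 x; rewrite ger0_norm; last by lra.
apply: (@le_trans _ _ (x * (expR x - 1))); first by nra.
rewrite (le_trans (ler_norm _)) // normrM -[x ^+ 2]real_normK ?num_real // expr2 -mulrA.
by rewrite ler_wpM2l // abs_expRB1_le.
Qed.
End RealBounds.

(** * The complex exponential and the nome *)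

Section ComplexExp.
Variable R : realType.
Implicit Types z w tau : Cplx R.

Lemma cexpD z w : cexp (z + w) = cexp z * cexp w.
Proof.
rewrite /cexp reD imD expRD cosD sinD; case: z w => a b [c d] /=.
by apply/eqP; rewrite eq_complex /=; apply/andP; split; apply/eqP; ring.
Qed.

Lemma cexp0 : cexp 0 = 1 :> Cplx R.
Proof. by rewrite /cexp /= expR0 cos0 sin0 mulr1 mulr0. Qed.

Lemma cexpMn z n : cexp (n%:R * z) = cexp z ^+ n.
Proof.
elim: n => [|n IHn]; first by rewrite mul0r cexp0.
by rewrite -nat1r mulrDl mul1r cexpD IHn exprS.
Qed.

Lemma cabs_cexp z : cabs (cexp z) = expR (re z).
Proof.
rewrite cabsE /cexp /= !exprMn -mulrDr cos2Dsin2 mulr1 sqrtr_sqr ger0_norm // expR_ge0.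
Qed.

(** Splitting into real and imaginary parts gives four errors, bounded by 1, 1, 2 and 1 times
    [r^2 expR r]; hence the constant 5. *)
Lemma cexp_taylor z : cabs (cexp z - 1 - z) <= 5 * cabs z ^+ 2 * expR (cabs z).
Proof.
have [xz yz] := (re_le_cabs z, im_le_cabs z).
apply: le_trans (cabs_le_re_im _) _.
have -> : re (cexp z - 1 - z) = (expR (re z) - 1 - re z) + expR (re z) * (cos (im z) - 1).
  by case: z {xz yz} => a b; rewrite /cexp /=; ring.
have -> : im (cexp z - 1 - z) = expR (re z) * (sin (im z) - im z) + im z * (expR (re z) - 1).
  by case: z {xz yz} => a b; rewrite /cexp /=; ring.
move: (re z) (im z) xz yz => x y xz yz; set r := cabs z.
have r0 : 0 <= r := cabs_ge0 z.
have E : expR `|x| <= expR r by rewrite ler_expR.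
have E0 : 0 < expR r := expR_gt0 _.
have x2 : x ^+ 2 <= r ^+ 2 by rewrite -[x ^+ 2]real_normK ?num_real // ler_pXn2r ?nnegrE.
have y2 : y ^+ 2 <= r ^+ 2 by rewrite -[y ^+ 2]real_normK ?num_real // ler_pXn2r ?nnegrE.
have t1 : `|expR x - 1 - x| <= r ^+ 2 * expR r.
  by apply: le_trans (abs_expRB1B_le x) _; apply: ler_pM; rewrite ?sqr_ge0 ?expR_ge0.
have Ex : `|expR x| <= expR r by rewrite ger0_norm ?expR_ge0 // (le_trans (expR_le_abs x)).
have t2 : `|expR x * (cos y - 1)| <= r ^+ 2 * expR r.
  by rewrite normrM mulrC ler_pM // (le_trans (abs_cosB1_le y)).
have t3 : `|expR x * (sin y - y)| <= 2 * r ^+ 2 * expR r.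
  rewrite normrM mulrC ler_pM // (le_trans (abs_sinB_le y)) //; lra.
have t4 : `|y * (expR x - 1)| <= r ^+ 2 * expR r.
  rewrite normrM expr2 -mulrA ler_pM //.
  by rewrite (le_trans (abs_expRB1_le x)) // ler_pM ?expR_ge0.
have := ler_normD (expR x - 1 - x) (expR x * (cos y - 1)).
have := ler_normD (expR x * (sin y - y)) (y * (expR x - 1)).
lra.
Qed.

Lemma re_two_pi_i tau : re (two_pi_i R * tau) = - (2 * pi * im tau).
Proof. by case: tau => a b; rewrite /two_pi_i /re /im /=; ring. Qed.

Lemma cabs_two_pi_i : cabs (two_pi_i R) = 2 * pi.
Proof.
rewrite cabsE /two_pi_i /= expr0n add0r sqrtr_sqr ger0_norm // mulr_ge0 //.
exact: pi_ge0.
Qed.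

Lemma cabs_nome tau : cabs (nome tau) = expR (- (2 * pi * im tau)).
Proof. by rewrite /nome cabs_cexp re_two_pi_i. Qed.

Lemma cabs_nome_lt1 tau : 0 < im tau -> 0 < cabs (nome tau) < 1.
Proof.
move=> t0; rewrite cabs_nome expR_gt0 /= -{2}expR0 ltr_expR oppr_lt0.
by rewrite mulr_gt0 // mulr_gt0 // pi_gt0.
Qed.

Lemma nomeD tau h : nome (tau + h) = nome tau * nome h.
Proof. by rewrite /nome mulrDr cexpD. Qed.
End ComplexExp.

(** * Power series that converge in the unit disc *)

Section QSeries.
Variable R : realType.
Implicit Types (c d : nat -> Cplx R) (tau h : Cplx R).

(* The power series with coefficients [c] converges in the open unit disc. *)
Definition tempered c :=
  forall x : R, 0 <= x < 1 -> exists M, forall n, cabs (c n) * x ^+ n <= M.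

(** The bound at the larger radius [x' = (1 + x) / 2 < 1] gives geometric decay with ratio [x / x']
    at [x]. *)
Lemma tempered_geom c (x : R) : tempered c -> 0 <= x < 1 ->
  exists M y, [/\ 0 <= M, 0 <= y < 1 & forall n, cabs (c n) * x ^+ n <= M * y ^+ n].
Proof.
move=> tc /andP[x0 x1]; pose x' := (1 + x) / 2.
have x'0 : 0 < x' by rewrite /x'; lra.
have [|M MP] := tc x'; first by rewrite /x'; lra.
exists M, (x / x'); split.
- by apply: le_trans (MP 0%N); rewrite expr0 mulr1 cabs_ge0.
- by rewrite divr_ge0 ?(ltW x'0) //= ltr_pdivrMr // mul1r /x'; lra.
move=> n; have -> : cabs (c n) * x ^+ n = cabs (c n) * x' ^+ n * (x / x') ^+ n.
  by rewrite -mulrA -exprMn [x' * _]mulrC divfK // gt_eqF.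
by apply: ler_wpM2r => //; rewrite exprn_ge0 // divr_ge0 // ltW.
Qed.

(** Each of the [n] terms [y^0, ..., y^(n-1)] of the geometric sum is at least [y^n]. *)
Lemma natmul_geom_le (y : R) n : 0 <= y < 1 -> n%:R * y ^+ n <= 1 / (1 - y).
Proof.
move=> y01; have /andP[y0 y1] := y01; apply: le_trans (geom_sum_le n y01 ler01).
rewrite mulr_natl -[X in _ *+ X]subn0 -sumr_const_nat; apply: ler_sum_nat => i /andP[_ i_n].
by rewrite mul1r; apply: ler_wiXn2l => //; [exact: ltW|exact: ltnW].
Qed.

Lemma tempered_le c d : tempered d -> (forall n, cabs (c n) <= cabs (d n)) -> tempered c.
Proof.
move=> td cd x x01; have [M MP] := td x x01; exists M => n.
by apply: le_trans (MP n); rewrite ler_wpM2r // exprn_ge0 //; case/andP: x01.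
Qed.

Lemma temperedD c d : tempered c -> tempered d -> tempered (fun n => c n + d n).
Proof.
move=> tc td x x01; have [M MP] := tc x x01; have [M' MP'] := td x x01; exists (M + M') => n.
apply: le_trans (lerD (MP n) (MP' n)); rewrite -mulrDl ler_wpM2r ?cabsD // exprn_ge0 //.
by case/andP: x01.
Qed.

Lemma temperedZ a c : tempered c -> tempered (fun n => a * c n).
Proof.
move=> tc x x01; have [M MP] := tc x x01; exists (cabs a * M) => n.
by rewrite cabsM -mulrA ler_wpM2l ?cabs_ge0.
Qed.

Lemma tempered_natM c : tempered c -> tempered (fun n => n%:R * c n).
Proof.
move=> tc x x01; have [M [y [M0 y01 MP]]] := tempered_geom tc x01.
exists (M * (1 / (1 - y))) => n; rewrite cabsM cabs_nat -mulrA.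
apply: le_trans (_ : n%:R * (M * y ^+ n) <= _); first by rewrite ler_wpM2l.
by rewrite mulrCA ler_wpM2l // natmul_geom_le.
Qed.

Lemma tempered0 : tempered (fun=> 0).
Proof. by move=> x x01; exists 0 => n; rewrite cabs0 mul0r. Qed.

Lemma tempered1 : tempered (fun=> 1).
Proof. by move=> x /andP[x0 x1]; exists 1 => n; rewrite cabs1 mul1r exprn_ile1 // ltW. Qed.

Lemma tempered_sum I (s : seq I) (c : I -> nat -> Cplx R) :
  (forall i, tempered (c i)) -> tempered (fun n => \sum_(i <- s) c i n).
Proof.
move=> tc; elim: s => [|i s IHs].
  by apply: tempered_le tempered0 _ => n; rewrite big_nil.
by apply: tempered_le (temperedD (tc i) IHs) _ => n; rewrite big_cons.
Qed.

Lemma tempered_poly c (A : R) k : (forall n, cabs (c n) <= A * n.+1%:R ^+ k) -> tempered c.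
Proof.
move=> cA; have tp : tempered (fun n => n.+1%:R ^+ k).
  elim: k {cA} => [|k IHk]; first by apply: tempered_le tempered1 _ => n; rewrite expr0.
  apply: tempered_le (temperedD (tempered_natM IHk) IHk) _ => n.
  by rewrite exprS -natr1 mulrDl mul1r.
apply: tempered_le (temperedZ (of_real A) tp) _ => n.
rewrite cabsM cabsX cabs_nat cabs_of_real (le_trans (cA n)) // ler_wpM2r ?exprn_ge0 //.
exact: ler_norm.
Qed.

Definition cauchy_prod c d n : Cplx R := \sum_(i < n.+1) c i * d (n - i)%N.

Lemma tempered_geom2 c d (x : R) : tempered c -> tempered d -> 0 <= x < 1 ->
  exists M y, [/\ 0 <= M, 0 <= y < 1, forall n, cabs (c n) * x ^+ n <= M * y ^+ n &
                  forall n, cabs (d n) * x ^+ n <= M * y ^+ n].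
Proof.
move=> tc td x01; have [M [y [M0 /andP[y0 y1] MP]]] := tempered_geom tc x01.
have [N [z [N0 /andP[z0 z1] NP]]] := tempered_geom td x01.
exists (Num.max M N), (Num.max y z); split.
- by rewrite le_max M0.
- by rewrite le_max y0 gt_max y1.
- move=> n; apply: le_trans (MP n) _; apply: ler_pM; rewrite ?exprn_ge0 ?le_max ?lexx //.
  by rewrite lerXn2r ?nnegrE ?le_max ?y0 ?lexx.
- move=> n; apply: le_trans (NP n) _; apply: ler_pM; rewrite ?exprn_ge0 ?le_max ?lexx ?orbT //.
  by rewrite lerXn2r ?nnegrE ?le_max ?z0 ?lexx ?orbT.
Qed.

Lemma tempered_cauchy c d : tempered c -> tempered d -> tempered (cauchy_prod c d).
Proof.
move=> tc td x x01; have [M [y [M0 y01 cM dM]]] := tempered_geom2 tc td x01.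
have [x0 x1] := andP x01; have [y0 y1] := andP y01.
exists (M ^+ 2 * (1 / (1 - y))) => n.
apply: le_trans (_ : \sum_(i < n.+1) M ^+ 2 * y ^+ n <= _).
  apply: le_trans (_ : (\sum_(i < n.+1) cabs (c i * d (n - i)%N)) * x ^+ n <= _).
    by rewrite ler_wpM2r ?exprn_ge0 // cabs_sum.
  rewrite mulr_suml ler_sum // => i _.
  have -> : x ^+ n = x ^+ i * x ^+ (n - i) by rewrite -exprD subnKC // -ltnS.
  have -> : y ^+ n = y ^+ i * y ^+ (n - i) by rewrite -exprD subnKC // -ltnS.
  rewrite cabsM expr2 [leLHS]mulrACA [leRHS]mulrACA ler_pM // mulr_ge0 ?cabs_ge0 // exprn_ge0 //.
rewrite sumr_const card_ord -mulrnAr ler_wpM2l ?sqr_ge0 //.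
apply: le_trans (geom_sum_le n.+1 y01 ler01).
rewrite -[X in _ *+ X]subn0 -sumr_const_nat; apply: ler_sum_nat => i /andP[_ i_n].
by rewrite mul1r; apply: ler_wiXn2l => //; exact: ltW.
Qed.

Definition qterm c tau n : Cplx R := c n * nome tau ^+ n.
Definition qsum c tau : Cplx R := limn (series (qterm c tau)).

Lemma qterm_bounded c tau : tempered c -> 0 < im tau ->
  exists M y, geom_bounded (qterm c tau) M y.
Proof.
move=> tc /cabs_nome_lt1 /andP[q0 q1].
have [|M [y [M0 y01 MP]]] := tempered_geom tc (x := cabs (nome tau)); first by rewrite ltW.
by exists M, y; split=> // n; rewrite cabsM cabsX.
Qed.

Lemma qsum_cvg c tau : tempered c -> 0 < im tau -> series (qterm c tau) @ \oo --> qsum c tau.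
Proof. by move=> tc t0; have [M [y bd]] := qterm_bounded tc t0; apply: geom_bounded_cvg bd. Qed.

Lemma cplx_hausdorff : hausdorff_space (Cplx R).
Proof. exact: norm_hausdorff. Qed.

Lemma qsum_unique c tau l : series (qterm c tau) @ \oo --> l -> qsum c tau = l.
Proof. exact: (cvg_lim cplx_hausdorff). Qed.

Lemma eq_qsum c d tau : (forall n, c n = d n) -> qsum c tau = qsum d tau.
Proof. by move=> cd; rewrite /qsum (_ : qterm c tau = qterm d tau) //; apply/funext => n; rewrite /qterm cd. Qed.

Lemma qsumD c d tau : tempered c -> tempered d -> 0 < im tau ->
  qsum (fun n => c n + d n) tau = qsum c tau + qsum d tau.
Proof.
move=> tc td t0; apply: qsum_unique.
rewrite (_ : series _ = series (qterm c tau) \+ series (qterm d tau)); first by apply: cvgD; exact: qsum_cvg.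
apply/funext => n; rewrite /series /= /qterm -big_split /=.
by apply: eq_bigr => k _; rewrite mulrDl.
Qed.

Lemma qsumZ a c tau : tempered c -> 0 < im tau ->
  qsum (fun n => a * c n) tau = a * qsum c tau.
Proof.
move=> tc t0; apply: qsum_unique.
rewrite (_ : series _ = (fun n => a * series (qterm c tau) n)).
  by apply: cvgM; [exact: cvg_cst|exact: qsum_cvg].
apply/funext => n; rewrite /series /= /qterm mulr_sumr.
by apply: eq_bigr => k _; rewrite mulrA.
Qed.

Lemma qsum_sum (I : Type) (s : seq I) (c : I -> nat -> Cplx R) tau :
  (forall i, tempered (c i)) -> 0 < im tau ->
  qsum (fun n => \sum_(i <- s) c i n) tau = \sum_(i <- s) qsum (c i) tau.
Proof.
move=> tc t0; elim: s => [|i s IHs].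
  rewrite big_nil; apply: qsum_unique; rewrite (_ : series _ = cst 0); first exact: cvg_cst.
  by apply/funext => n; rewrite /series /= big1 // => k _; rewrite /qterm big_nil mul0r.
rewrite big_cons -IHs -qsumD //; last exact: tempered_sum.
by apply: eq_qsum => n; rewrite big_cons.
Qed.
End QSeries.

Section QSeriesAnalysis.
Variable R : realType.
Implicit Types (c d : nat -> Cplx R) (tau h : Cplx R).

Lemma cvg_cabs_bound (u : nat -> Cplx R) (l : Cplx R) (M y : R) : 0 <= y < 1 ->
  (forall n, cabs (l - u n) <= M * y ^+ n) -> u @ \oo --> l.
Proof.
move=> /andP[y0 y1] uM; apply/cvg_cabsP.
apply: (@squeeze_cvgr _ _ _ _ (cst 0) (geometric M y)); last 2 first.
- exact: cvg_cst.
- by apply: cvg_geometric; rewrite ger0_norm.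
by apply: nearW => n; rewrite cabs_ge0 /= uM.
Qed.

Lemma cauchy_prod_partial (a b : nat -> Cplx R) N :
  series (cauchy_prod a b) N = \sum_(0 <= i < N) a i * series b (N - i)%N.
Proof.
rewrite /series /= /cauchy_prod.
transitivity (\sum_(0 <= n < N) \sum_(0 <= i < N | (i <= n)%N) a i * b (n - i)%N).
  rewrite !big_nat; apply: eq_bigr => n /andP[_ nN].
  rewrite -(big_mkord xpredT (fun i => a i * b (n - i)%N)).
  by rewrite [RHS](big_cat_nat (n := n.+1)) //= [X in _ = _ + X]big_nat_cond [X in _ = _ + X]big1 ?addr0;
    [rewrite big_nat [RHS]big_nat_cond; apply: eq_bigl => i; lia|move=> i; lia].
rewrite (exchange_big_dep_nat xpredT) //= !big_nat; apply: eq_bigr => i /andP[_ iN].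
rewrite mulr_sumr (big_cat_nat (n := i)) //=; last exact: ltnW.
rewrite big_nat_cond big1 ?add0r; last by move=> n; lia.
rewrite -[X in bigop _ (index_iota X _)](add0n i) big_addn big_mkcond /=; apply: eq_bigr => n _.
by rewrite leq_addl addnK.
Qed.

Lemma qsum_cauchy c d tau : tempered c -> tempered d -> 0 < im tau ->
  qsum c tau * qsum d tau = qsum (cauchy_prod c d) tau.
Proof.
move=> tc td t0; apply/esym/qsum_unique.
have /andP[q0 q1] := cabs_nome_lt1 t0.
have [|M [y [M0 y01 cM dM]]] := tempered_geom2 tc td (x := cabs (nome tau)); first by rewrite ltW.
pose a := qterm c tau; pose b := qterm d tau.
have aM n : cabs (a n) <= M * y ^+ n by rewrite cabsM cabsX.
have bM n : cabs (b n) <= M * y ^+ n by rewrite cabsM cabsX.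
have -> : qterm (cauchy_prod c d) tau = cauchy_prod a b.
  apply/funext => n; rewrite /qterm /cauchy_prod mulr_suml; apply: eq_bigr => i _.
  have -> : nome tau ^+ n = nome tau ^+ i * nome tau ^+ (n - i) by rewrite -exprD subnKC // -ltnS.
  by rewrite /a /b /qterm mulrACA.
have prod_cvg : (fun N => series a N * series b N) @ \oo --> qsum c tau * qsum d tau.
  by apply: cvgM; apply: qsum_cvg.
have [y0 y1] := andP y01.
have tail i N : (i <= N)%N -> cabs (series b N - series b (N - i)%N) <= N%:R * (M * y ^+ (N - i)).
  move=> iN; rewrite /series /= (big_cat_nat (n := (N - i)%N)) ?leq_subr //= addrAC subrr add0r.
  apply: le_trans (cabs_sum _ _ _) _.
  apply: le_trans (_ : \sum_(N - i <= k < N) M * y ^+ (N - i) <= _).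
    apply: ler_sum_nat => k /andP[Nk _]; apply: le_trans (bM k) _.
    by rewrite ler_wpM2l // ler_wiXn2l // ltW.
  rewrite sumr_const_nat subKn // -[leLHS]mulr_natl ler_wpM2r ?mulr_ge0 ?exprn_ge0 //.
  by rewrite ler_nat.
(* Row [i] of the Cauchy product stops at [N - i]. The missing part of that row is at most
   [N M^2 y^N], and there are [N] rows. *)
have diff N : cabs (series a N * series b N - series (cauchy_prod a b) N) <=
    M ^+ 2 * (cabs ((N%:R : Cplx R) * (N%:R * 1)) * y ^+ N).
  rewrite cauchy_prod_partial {1}/series /= mulr_suml -sumrB.
  apply: le_trans (cabs_sum _ _ _) _.
  apply: le_trans (_ : \sum_(0 <= i < N) N%:R * (M ^+ 2 * y ^+ N) <= _).
    apply: ler_sum_nat => i /andP[_ iN]; rewrite -mulrBr cabsM.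
    apply: le_trans (ler_pM (cabs_ge0 _) (cabs_ge0 _) (aM i) (tail i N (ltnW iN))) _.
    have -> : y ^+ N = y ^+ i * y ^+ (N - i) by rewrite -exprD subnKC // ltnW.
    by rewrite le_eqVlt; apply/orP; left; apply/eqP; ring.
  rewrite sumr_const_nat subn0 -[leLHS]mulr_natl mulr1 cabsM cabs_nat.
  by rewrite le_eqVlt; apply/orP; left; apply/eqP; ring.
(* Factors [N^2] are absorbed by temperedness of the sequence [N * (N * 1)]; this explains the shape
   of the bound in [diff]. *)
have [M' [y' [M'0 y'01 M'P]]] := tempered_geom (tempered_natM (tempered_natM (@tempered1 R))) y01.
have diff_cvg : (fun N => series (cauchy_prod a b) N - series a N * series b N) @ \oo --> (0 : Cplx R).
  apply: (cvg_cabs_bound (M := M ^+ 2 * M') y'01) => N.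
  rewrite sub0r opprB (le_trans (diff N)) // -[leRHS]mulrA ler_wpM2l ?sqr_ge0 //.
rewrite -[X in _ --> X]add0r.
rewrite (_ : series (cauchy_prod a b) =
  (fun N => series (cauchy_prod a b) N - series a N * series b N) \+ (fun N => series a N * series b N)).
  by apply: cvgD; [exact: diff_cvg|exact: prod_cvg].
by apply/funext => N; rewrite /= subrK.
Qed.

Lemma im_pos_near tau : 0 < im tau -> \forall t \near tau, 0 < im t.
Proof.
move=> t0; apply/nbhs_ballP; exists (of_real (im tau)); first by rewrite /= (of_real_lt 0).
move=> t; rewrite -ball_normE /= normr_cabs of_real_lt => ht.
have := le_lt_trans (im_le_cabs (tau - t)) ht; rewrite imB.
by have := ler_norm (im tau - im t); lra.
Qed.

(** The difference quotient minus the expected derivative is, term by term, a second-order remainder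
    of the exponential. Summed up, it is at most [C |h|]. *)
Lemma qsum_derive c tau (F : Cplx R -> Cplx R) : tempered c -> 0 < im tau ->
  (forall t, 0 < im t -> F t = qsum c t) ->
  derive1 F tau = qsum (fun n => two_pi_i R * (n%:R * c n)) tau.
Proof.
(* [F] is known on the upper half-plane only; this is a neighbourhood of [tau], which suffices for
   the derivative. *)
move=> tc t0 FE; rewrite derive1E (near_eq_derive _ (_ : \near tau, F tau = qsum c tau)); last first.
  by apply: filterS (im_pos_near t0) => t /FE.
rewrite -derive1E {FE F}.
set L := qsum _ _ in |- *; rewrite /derive1; apply: cvg_lim; first exact: norm_hausdorff.
apply/cvg_cabsP.
have /andP[q0 q1] := cabs_nome_lt1 t0; set x0 := cabs (nome tau) in q0 q1.
pose x1 := (1 + x0) / 2; have x1_gt0 : 0 < x1 by rewrite /x1; lra.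
have x1_lt1 : x1 < 1 by rewrite /x1; lra.
have pi0 := pi_gt0 R.
(* Here [expR (2 pi dl) = x1 / x0], so for [|h| < dl] the factor [expR (2 pi n |h|)] enlarges [x0^n]
   to at most [x1^n], still inside the unit disc. *)
pose dl := ln (x1 / x0) / (2 * pi).
have x10 : 1 < x1 / x0 by rewrite ltr_pdivlMr // mul1r /x1; lra.
have dl0 : 0 < dl by rewrite divr_gt0 ?ln_gt0 // mulr_gt0.
have edl : expR (2 * pi * dl) = x1 / x0.
  by rewrite /dl mulrCA mulfV ?mulr1 ?lnK // ?posrE ?(lt_trans _ x10) // gt_eqF // mulr_gt0.
have tc2 := tempered_natM (tempered_natM tc).
have [|M [y [M0 y01 MP]]] := tempered_geom tc2 (x := x1); first by rewrite ltW.
pose C := 5 * (2 * pi) ^+ 2 * M / (1 - y).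
have key h : h != 0 -> cabs h < dl -> 0 < im (h + tau) ->
    cabs (L - h^-1 *: (qsum c (h + tau) - qsum c tau)) <= C * cabs h.
  move=> h0 hd th0.
  pose e n := c n * nome tau ^+ n * (cexp (n%:R * (two_pi_i R * h)) - 1 - n%:R * (two_pi_i R * h)).
  have e_cvg : series e @ \oo --> qsum c (h + tau) - qsum c tau - h * L.
    rewrite (_ : series e = (fun n => series (qterm c (h + tau)) n - series (qterm c tau) n
        - h * series (qterm (fun n => two_pi_i R * (n%:R * c n)) tau) n)).
      apply: cvgB; first by apply: cvgB; exact: qsum_cvg.
      apply: cvgM; first exact: cvg_cst.
      by apply: qsum_cvg => //; apply/temperedZ/tempered_natM.
    apply/funext => N; rewrite /series /= mulr_sumr -!sumrB; apply: eq_bigr => n _.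
    by rewrite /e /qterm addrC nomeD exprMn cexpMn -/(nome h); ring.
  have e_bd : geom_bounded e (5 * (2 * pi) ^+ 2 * cabs h ^+ 2 * M) y.
    split=> // n; rewrite cabsM.
    have := cexp_taylor (n%:R * (two_pi_i R * h)).
    set w := cabs (n%:R * _) => tay.
    have wE : w = n%:R * (2 * pi * cabs h) by rewrite /w !cabsM cabs_nat cabs_two_pi_i.
    have exp_le : x0 ^+ n * expR w <= x1 ^+ n.
      rewrite wE expRM_natl -exprMn; apply: lerXn2r; rewrite ?nnegrE.
      - by rewrite mulr_ge0 ?expR_ge0 // ltW.
      - exact: ltW.
      by rewrite -(ler_pdivlMl _ _ q0) [_^-1 * _]mulrC -edl ler_expR ler_pM2l ?mulr_gt0 // ltW.
    apply: le_trans (_ : cabs (c n * nome tau ^+ n) * (5 * w ^+ 2 * expR w) <= _).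
      by rewrite ler_wpM2l ?cabs_ge0.
    have := MP n; rewrite !cabsM cabs_nat cabsX -/x0 wE => MPn.
    apply: le_trans (_ : 5 * (2 * pi) ^+ 2 * cabs h ^+ 2 * (n%:R * (n%:R * cabs (c n)) * x1 ^+ n) <= _); last first.
      by rewrite -[leRHS]mulrA ler_wpM2l // ?mulr_ge0 ?exprn_ge0 ?cabs_ge0 ?mulr_ge0 ?(ltW pi0).
    rewrite -wE.
    rewrite (_ : cabs (c n) * x0 ^+ n * _ = 5 * w ^+ 2 * cabs (c n) * (x0 ^+ n * expR w)); last ring.
    rewrite [leRHS](_ : _ = 5 * w ^+ 2 * cabs (c n) * x1 ^+ n); last by rewrite wE; ring.
    by rewrite ler_wpM2l // !mulr_ge0 ?cabs_ge0 ?sqr_ge0.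
  have bound := series_sum_le e_bd e_cvg.
  have hE : L - h^-1 *: (qsum c (h + tau) - qsum c tau) =
     - (h^-1 * (qsum c (h + tau) - qsum c tau - h * L)).
    by rewrite /GRing.scale /= [h^-1 * (_ - h * L)]mulrBr mulKf // opprB.
  rewrite hE cabsN cabsM.
  have hV : cabs h^-1 = (cabs h)^-1.
    apply: (@mulfI _ (cabs h)); first by rewrite cabs_eq0.
    by rewrite -cabsM mulfV // cabs1 mulfV // cabs_eq0.
  rewrite hV ler_pdivrMl ?cabs_gt0 // (le_trans bound) //.
  suff -> : 5 * (2 * pi) ^+ 2 * cabs h ^+ 2 * M / (1 - y) = cabs h * (C * cabs h) by [].
  by rewrite /C; ring.
apply/cvgrPdist_lt => e e0; have C0 : 0 <= C.
  have y1 : 0 <= 1 - y by rewrite subr_ge0; case/andP: y01 => _ /ltW.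
  by apply: divr_ge0 => //; apply: mulr_ge0 => //; apply: mulr_ge0 => //; apply: sqr_ge0.
(* The three bounds serve the domination, the condition [0 < im (h + tau)], and the final inequality
   [C |h| < e]; [C + 1] avoids division by zero. *)
pose r := Num.min (Num.min dl (im tau)) (e / (C + 1)).
have r0 : 0 < r by rewrite !lt_min dl0 t0 divr_gt0 // ltr_wpDl.
rewrite /at_right; apply/nbhs_ballP; exists (of_real r); first by rewrite /= (of_real_lt 0).
move=> h; rewrite -ball_normE /= sub0r normrN normr_cabs of_real_lt !lt_min => /andP[/andP[hd ht] he] h0.
rewrite sub0r normrN ger0_norm ?cabs_ge0 // (le_lt_trans (key h h0 hd _)) //.
  by rewrite imD; have := im_le_cabs h; have := ler_norm (- im h); rewrite normrN; lra.
rewrite ltr_pdivlMr in he; last by rewrite ltr_wpDl.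
by have := cabs_ge0 h; have : 0 < cabs h; [rewrite cabs_gt0|lra].
Qed.

Lemma tempered_derive_n c i : tempered c -> tempered (fun n => (two_pi_i R * n%:R) ^+ i * c n).
Proof.
move=> tc; elim: i => [|i IHi]; first by apply: tempered_le tc _ => n; rewrite expr0 mul1r.
apply: tempered_le (temperedZ (two_pi_i R) (tempered_natM IHi)) _ => n.
by rewrite exprS !mulrA.
Qed.

Lemma qsum_derive1n c tau i (F : Cplx R -> Cplx R) : tempered c -> 0 < im tau ->
  (forall t, 0 < im t -> F t = qsum c t) ->
  derive1n i F tau = qsum (fun n => (two_pi_i R * n%:R) ^+ i * c n) tau.
Proof.
move=> tc t0 FE; elim: i tau t0 => [|i IHi] tau t0.
  by rewrite derive1n0 FE //; apply: eq_qsum => n; rewrite expr0 mul1r.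
rewrite derive1nS (qsum_derive (tempered_derive_n i tc) t0 IHi).
by apply: eq_qsum => n; rewrite exprS !mulrA.
Qed.
End QSeriesAnalysis.

(** * Uniqueness of q-expansions *)

Section Uniqueness.
Variable R : realType.
Implicit Types (c d : nat -> Cplx R) (tau : Cplx R).

Definition imag_point (y : R) : Cplx R := (0 +i* y)%C.

Lemma cabs_nome_imag y : cabs (nome (imag_point y)) = expR (- (2 * pi * y)).
Proof. exact: cabs_nome. Qed.

(** An arbitrary q-expansion carries no growth hypothesis. Convergence at the single point [tau = i]
    already bounds its coefficients geometrically. *)
Lemma cvg_series_terms_bounded (a : nat -> Cplx R) (l : Cplx R) : series a @ \oo --> l ->
  exists M, forall n, cabs (a n) <= M.
Proof.
move=> /cvg_cabsP /cvgrPdist_lt /(_ 1 ltr01) [N _ NP].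
have {}NP n : (N <= n)%N -> cabs (l - series a n) < 1.
  by move=> /NP /=; rewrite sub0r normrN ger0_norm ?cabs_ge0.
exists (2 + \sum_(0 <= k < N) cabs (a k)) => n.
have S0 m : 0 <= \sum_(0 <= k < m) cabs (a k) by apply: sumr_ge0 => k _; apply: cabs_ge0.
have [nN|Nn] := ltnP n N.
  rewrite (big_cat_nat (n := n.+1)) //= big_nat_recr //=.
  have := S0 n; have : 0 <= \sum_(n.+1 <= k < N) cabs (a k) by apply: sumr_ge0 => k _; apply: cabs_ge0.
  lra.
have -> : a n = (l - series a n) - (l - series a n.+1).
  by rewrite /series /= big_nat_recr //=; ring.
have := cabsD (l - series a n) (- (l - series a n.+1)); rewrite cabsN.
have := NP n Nn; have := NP n.+1 (leqW Nn); have := S0 N; lra.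
Qed.

(* At [tau = i y] with [y] large the nonzero term of least index dominates. *)
Lemma qseries_zero d : (forall tau, 0 < im tau -> series (qterm d tau) @ \oo --> (0 : Cplx R)) ->
  forall n, d n = 0.
Proof.
move=> d0 n0; apply/eqP/negPn/negP => dn0.
have ex : exists n, d n != 0 by exists n0.
case: (ex_minnP ex) => n dn min_n {n0 dn0 ex}.
have pi0 := pi_gt0 R.
set r := cabs (nome (imag_point 1)).
have /andP[r0 r1] : 0 < r < 1 by apply: cabs_nome_lt1.
have [M MP] := cvg_series_terms_bounded (d0 (imag_point 1) ltr01).
have M0 : 0 <= M by apply: le_trans (MP 0%N); apply: cabs_ge0.
pose A := M / r ^+ n.
have A0 : 0 <= A by rewrite divr_ge0 // exprn_ge0 // ltW.
have key s : 0 < s <= 1 / 2 -> cabs (d n) <= A * s / (1 - s).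
  move=> /andP[s0 s1].
  (* This height makes the nome have modulus [r s], with [r] the modulus at [tau = i]. *)
  pose u := - ln s / (2 * pi); have u0 : 0 <= u.
    by rewrite divr_ge0 ?mulr_ge0 ?(ltW pi0) // oppr_ge0 ln_le0 //; lra.
  pose tau := imag_point (1 + u); have t0 : 0 < im tau by rewrite /=; lra.
  pose q := nome tau; have qE : cabs q = r * s.
    rewrite /q /r !cabs_nome_imag mulrDr opprD expRD; congr (_ * _).
    by rewrite /u mulrCA mulfV ?mulr1 ?opprK ?lnK ?gt_eqF // mulr_gt0.
  (* This is the series divided by [q^n] without its leading term, so it sums to [- d n]. *)
  pose b k := d (n + k.+1)%N * q ^+ k.+1.
  have b_cvg : series b @ \oo --> - d n.
    have qn0 : q ^+ n != 0 by rewrite expf_neq0 // -cabs_gt0 qE mulr_gt0.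
    have h : (fun k => series (qterm d tau) (k + n.+1)%N) @ \oo --> (0 : Cplx R).
      by have := d0 tau t0; rewrite -(cvg_shiftn n.+1).
    rewrite (_ : series b = fun k => (q ^+ n)^-1 * series (qterm d tau) (k + n.+1)%N - d n).
      rewrite -[X in _ --> X]add0r -[X in _ --> X + _](mulr0 (q ^+ n)^-1).
      by apply: cvgB; [apply: cvgM; [exact: cvg_cst|exact: h]|exact: cvg_cst].
    apply/funext => k.
    have -> : series (qterm d tau) (k + n.+1)%N =
        qterm d tau n + \sum_(0 <= i < k) qterm d tau (i + n.+1)%N.
      have nk : (n <= k + n.+1)%N by rewrite addnS leqW // leq_addl.
      rewrite /series /= (big_cat_nat (leq0n n) nk).
      rewrite [X in X + _ = _]big_nat [X in X + _ = _]big1 ?add0r; last first.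
        move=> i /andP[_ i_n]; rewrite /qterm; have [->|di] := eqVneq (d i) 0; first by rewrite mul0r.
        by have := min_n i di; rewrite leqNgt i_n.
      rewrite big_ltn; last by rewrite addnS ltnS leq_addl.
      by congr (_ + _); rewrite -[X in bigop _ (index_iota X _)](add0n n.+1) big_addn addnK.
    rewrite mulrDr.
    have -> : (q ^+ n)^-1 * qterm d tau n = d n by rewrite /qterm mulrCA mulVf ?mulr1.
    rewrite addrAC subrr add0r mulr_sumr /series; apply: eq_bigr => i _.
    by rewrite /qterm /b [(i + n.+1)%N]addnC addSnnS exprD mulrCA mulKf.
  have b_bd : geom_bounded b (A * s) s.
    split=> [|k]; first by lra.
    rewrite cabsM cabsX qE exprMn.
    have := MP (n + k.+1)%N; rewrite cabsM cabsX -/r exprD => MPk.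
    have rn : 0 < r ^+ n by rewrite exprn_gt0.
    have -> : A * s * s ^+ k = A * s ^+ k.+1 by rewrite exprS mulrA.
    rewrite mulrA ler_wpM2r ?exprn_ge0 ?(ltW s0) // /A ler_pdivlMr //.
    by rewrite -mulrA [r ^+ _ * _]mulrC.
  by have := series_sum_le b_bd b_cvg; rewrite cabsN.
have dn' : 0 < cabs (d n) by rewrite cabs_gt0.
(* Now [s (4 A + 1) <= |d n|] and [|d n| (1 - s) <= A s] with [s <= 1/2] would give
   [4 A + 1 <= 2 A]. *)
pose s := Num.min (1 / 2) (cabs (d n) / (4 * A + 1)).
have s0 : 0 < s by rewrite lt_min; apply/andP; split; [lra|rewrite divr_gt0 //; lra].
have s1 : s <= 1 / 2 by rewrite ge_min lexx.
have sA : s * (4 * A + 1) <= cabs (d n).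
  by rewrite -ler_pdivlMr; [rewrite ge_min lexx orbT|lra].
have := key s; rewrite s0 s1 => /(_ isT); rewrite ler_pdivlMr; last by lra.
nra.
Qed.

Lemma q_coef_unique (f : Cplx R -> Cplx R) c : has_q_expansion f c -> q_coef f = c.
Proof.
move=> fc; rewrite /q_coef; case: xgetP => [d _ fd|/(_ c)//].
apply/funext => n; apply/eqP; rewrite -subr_eq0; apply/eqP.
move: n; apply: (@qseries_zero (fun n => d n - c n)) => tau t0.
rewrite -(subrr (f tau)) (_ : series _ = series (fun n => d n * nome tau ^+ n) \- series (fun n => c n * nome tau ^+ n)).
  by apply: cvgB; [exact: fd|exact: fc].
by apply/funext => N; rewrite /series /= /qterm -sumrB; apply: eq_bigr => k _; rewrite mulrBl.
Qed.
End Uniqueness.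

(** * The q-expansion of f *)

Lemma class_number_ge0 N : 0 <= class_number N.
Proof. by apply: sumr_ge0 => Q _; rewrite invr_ge0. Qed.

Lemma size_irange n : size (irange n) = (n + n).+1.
Proof. by rewrite size_map size_iota. Qed.

Section Coefficients.
Variable R : realType.
Implicit Types (tau : Cplx R) (m : int).

Definition hcoef (x : int) : Cplx R := ratr (hz x).

Lemma of_real_ratr (x : rat) : of_real (ratr x) = ratr x :> Cplx R.
Proof. by rewrite /of_real (fmorph_rat (real_complex R)). Qed.

(** Each reduced form contributes at most 1, and all of them lie in a box of [(2 N + 1)^3] triples.
    Any polynomial bound suffices for convergence. *)
Lemma class_number_bound N : class_number N <= ((2 * N.+1) ^ 3)%:R.
Proof.
apply: (@le_trans _ _ (\sum_(Q <- reduced_forms N) 1)).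
  apply: ler_sum => Q _; rewrite invf_le1 ?ltr0n ?ler1n /weight.
    by case: ifP => // _; case: ifP.
  by case: ifP => // _; case: ifP.
rewrite big_const_seq count_predT iter_addr_0 ler_nat size_filter (leq_trans (count_size _ _)) //.
rewrite size_map !size_allpairs !size_irange !expnS expn0 muln1 mulnA.
by rewrite !leq_mul //; lia.
Qed.

Lemma cabs_hcoef n : cabs (hcoef n%:Z) <= 8 * n.+1%:R ^+ 3.
Proof.
have cr (x : rat) : cabs (ratr x : Cplx R) = `|ratr x|.
  by rewrite -of_real_ratr cabs_of_real.
rewrite /hcoef cr; case: n => [|n].
  rewrite hz0 -ratr_norm expr1n mulr1 -(ratr_nat R 8) ler_rat normrN ger0_norm; lra.
rewrite hz_pos // ger0_norm ?ler0q ?class_number_ge0 //.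
rewrite (le_trans (_ : _ <= ratr ((2 * n.+2) ^ 3)%:R)) ?ler_rat ?class_number_bound //.
by rewrite ratr_nat natrX natrM exprMn; lra.
Qed.

Lemma tempered_hcoef : tempered (fun n => hcoef n%:Z).
Proof. exact: tempered_poly cabs_hcoef. Qed.

Lemma hurwitz_gfE tau : hurwitz_gf tau = qsum (fun n => hcoef n%:Z) tau.
Proof. by []. Qed.

Lemma sum_square_roots m (s L : nat) (F : int -> Cplx R) :
  (forall t : int, t ^+ 2 = s%:Z -> `|t| <= L%:Z) ->
  \sum_(t <- irange L | (t ^+ 2 == s%:Z) && (t == m %[mod 2])%Z) F t =
  \sum_(t <- irange s | (t ^+ 2 == s%:Z) && (t == m %[mod 2])%Z) F t.
Proof.
move=> tL; apply: (reindex_seq (f := id) (g := id)); try exact: irange_uniq.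
  move=> t _ /andP[/eqP t2 tm]; rewrite t2 eqxx tm; split=> //.
  by rewrite mem_irange; have := sqr_ge0 (t - 1); have := sqr_ge0 (t + 1); nia.
move=> t _ /andP[/eqP t2 tm]; rewrite t2 eqxx tm; split=> //.
by rewrite mem_irange; have := tL t t2; lia.
Qed.

Definition theta_coef m (s : nat) : Cplx R :=
  \sum_(t <- irange s | (t ^+ 2 == s%:Z) && (t == m %[mod 2])%Z) 1.

Lemma tempered_theta_coef m : tempered (theta_coef m).
Proof.
apply: (@tempered_poly _ _ 2 1) => s; apply: le_trans (cabs_sum _ _ _) _.
rewrite big_mkcond /= expr1; apply: le_trans (_ : \sum_(t <- irange s) 1 <= _).
  by apply: ler_sum => t _; case: ifP; rewrite ?cabs1 ?cabs0.
rewrite big_const_seq count_predT iter_addr_0 size_irange -natrM ler_nat; lia.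
Qed.

(** The condition [|t| <= N] means [t^2 <= N^2], so the symmetric partial sums form a subsequence of
    the partial sums in powers of [q]. *)
Lemma theta_partial m tau N :
  \sum_(n \in [set n : int | `|n| <= N%:Z /\ (n = m %[mod 2])%Z])
      n%:~R ^+ 0 * nome tau ^+ (absz n ^ 2)%N =
  series (qterm (theta_coef m) tau) (N ^ 2).+1.
Proof.
pose r := [seq t <- irange N | (t == m %[mod 2])%Z].
have -> : [set n : int | `|n| <= N%:Z /\ (n = m %[mod 2])%Z] = [set` r].
  apply/seteqP; split=> t /=; rewrite mem_filter mem_irange.
    by case=> tN /eqP ->; lia.
  by case/andP => /eqP tm tN; split; [lia|].
rewrite -fsbig_seq ?filter_uniq ?irange_uniq //= big_filter /series /=.
transitivity (\sum_(0 <= s < (N ^ 2).+1)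
   \sum_(t <- irange N | (t ^+ 2 == s%:Z) && (t == m %[mod 2])%Z) nome tau ^+ s); last first.
  rewrite !big_nat; apply: eq_bigr => s /andP[_ sN].
  rewrite (sum_square_roots m (s := s)) /qterm /theta_coef ?mulr_suml.
    by apply: eq_bigr => t _; rewrite mul1r.
  move=> t t2; rewrite -(@ler_pXn2r _ 2) ?nnegrE // real_normK ?num_real // t2.
  by rewrite -(Posz_sqr N) lez_nat -ltnS.
under [RHS]eq_bigr do rewrite big_mkcond /=.
rewrite exchange_big /= big_mkcond big_seq [RHS]big_seq; apply: eq_bigr => t.
rewrite mem_irange => tN; case: ifP => tm; last first.
  by rewrite big1 // => s _; rewrite andbF.
rewrite mul1r.
have tE : t ^+ 2 = (absz t ^ 2)%N%:Z by rewrite -abszX gez0_abs ?sqr_ge0.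
rewrite (bigD1_seq (absz t ^ 2)%N) ?iota_uniq //=; last first.
  by rewrite mem_index_iota ltnS leq_sqr; lia.
rewrite tE eqxx andbT big1 ?addr0 // => s sN.
by rewrite eqz_nat eq_sym (negbTE sN).
Qed.

Lemma thetaE m tau : 0 < im tau -> theta 0 m 2 tau = qsum (theta_coef m) tau.
Proof.
move=> t0; rewrite /theta; apply: (cvg_lim (@cplx_hausdorff R)).
rewrite (_ : (fun N => _) = (fun N => series (qterm (theta_coef m) tau) (N ^ 2).+1)); last first.
  by apply/funext => N; rewrite theta_partial.
have := qsum_cvg (tempered_theta_coef m) t0.
move/cvg_cabsP/cvgrPdist_lt => h; apply/cvg_cabsP/cvgrPdist_lt => e /h [M _ MP].
exists M => // N /= MN; apply: MP => /=; apply: (leq_trans MN); apply: leqW.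
by rewrite expnS expn1; case: (N) => // N'; rewrite leq_pmulr.
Qed.
End Coefficients.

(** For [b = 1] and [n > 0] the factors [t - s] and [t + s] of [n] are positive, so there are
    finitely many pairs and the extended real sum becomes a sum over a list. *)
Definition norm_pairs (m : int) (n : nat) : seq (int * int) :=
  [seq x <- allpairs pair (irange n) (irange n) |
    [&& 1 <= x.1, 0 <= x.2, x.1 ^+ 2 - x.2 ^+ 2 == n%:Z & (x.1 == m %[mod 2])%Z]].

Section QExpansion.
Variable R : realType.
Implicit Types (tau : Cplx R) (m : int).

Definition pair_weight l (x : int * int) : R :=
  (if x.2 == 0 then 2^-1 else 1) * (x.1 - x.2)%:~R ^+ l.+1.

Lemma norm_pairs_gt0 m n x : (0 < n)%N -> x \in norm_pairs m n -> 0 < x.1 - x.2 <= n%:Z.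
Proof.
case: x => t s n0; rewrite mem_filter mem_allpairs_pair !mem_irange /=.
move=> /andP[/and4P[t1 s0 /eqP E _] /andP[tn sn]]; nia.
Qed.

Lemma pair_weight_ge0 l m n x : (0 < n)%N -> x \in norm_pairs m n -> 0 <= pair_weight l x.
Proof.
move=> n0 /(norm_pairs_gt0 n0) /andP[x0 _]; rewrite mulr_ge0 ?exprn_ge0 ?ler0z ?ltW //.
by case: ifP; rewrite ?invr_gt0.
Qed.

(** Both signs give the same sum, since [m] and [- m] agree modulo 2 and the sign factor is 1 for
    even [l]. *)
Lemma lambda_coefE l m n : ~~ odd l -> (0 < n)%N ->
  lambda_coef R l m 2 1 n = 2 * \sum_(x <- norm_pairs m n) pair_weight l x.
Proof.
move=> l_even n0; rewrite /lambda_coef.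
have S e : (e = 1 \/ e = -1) ->
  [set ts : int * int | [/\ 1 <= ts.1, 0 <= ts.2, ts.1 ^+ 2 - 1%N%:Z * ts.2 ^+ 2 = n%:Z
                   & (ts.1 = e * m %[mod 2])%Z]] = [set` norm_pairs m n].
  move=> e1; apply/seteqP; split=> -[t s] /=; rewrite mem_filter mem_allpairs_pair !mem_irange /=.
    case=> t1 s0; rewrite mul1r => E tm.
    apply/andP; split; first by rewrite t1 s0 E eqxx /=; case: e1 => ?; subst e; lia.
    have E' : (t - s) * (t + s) = n%:Z by rewrite -E; ring.
    have ts : 0 < t - s by clear - E' t1 s0 n0; nia.
    have tsn : t + s <= n%:Z by clear - E' ts t1 s0; nia.
    by clear - tsn t1 s0; lia.
  case/andP => /and4P[t1 s0 /eqP E tm] _; rewrite mul1r; split=> //.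
  by case: e1 => ?; subst e; lia.
have main e : (e = 1 \/ e = -1) -> fine (\esum_(ts in [set ts : int * int |
     [/\ 1 <= ts.1, 0 <= ts.2, ts.1 ^+ 2 - 1%N%:Z * ts.2 ^+ 2 = n%:Z & (ts.1 = e * m %[mod 2])%Z]])
      ((if ts.2 == 0 then 2^-1 else 1) * (ts.1%:~R - Num.sqrt 1%:R * ts.2%:~R) ^+ l.+1)%:E) =
   \sum_(x <- norm_pairs m n) pair_weight l x.
  move=> e1; rewrite S //.
  have wE (x : int * int) : (if x.2 == 0 then 2^-1 else 1) * (x.1%:~R - Num.sqrt 1%:R * x.2%:~R) ^+ l.+1 = pair_weight l x.
    by rewrite /pair_weight sqrtr1 mul1r -intrB.
  under eq_esum do rewrite wE.
  have fin : finite_set [set` norm_pairs m n] by exact: finite_seq.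
  rewrite (esum_fset fin); last first.
    by move=> x; rewrite mem_setE lee_fin => /(pair_weight_ge0 l n0).
  rewrite fsumEFin //=.
  by rewrite -fsbig_seq // filter_uniq // allpairs_pair_uniq // irange_uniq.
rewrite !big_cons big_nil addr0 main; last by left.
rewrite main; last by right.
rewrite mulr1z expr1n mul1r mulrNz mulr1z -signr_odd (negbTE l_even) expr0 mul1r.
by rewrite mulr_natl mulr2n.
Qed.

Definition lambda_seq l m (n : nat) : Cplx R :=
  if n == 0%N then 0 else of_real (lambda_coef R l m 2 1 n).

Lemma tempered_lambda l m : ~~ odd l -> tempered (lambda_seq l m).
Proof.
move=> l_even; apply: (@tempered_poly _ _ 8 (l + 3)) => -[|n].
  by rewrite /lambda_seq eqxx cabs0 mulr_ge0 ?exprn_ge0.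
rewrite /lambda_seq /= cabs_of_real lambda_coefE //.
have w_le : \sum_(x <- norm_pairs m n.+1) pair_weight l x <= \sum_(x <- norm_pairs m n.+1) n.+1%:R ^+ l.+1.
  rewrite big_seq [leRHS]big_seq; apply: ler_sum => x xP.
  have /andP[x0 xn] := norm_pairs_gt0 (ltn0Sn n) xP.
  have x0' : 0 <= (x.1 - x.2)%:~R :> R by rewrite ler0z ltW.
  rewrite /pair_weight -[leRHS]mul1r; apply: ler_pM.
  - by case: ifP; rewrite ?invr_ge0.
  - exact: exprn_ge0.
  - by case: ifP => // _; rewrite invf_le1 // ler1n.
  - by apply: lerXn2r; rewrite ?nnegrE // -[n.+1%:R]/(n.+1%:~R) ler_int.
rewrite ger0_norm; last first.
  by rewrite mulr_ge0 // big_seq sumr_ge0 // => x /pair_weight_ge0; apply.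
rewrite (le_trans (ler_wpM2l _ w_le)) // big_const_seq count_predT iter_addr_0 -[_ *+ size _]mulr_natr.
have sz : (size (norm_pairs m n.+1) <= 4 * (n.+2 ^ 2))%N.
  rewrite size_filter (leq_trans (count_size _ _)) // size_allpairs !size_irange.
  by rewrite (_ : 4 * n.+2 ^ 2 = (2 * n.+2) * (2 * n.+2))%N; [apply: leq_mul; lia|rewrite !expnS expn0; lia].
have h1 : n.+1%:R ^+ l.+1 <= n.+2%:R ^+ l.+1 :> R by rewrite lerXn2r ?nnegrE // ler_nat.
have h2 : (size (norm_pairs m n.+1))%:R <= 4 * n.+2%:R ^+ 2 :> R by rewrite -natrX -natrM ler_nat.
rewrite (_ : 8 * _ = 2 * (n.+2%:R ^+ l.+1 * (4 * n.+2%:R ^+ 2))).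
  by rewrite ler_wpM2l // ler_pM ?exprn_ge0.
by rewrite (_ : (l + 3 = l.+1 + 2)%N) ?exprD; [ring|rewrite addnC addSnnS addnC].
Qed.

Lemma Lambda_gfE l m tau : Lambda_gf l m 2 1 tau = qsum (lambda_seq l m) tau.
Proof.
rewrite /Lambda_gf /qsum; congr (limn _); apply/funext => -[|N]; rewrite /series /=.
  by rewrite !big_geq.
rewrite [RHS]big_ltn // /qterm {1}/lambda_seq eqxx mul0r add0r !big_nat.
by apply: eq_bigr => n /andP[n0 _]; rewrite /lambda_seq gtn_eqF.
Qed.

Definition rc_weight K i : Cplx R :=
  (-1) ^+ i * gbinom (3%:R / 2 + K%:R - 1) (K - i) * gbinom (2^-1 + 0%:R + K%:R - 1) i.

Definition bracket_coef m K (n : nat) : Cplx R :=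
  \sum_(i < K.+1) rc_weight K i *
    cauchy_prod (fun j => j%:R ^+ i * hcoef R j%:Z) (fun s => s%:R ^+ (K - i) * theta_coef R m s) n.

Lemma two_pi_i_neq0 : two_pi_i R != 0.
Proof. by rewrite -cabs_gt0 cabs_two_pi_i mulr_gt0 // pi_gt0. Qed.

Lemma tempered_pow (c : nat -> Cplx R) i : tempered c -> tempered (fun n => n%:R ^+ i * c n).
Proof.
move=> tc; elim: i => [|i IHi]; first by apply: tempered_le tc _ => n; rewrite expr0 mul1r.
by apply: tempered_le (tempered_natM IHi) _ => n; rewrite exprS mulrA.
Qed.

Lemma tempered_bracket m K : tempered (bracket_coef m K).
Proof.
apply: tempered_sum => i; apply: temperedZ; apply: tempered_cauchy; apply: tempered_pow.
  exact: tempered_hcoef.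
exact: tempered_theta_coef.
Qed.

(** The [i]-th derivative multiplies the [n]-th coefficient by [(2 pi i)^i n^i], where only the
    exponent is the index. The total power [K] of [2 pi i] cancels the normalising factor. *)
Lemma rankin_cohenE m K tau : 0 < im tau ->
  rankin_cohen (3%:R / 2) (2^-1 + 0%:R) (Vop 1 (@hurwitz_gf R)) (theta 0 m 2) K tau =
  qsum (bracket_coef m K) tau.
Proof.
move=> t0; rewrite /rankin_cohen /bracket_coef qsum_sum //; last first.
  move=> i; apply: temperedZ; apply: tempered_cauchy; apply: tempered_pow.
    exact: tempered_hcoef.
  exact: tempered_theta_coef.
rewrite mulr_sumr; apply: eq_bigr => i _.
have th := tempered_pow i (@tempered_hcoef R); have tt := tempered_pow (K - i) (@tempered_theta_coef R m).
rewrite qsumZ //; last exact: tempered_cauchy.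
rewrite (qsum_derive1n i (@tempered_hcoef R) t0); last by move=> t _; rewrite /Vop mul1r hurwitz_gfE.
rewrite (qsum_derive1n (K - i) (@tempered_theta_coef R m) t0); last by move=> t; apply: thetaE.
rewrite -[_ * qsum _ tau * qsum _ tau]mulrA -/(rc_weight K i) mulrCA; congr (_ * _).
have dh := tempered_derive_n i (@tempered_hcoef R).
have dt := tempered_derive_n (K - i) (@tempered_theta_coef R m).
rewrite (qsum_cauchy dh dt t0) -(qsumZ _ (tempered_cauchy dh dt) t0).
apply: eq_qsum => n; rewrite /cauchy_prod mulr_sumr; apply: eq_bigr => j _.
have -> : two_pi_i R ^+ K = two_pi_i R ^+ i * two_pi_i R ^+ (K - i) by rewrite -exprD subnKC // -ltnS.
have w0 a : two_pi_i R ^+ a != 0 by rewrite expf_neq0 // two_pi_i_neq0.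
rewrite !exprMn invfM.
move: (w0 i) (w0 (K - i)%N); move: (_ R ^+ i) (_ R ^+ (K - i)) => A B A0 B0.
by field; rewrite A0 B0.
Qed.

Lemma f_holo_expansion l m : ~~ odd l ->
  has_q_expansion (@f_holo R l m 2 1) (fun n => bracket_coef m l./2 n +
    (2 ^+ l.+1)^-1 * 'C(l, l./2)%:R * lambda_seq l m n).
Proof.
move=> l_even tau t0; have tb := @tempered_bracket m l./2.
have tl := temperedZ ((2 ^+ l.+1)^-1 * 'C(l, l./2)%:R) (tempered_lambda m l_even).
have -> : f_holo l m 2 1 tau = qsum (fun n => bracket_coef m l./2 n +
    (2 ^+ l.+1)^-1 * 'C(l, l./2)%:R * lambda_seq l m n) tau.
  rewrite (qsumD tb tl t0) (qsumZ _ (tempered_lambda m l_even) t0) -Lambda_gfE -(rankin_cohenE m _ t0).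
  rewrite /f_holo (negbTE l_even) /=; congr (_ + _ * _).
  by rewrite sqrtr1 invr1 mul1r.
exact: (qsum_cvg (temperedD tb tl) t0).
Qed.

Lemma gamma_coefE l m n : ~~ odd l -> gamma_coef R l m 2 1 n = bracket_coef m l./2 n +
    (2 ^+ l.+1)^-1 * 'C(l, l./2)%:R * lambda_seq l m n.
Proof. by move=> l_even; rewrite /gamma_coef (q_coef_unique (@f_holo_expansion l m l_even)). Qed.

Lemma cauchy_prod_theta m n (u v : nat -> Cplx R) :
  cauchy_prod u (fun s => v s * theta_coef R m s) n =
  \sum_(t <- irange n | (t == m %[mod 2])%Z && (absz t ^ 2 <= n)%N)
     u (n - absz t ^ 2)%N * v (absz t ^ 2)%N.
Proof.
rewrite /cauchy_prod (reindex_inj rev_ord_inj) /=.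
transitivity (\sum_(s < n.+1) \sum_(t <- irange n | (t ^+ 2 == s%:Z) && (t == m %[mod 2])%Z)
   u (n - s)%N * v s).
  apply: eq_bigr => s _; rewrite subSS subKn -1?ltnS // /theta_coef mulrA mulr_sumr.
  rewrite -(@sum_square_roots R m s n) => [|t t2].
    by apply: eq_bigr => t _; rewrite mulr1.
  have sn : s%:Z <= n%:Z by rewrite lez_nat -ltnS.
  by have := sqr_ge0 (t - 1); have := sqr_ge0 (t + 1); nia.
rewrite (exchange_big_dep xpredT) //= [RHS]big_mkcond; apply: eq_bigr => t _.
have tE : t ^+ 2 = (absz t ^ 2)%N%:Z by rewrite -abszX gez0_abs ?sqr_ge0.
case: (boolP ((t == m %[mod 2])%Z)) => tm /=; last by rewrite big_pred0 // => s; rewrite andbF.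
case: leqP => tn.
  have t_lt : (absz t ^ 2 < n.+1)%N by [].
  rewrite (big_pred1 (Ordinal t_lt)) // => s.
  by rewrite andbT tE eqz_nat eq_sym.
rewrite big_pred0 // => s; rewrite andbT tE eqz_nat; apply/eqP => e.
by move: tn; rewrite e ltnNge -ltnS ltn_ord.
Qed.

Lemma bracket_coefE m K n : bracket_coef m K n =
  \sum_(t <- irange n | (t == m %[mod 2])%Z) hcoef R (n%:Z - t ^+ 2) *
    \sum_(i < K.+1) rc_weight K i * (n%:Z - t ^+ 2)%:~R ^+ i * (t ^+ 2)%:~R ^+ (K - i).
Proof.
rewrite /bracket_coef.
under eq_bigr do rewrite cauchy_prod_theta mulr_sumr.
rewrite exchange_big /= big_mkcondr; apply: eq_bigr => t tm.
have tE : (absz t ^ 2)%N%:Z = t ^+ 2 by rewrite -abszX gez0_abs ?sqr_ge0.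
case: leqP => tn; last first.
  by rewrite /hcoef hz_neg ?rmorph0 ?mul0r // -tE; lia.
have nE : (n - absz t ^ 2)%N%:Z = n%:Z - t ^+ 2 by rewrite -subzn // tE.
rewrite mulr_sumr; apply: eq_bigr => i _.
rewrite -nE -tE -!pmulrn; ring.
Qed.
End QExpansion.

(** * Rankin-Cohen coefficients and ballot numbers *)

Lemma central_binS K : (K.+1 * 'C(K.+1.*2, K.+1) = 2 * (K.*2.+1 * 'C(K.*2, K)))%N.
Proof.
have e1 := mul_bin_diag K.+1.*2 K; have e2 := mul_bin_diag K.*2.+1 K.
have e3 : 'C(K.*2.+1, K) = 'C(K.*2.+1, K.+1) by rewrite -bin_sub; [congr ('C(_, _)); lia|lia].
move: e1 e2; rewrite doubleS /= e3 => <- ->.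
by rewrite -!muln2; nia.
Qed.

Lemma bin_step2 K i : (i < K)%N ->
  (i.*2.+3 * i.*2.+2 * 'C(K.*2.+1, i.*2.+3) = (K - i).*2 * (K - i).*2.-1 * 'C(K.*2.+1, i.*2.+1))%N.
Proof.
move=> iK; have l1 := mul_bin_left K.*2.+1 i.*2.+1; have l2 := mul_bin_left K.*2.+1 i.*2.+2.
rewrite (_ : K.*2.+1 - i.*2.+1 = (K - i).*2)%N in l1; last by lia.
rewrite (_ : K.*2.+1 - i.*2.+2 = (K - i).*2.-1)%N in l2; last by lia.
move: l1 l2; move: 'C(_, i.*2.+3) 'C(_, i.*2.+2) 'C(_, i.*2.+1) => c3 c2 c1 l1 l2.
by rewrite mulnAC l2 -mulnA (mulnC c2) l1 mulnCA mulnA.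
Qed.

Section Combinatorics.
Variable F : numFieldType.

Lemma gbinomS (a : F) i : gbinom a i.+1 * i.+1%:R = gbinom a i * (a - i%:R).
Proof.
rewrite /gbinom big_ord_recr /= factS natrM.
have x0 : i.+1%:R != 0 :> F by rewrite pnatr_eq0.
have y0 : i`!%:R != 0 :> F by rewrite pnatr_eq0 -lt0n fact_gt0.
move: x0 y0; move: i.+1%:R i`!%:R => x y x0 y0.
by field; rewrite x0 y0.
Qed.

Lemma gbinom0 (a : F) : gbinom a 0 = 1.
Proof. by rewrite /gbinom big_ord0 divr1. Qed.

Lemma gbinom_shift (a : F) i : i.+1%:R * gbinom (a + 1) i.+1 = (a + 1) * gbinom a i.
Proof.
elim: i => [|i IHi]; first by rewrite mulrC gbinomS !gbinom0; ring.
have h1 : i.+1%:R != 0 :> F by rewrite pnatr_eq0.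
apply: (mulfI h1); have e1 := gbinomS (a + 1) i.+1; have e2 := gbinomS a i.
rewrite -[i.+2%:R * gbinom _ _]mulrC e1 mulrA IHi.
rewrite [RHS]mulrCA -[i.+1%:R * gbinom _ _]mulrC e2 -[i.+1%:R]natr1; ring.
Qed.

Lemma gbinom_half K : gbinom (K%:R + 2^-1 : F) K * 4 ^+ K = 'C(K.*2, K)%:R * K.*2.+1%:R.
Proof.
elim: K => [|K IHK]; first by rewrite gbinom0 bin0 expr0 !mulr1.
have h1 : K.+1%:R != 0 :> F by rewrite pnatr_eq0.
have b1 : K.+1%:R * 'C(K.+1.*2, K.+1)%:R = 2 * (K.*2.+1%:R * 'C(K.*2, K)%:R) :> F.
  by rewrite -!natrM central_binS.
have e := gbinom_shift (K%:R + 2^-1) K.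
apply: (mulfI h1); rewrite exprS [_ * (gbinom _ _ * _)]mulrA [RHS]mulrA b1.
rewrite (_ : K.+1%:R + 2^-1 = K%:R + 2^-1 + 1); last by rewrite -natr1; ring.
rewrite e mulrACA -/(gbinom _ _) IHK.
by rewrite doubleS -[K.*2.+3%:R]natr1 -[K.*2.+2%:R]natr1 -[K.*2.+1%:R]natr1 -muln2 natrM; field.
Qed.

(** Passing from [i] to [i + 1] multiplies the left side by [(K - i) (K - i - 1/2) / ((i + 3/2) (i +
    1))], which is also the quotient of the binomials with lower entries [2 i + 3] and [2 i + 1]. *)
Lemma gbinom_pair K i : (i <= K)%N ->
  gbinom (K%:R + 2^-1 : F) (K - i) * gbinom (K%:R - 2^-1) i * 4 ^+ K =
  'C(K.*2, K)%:R * 'C(K.*2.+1, i.*2.+1)%:R.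
Proof.
elim: i => [|i IHi] iK; first by rewrite subn0 gbinom0 mulr1 gbinom_half bin1.
have := IHi (ltnW iK); have KiE : (K - i = (K - i.+1).+1)%N by rewrite subnS prednK // subn_gt0.
have e1 := gbinomS (K%:R + 2^-1 : F) (K - i.+1).
have e2 := gbinomS (K%:R - 2^-1 : F) i.
have b1 : i.*2.+3%:R * i.*2.+2%:R * 'C(K.*2.+1, i.*2.+3)%:R =
   (K - i).*2%:R * (K - i).*2.-1%:R * 'C(K.*2.+1, i.*2.+1)%:R :> F.
  by rewrite -!natrM bin_step2.
rewrite doubleS.
move: e1 e2 b1; rewrite -KiE.
move: (gbinom _ (K - i)) (gbinom _ (K - i.+1)) (gbinom _ i.+1) (gbinom _ i) => A A' B' B.
have -> : (K - i.+1)%:R = K%:R - i%:R - 1 :> F by rewrite natrB // -natr1; ring.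
have -> : (K - i).*2.-1%:R = 2 * (K%:R - i%:R) - 1 :> F.
  by rewrite -natrB 1?ltnW // -natrM -(@natrB F _ 1) ?mul2n ?subn1 // KiE.
have -> : (K - i).*2%:R = 2 * (K%:R - i%:R) :> F by rewrite -natrB 1?ltnW // -natrM mul2n.
have -> : (K - i)%:R = K%:R - i%:R :> F by rewrite natrB 1?ltnW.
move: ('C(_, i.*2.+3)%:R) ('C(_, i.*2.+1)%:R) ('C(_, K)%:R) (4 ^+ K) => c' c C X.
have n2 : i.*2.+2%:R = 2 * i.+1%:R :> F by rewrite -natrM mul2n.
have n3 : i.*2.+3%:R = 2 * i.+1%:R + 1 :> F by rewrite -natr1 n2.
have i1 : i.+1%:R != 0 :> F by rewrite pnatr_eq0.
have i3 : i.*2.+3%:R != 0 :> F by rewrite pnatr_eq0.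
rewrite n2 n3; rewrite n3 in i3; move: i1 i3; rewrite -(natr1 i).
have ki : K%:R - i%:R != 0 :> F by rewrite subr_eq0 eqr_nat gtn_eqF.
move: ki; move: (K%:R) (i%:R : F) => k j kj j1 j3 e1 e2 b1 IH.
have h2 : 2 != 0 :> F by rewrite pnatr_eq0.
have q : (k - j) * ((2 * (j + 1) + 1) * (j + 1)) != 0 by rewrite !mulf_neq0.
apply: (mulfI q).
transitivity (A' * (k + 2^-1 - (k - j - 1)) * (B' * (j + 1)) * (2 * (k - j)) * X).
  by field.
rewrite -e1 e2.
transitivity (C * (2 ^-1 * (2 * (k - j) * (2 * (k - j) - 1) * c))* (k - j)); last first.
  by rewrite -b1; field.
by rewrite (_ : _ * X = (A * B * X) * ((k - j) * (k - 2^-1 - j) * (2 * (k - j)))); [rewrite IH; field|ring].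
Qed.
End Combinatorics.

(** * Inversion of homogeneous sums by ballot numbers *)

Section Inversion.
Variable F : numFieldType.

(** A ballot number is a difference of neighbouring binomials ([ballotE]). In this form its partial
    sums telescope. *)
Definition bin_diff k mu : F :=
  'C(k, mu)%:R - (if mu is mu'.+1 then 'C(k, mu')%:R else 0).

Lemma sum_bin_diff k M : \sum_(mu < M.+1) bin_diff k mu = 'C(k, M)%:R.
Proof.
elim: M => [|M IHM]; first by rewrite big_ord_recr big_ord0 /= add0r /bin_diff subr0.
by rewrite big_ord_recr /= IHM /bin_diff addrC subrK.
Qed.

Lemma ballotE k mu : (mu <= k)%N -> ballot F k mu = bin_diff k mu.
Proof.
move=> muk; rewrite /ballot /bin_diff.
have d0 : k%:R - mu%:R + 1 != 0 :> F by rewrite -natrB // natr1 pnatr_eq0.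
case: mu muk d0 => [|mu] muk d0.
  by move: d0; rewrite subr0 mulr0 !subr0 => d0; rewrite divff // mul1r.
apply: (mulfI d0); rewrite mulrA mulrCA mulfV // mulr1 mulrBr.
have e : (k%:R - mu.+1%:R + 1) * 'C(k, mu)%:R = mu.+1%:R * 'C(k, mu.+1)%:R :> F.
  by rewrite -natrM mul_bin_left natrM natrB 1?ltnW // -natr1; congr (_ * _); ring.
by rewrite e; ring.
Qed.

Lemma ballot_mid K : ballot F K.*2 K = catalan F K.
Proof.
rewrite /ballot /catalan -!mul2n natrM subrr add0r.
by rewrite (_ : 2 * K%:R - K%:R + 1 = K.+1%:R) ?mul1r // -natr1; ring.
Qed.

Definition hsum n (x y : F) := \sum_(j < n.+1) x ^+ (n - j) * y ^+ j.

(** Multiplication by [(x y)^mu] turns the monomials of [h_(k - 2 mu)] into the middle monomials of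
    degree [k], those with [mu <= j <= k - mu]. *)
Lemma hsum_shift k mu (x y : F) : (mu.*2 <= k)%N ->
  (x * y) ^+ mu * hsum (k - mu.*2) x y =
  \sum_(j < k.+1 | (mu <= j)%N && (mu <= k - j)%N) x ^+ (k - j) * y ^+ j.
Proof.
move=> muk; rewrite /hsum mulr_sumr.
rewrite -(big_mkord xpredT (fun j => (x * y) ^+ mu * (x ^+ (k - mu.*2 - j) * y ^+ j))).
rewrite -(big_mkord (fun j => (mu <= j) && (mu <= k - j))%N (fun j => x ^+ (k - j) * y ^+ j)).
rewrite [RHS](@big_cat_nat _ _ _ mu) //=; last by lia.
rewrite [X in _ = X + _]big_nat_cond [X in _ = X + _]big_pred0 ?add0r; last by move=> j; lia.
rewrite [RHS](@big_cat_nat _ _ _ (k - mu).+1 mu) /=; [|lia|lia].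
rewrite [X in _ = _ + X]big_nat_cond [X in _ = _ + X]big_pred0 ?addr0; last by move=> j; lia.
rewrite [RHS](@big_addn _ _ _ 0 _ mu) (_ : (k - mu).+1 - mu = (k - mu.*2).+1)%N; last by lia.
rewrite [LHS]big_nat_cond [RHS]big_nat_cond; apply: eq_big => [j|j jk]; first by lia.
rewrite (_ : k - (j + mu) = mu + (k - mu.*2 - j))%N; last by clear - jk muk; lia.
by rewrite exprMn !exprD; ring.
Qed.

(** The monomial with exponent [j] of [y] occurs for all [mu <= min(j, 2K - j)]. Its coefficients
    telescope to the binomial of that minimum, hence of [j]. *)
Lemma hsum_inversion K (x y : F) :
  \sum_(mu < K.+1) bin_diff K.*2 mu * ((x * y) ^+ mu * hsum (K - mu).*2 x y) = (x + y) ^+ K.*2.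
Proof.
have muK (mu : 'I_K.+1) : (mu.*2 <= K.*2)%N by rewrite leq_double -ltnS.
under eq_bigr => mu _ do rewrite doubleB hsum_shift // mulr_sumr.
rewrite (exchange_big_dep xpredT) //= exprDn; apply: eq_bigr => j _.
rewrite -mulr_suml -[RHS]mulr_natl; congr (_ * _).
have jk : (j <= K.*2)%N by rewrite -ltnS.
have mE : 'C(K.*2, j) = 'C(K.*2, minn j (K.*2 - j)).
  by rewrite /minn; case: ifP => // _; rewrite bin_sub.
rewrite mE -sum_bin_diff (@big_ord_widen _ _ _ _ K.+1); last by clear - jk; lia.
by apply: eq_bigl => mu; rewrite ltnS leq_min.
Qed.

(* For [u = t^2] and [v = - s^2] this is [(x^(2K+1) - y^(2K+1)) / (x - y)] with
   [x = t + s] and [y = t - s]. *)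
Definition odd_bin_poly K (u v : F) :=
  \sum_(i < K.+1) (-1) ^+ i * 'C(K.*2.+1, i.*2.+1)%:R * v ^+ i * u ^+ (K - i).

Lemma sum_double n (f : nat -> F) :
  \sum_(i < n.*2) f i = \sum_(i < n) (f i.*2 + f i.*2.+1).
Proof.
elim: n => [|n IHn]; first by rewrite !big_ord0.
by rewrite doubleS !big_ord_recr /= IHn addrA.
Qed.

Lemma odd_bin_polyE K (t s : F) : odd_bin_poly K (t ^+ 2) (- s ^+ 2) = hsum K.*2 (t + s) (t - s).
Proof.
(* The general case cancels [x - y = 2 s] from [(x - y) h_(2K)(x, y) = x^(2K+1) - y^(2K+1)], where
   only odd powers of [s] survive; so [s = 0] is treated apart. *)
have [->|s0] := eqVneq s 0.
  rewrite /odd_bin_poly /hsum expr0n /= oppr0 addr0 big_ord_recl big1 ?addr0; last first.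
    by move=> i _; rewrite expr0n /= mulr0 mul0r.
  rewrite expr0 bin1 !mul1r mulr1 subn0 -exprM mul2n.
  rewrite (eq_bigr (fun=> t ^+ K.*2)); last by move=> j _; rewrite -exprD subnK // -ltnS.
  by rewrite sumr_const card_ord -[RHS]mulr_natl.
have s2 : (t + s) - (t - s) = 2 * s by ring.
have s20 : 2 * s != 0 by rewrite mulf_neq0 // pnatr_eq0.
apply: (mulfI s20); rewrite -{2}s2 /hsum.
rewrite (eq_bigr (fun i : 'I_ _ => (t + s) ^+ (K.*2.+1.-1 - i) * (t - s) ^+ i)) // -subrXX.
rewrite exprDn exprBn -sumrB -doubleS.
rewrite (@sum_double K.+1 (fun i => t ^+ (K.*2.+1 - i) * s ^+ i *+ 'C(K.*2.+1, i) -
  (-1) ^+ i * t ^+ (K.*2.+1 - i) * s ^+ i *+ 'C(K.*2.+1, i))).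
rewrite mulr_sumr; apply: eq_bigr => i _.
have e2 : (-1) ^+ i.*2 = 1 :> F by rewrite -signr_odd odd_double.
have e3 : (-1) ^+ i.*2.+1 = - 1 :> F by rewrite -signr_odd /= odd_double.
rewrite e2 e3 mul1r subrr add0r.
rewrite (_ : K.*2.+1 - i.*2.+1 = (K - i) * 2)%N; last by rewrite subSS -doubleB muln2.
have e4 : (- s ^+ 2) ^+ i = (-1) ^+ i * s ^+ i.*2 by rewrite -[- s ^+ 2]mulN1r exprMn -mul2n [s ^+ (2 * i)]exprM.
rewrite e4 -[_ *+ 'C(_, _)]mulr_natl -[X in _ - X]mulr_natl -exprM mulnC -[s ^+ i.*2.+1]/(s ^+ i.*2.+1) exprS.
rewrite (_ : (-1) ^+ i * _ * _ * _ = ((-1) ^+ i * (-1) ^+ i) * ('C(K.*2.+1, i.*2.+1)%:R * s ^+ i.*2 * t ^+ ((K - i) * 2))); last by ring.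
by rewrite -exprD addnn e2; ring.
Qed.

Lemma odd_bin_inversion K (t s : F) :
  \sum_(mu < K.+1) bin_diff K.*2 mu * (t ^+ 2 - s ^+ 2) ^+ mu * odd_bin_poly (K - mu) (t ^+ 2) (- s ^+ 2) =
  (2 * t) ^+ K.*2.
Proof.
rewrite (_ : 2 * t = (t + s) + (t - s)); last by ring.
rewrite -hsum_inversion; apply: eq_bigr => mu _; rewrite odd_bin_polyE -mulrA.
by congr (_ * (_ ^+ _ * _)); ring.
Qed.
End Inversion.

Lemma sqr_mod4 (t : int) : exists u : int, t ^+ 2 = 4 * u + (t %% 2)%Z.
Proof.
exists ((t %/ 2)%Z ^+ 2 + (t %/ 2)%Z * (t %% 2)%Z).
have : (t %% 2)%Z ^+ 2 = (t %% 2)%Z by have [->|->] : (t %% 2)%Z = 0 \/ (t %% 2)%Z = 1 by lia.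
by rewrite [in t ^+ 2](divz_eq t 2); move: (t %% 2)%Z (t %/ 2)%Z => a b e; rewrite -[X in _ = _ + X]e; ring.
Qed.

Lemma sqr_diff_parity (t s m n : int) : m = 0 \/ m = 1 -> (n = 2 * m - 1 %[mod 4])%Z ->
  t ^+ 2 - s ^+ 2 = n -> (t = m %[mod 2])%Z.
Proof.
move=> m01 nm E; move: nm; rewrite -E; have [u ->] := sqr_mod4 t; have [v ->] := sqr_mod4 s.
by case: m01 => ->; lia.
Qed.

(** * The coefficients [lambda] at prime powers *)

Section LambdaPrimePower.
Variables (p : nat) (m : int).
Hypotheses (p_pr : prime p) (p_odd : odd p) (m01 : m = 0 \/ m = 1).

(** This is the solution with [t - s = p^i] and [t + s = p^(r - i)]. The range [i <= r/2] expresses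
    [s >= 0], and [s = 0] occurs exactly for [2 i = r]. *)
Definition power_pair r i : int * int :=
  ((p ^ (r - i) + p ^ i)./2%:Z, (p ^ (r - i) - p ^ i)./2%:Z).

Lemma power_pairE r i : (i <= r./2)%N ->
  [/\ (power_pair r i).1 - (power_pair r i).2 = (p ^ i)%N%:Z,
      (power_pair r i).1 + (power_pair r i).2 = (p ^ (r - i))%N%:Z & 0 <= (power_pair r i).2].
Proof.
move=> ir; rewrite /power_pair /=.
have le : (p ^ i <= p ^ (r - i))%N by rewrite leq_exp2l ?prime_gt1 //; lia.
have o j : odd (p ^ j) by rewrite oddX p_odd orbT.
move: le (o i) (o (r - i)%N); move: (p ^ i)%N (p ^ (r - i))%N => a b; clear.
by split; lia.
Qed.

Lemma sum_norm_pairs (F : zmodType) (f : int * int -> F) r :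
  ((p ^ r)%N%:Z = 2 * m - 1 %[mod 4])%Z ->
  \sum_(x <- norm_pairs m (p ^ r)) f x = \sum_(i < r./2.+1) f (power_pair r i).
Proof.
move=> nm; have p0 := prime_gt0 p_pr.
rewrite -(big_mkord xpredT (fun i => f (power_pair r i))) /index_iota subn0.
symmetry; apply: eq_trans (_ : \sum_(x <- [seq power_pair r i | i <- iota 0 r./2.+1]) f x = _).
  by rewrite big_map.
apply: perm_big; apply: uniq_perm.
- rewrite map_inj_in_uniq ?iota_uniq // => i j; rewrite !mem_iota !add0n !ltnS => ir jr e.
  have [e1 _ _] := power_pairE ir; have [e2 _ _] := power_pairE jr.
  by move: e1; rewrite e e2 => /eqP; rewrite eqz_nat eqn_exp2l ?prime_gt1 // => /eqP.
- by rewrite filter_uniq // allpairs_pair_uniq // irange_uniq.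
move=> x; apply/mapP/idP.
  case=> i; rewrite mem_iota add0n ltnS => ir ->; have [e1 e2 s0] := power_pairE ir.
  have E : (power_pair r i).1 ^+ 2 - (power_pair r i).2 ^+ 2 = (p ^ r)%N%:Z.
    by rewrite subr_sqr e1 e2 -PoszM -expnD subnKC //; lia.
  have d0 : 0 < (power_pair r i).1 - (power_pair r i).2 by rewrite e1 ltz_nat expn_gt0 p0.
  have d1 : (power_pair r i).1 + (power_pair r i).2 <= (p ^ r)%N%:Z.
    by rewrite e2 lez_nat leq_exp2l ?prime_gt1 // leq_subr.
  have tm := sqr_diff_parity m01 nm E.
  move: E d0 d1 s0 tm; rewrite mem_filter [power_pair r i]surjective_pairing mem_allpairs_pair !mem_irange /=.
  move: (p ^ r)%N (power_pair r i).1 (power_pair r i).2 => n t s -> d0 d1 s0 /eqP ->.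
  by rewrite eqxx; clear - d0 d1 s0; lia.
case: x => t s; rewrite mem_filter mem_allpairs_pair => /andP[/and4P[t1 s0 /eqP E _] _].
rewrite /= in t1 s0 E.
have E' : (t - s) * (t + s) = (p ^ r)%N%:Z by rewrite -subr_sqr.
have n0 : (0 < p ^ r)%N by rewrite expn_gt0 p0.
have d0 : 0 < t - s by clear - E' t1 s0 n0; nia.
have /(dvdn_pfactor _ _ p_pr) [i ir iE] : (`|t - s| %| p ^ r)%N.
  by rewrite -[(p ^ r)%N]/(absz (p ^ r)%N%:Z) -E' abszM dvdn_mulr.
have dE : t - s = (p ^ i)%N%:Z by rewrite -iE gez0_abs // ltW.
have eE : t + s = (p ^ (r - i))%N%:Z.
  apply: (mulfI (lt0r_neq0 d0)); rewrite E' dE -PoszM -expnD subnKC //.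
have ii : (i <= r - i)%N.
  by rewrite -(leq_exp2l _ _ (prime_gt1 p_pr)) -lez_nat -dE -eE; clear - s0; lia.
exists i; first by rewrite mem_iota add0n ltnS; clear - ii ir; lia.
rewrite /power_pair; congr (_, _); move: dE eE s0; move: (p ^ i)%N (p ^ (r - i))%N => a b; clear; lia.
Qed.

Lemma lambda_prime_power (R : realType) l r : ~~ odd l -> ((p ^ r)%N%:Z = 2 * m - 1 %[mod 4])%Z ->
  lambda_coef R l m 2 1 (p ^ r) = \sum_(i < r./2.+1) (if i.*2 == r then 1 else 2) * p%:R ^+ (i * l.+1).
Proof.
move=> l_even nm; rewrite lambda_coefE ?expn_gt0 ?prime_gt0 // sum_norm_pairs // mulr_sumr.
apply: eq_bigr => i _; have ir : (i <= r./2)%N by rewrite -ltnS.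
have [e1 e2 s0] := power_pairE ir; rewrite /pair_weight e1.
rewrite -[(p ^ i)%N%:Z%:~R]/((p ^ i)%N%:R) natrX -exprM.
have -> : ((power_pair r i).2 == 0) = (i.*2 == r :> nat).
  have : ((power_pair r i).2 == 0) = ((p ^ i)%N%:Z == (p ^ (r - i))%N%:Z).
    by rewrite -e1 -e2; clear; lia.
  by move=> ->; rewrite eqz_nat eqn_exp2l ?prime_gt1 //; clear - ir; lia.
case: ifP => _; first by rewrite mulrA mulfV // pnatr_eq0.
by rewrite mul1r.
Qed.

(** Raising the exponent by 2 shifts [i] to [i + 1], including the halved middle term. Only [i = 0]
    is left, with coefficient 2 because [r >= 2]. *)
Lemma lambda_step (R : realType) l r : ~~ odd l -> (2 <= r)%N -> ((p ^ r)%N%:Z = 2 * m - 1 %[mod 4])%Z ->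
  lambda_coef R l m 2 1 (p ^ r) - p%:R ^+ l.+1 * lambda_coef R l m 2 1 (p ^ (r - 2)) = 2.
Proof.
case: r => [|[|r]] // l_even _ nm; rewrite subSS subSS subn0.
have nm' : ((p ^ r)%N%:Z = 2 * m - 1 %[mod 4])%Z.
  rewrite -nm; have [u] := sqr_mod4 p%:Z; rewrite -[r.+2]/(2 + r)%N expnD PoszM Posz_sqr => ->.
  by rewrite (_ : (p%:Z %% 2)%Z = 1) ?mulrDl ?mul1r; [move: (_ * _); lia|lia].
rewrite !lambda_prime_power // big_ord_recl mul0n expr0 mulr1 mulr_sumr -addrA -sumrB big1 ?addr0 // => i _.
by rewrite lift0 doubleS !eqSS mulSn exprD mulrCA subrr.
Qed.

Lemma lambda_prime (R : realType) l : ~~ odd l -> ((p ^ 1)%N%:Z = 2 * m - 1 %[mod 4])%Z ->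
  lambda_coef R l m 2 1 (p ^ 1) = 2.
Proof.
by move=> l_even nm; rewrite lambda_prime_power // big_ord_recl big_ord0 addr0 mul0n expr0 mulr1.
Qed.
End LambdaPrimePower.

(** * Hurwitz moments *)

Lemma hz_mod4 x : (x %% 4)%Z = 1 \/ (x %% 4)%Z = 2 -> hz x = 0.
Proof.
move=> x4; rewrite /hz /hurwitz numq_int intr_eq0 ifF; last by lia.
rewrite ifF // !inE; apply/and3P => -[_ _]; lia.
Qed.

(** Here [n - t^2] is 1 or 2 modulo 4. Thus the zeroth moment over one parity class equals the sum
    over all [t] in Eichler's relation. *)
Lemma hz_off_parity (n : nat) (m t : int) : m = 0 \/ m = 1 -> (n%:Z = 2 * m - 1 %[mod 4])%Z ->
  ~~ (t == m %[mod 2])%Z -> hz (n%:Z - t ^+ 2) = 0.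
Proof.
move=> m01 nm tm; apply: hz_mod4; have [u ->] := sqr_mod4 t.
by case: m01 nm tm => ->; lia.
Qed.

(** For the opposite congruence of [n] the excluded residues 1 and 2 modulo 4 occur on the class of
    [m] itself, so the whole moment vanishes. *)
Lemma hz_on_parity (n : nat) (m t : int) : m = 0 \/ m = 1 -> (n%:Z = 2 * m + 1 %[mod 4])%Z ->
  (t = m %[mod 2])%Z -> hz (n%:Z - t ^+ 2) = 0.
Proof.
move=> m01 nm tm; apply: hz_mod4; have [u ->] := sqr_mod4 t.
by case: m01 nm tm => ->; lia.
Qed.

Lemma hz_out_of_range (n L : nat) t : (n <= L)%N -> t \notin irange L -> hz (n%:Z - t ^+ 2) = 0.
Proof.
rewrite mem_irange => nL tL; apply: hz_neg.
have [t0|t0] := lerP 0 t; nia.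
Qed.

Lemma hz_sum_widen (n L : nat) (P : pred int) (f : int -> rat) : (n <= L)%N ->
  \sum_(t <- irange L | P t) hz (n%:Z - t ^+ 2) * f t =
  \sum_(t <- irange n | P t) hz (n%:Z - t ^+ 2) * f t.
Proof.
move=> nL; rewrite bigfs ?irange_uniq //; last first.
  by move=> t _ tn; rewrite (hz_out_of_range nL) ?mul0r.
by rewrite [RHS]bigfs ?irange_uniq // => t _ tn; rewrite (hz_out_of_range (leqnn n)) ?mul0r.
Qed.

Lemma hurwitz_momentE k m p r : hurwitz_moment k m 2 1 p r =
  \sum_(t <- irange (p ^ r) | ~~ (p%:Z %| t)%Z && (t == m %[mod 2])%Z)
    hz ((p ^ r)%N%:Z - t ^+ 2) * t%:~R ^+ k.
Proof.
rewrite bigfs ?irange_uniq //; last by move=> t _ tn; rewrite (hz_out_of_range (leqnn _)) ?mul0r.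
rewrite /hurwitz_moment (eq_fsbigr (fun t : int => hz ((p ^ r)%N%:Z - t ^+ 2) * t%:~R ^+ k)); last first.
  by move=> t _; rewrite divr1.
apply: eq_fsbigl; apply/seteqP; split=> t /=.
  by case=> /negP h /eqP e; apply/andP.
by case/andP => /negP h /eqP.
Qed.

Definition hmoment k m n : rat :=
  \sum_(t <- irange n | (t == m %[mod 2])%Z) hz (n%:Z - t ^+ 2) * t%:~R ^+ k.

Lemma hurwitz_moment_vanish k m p r : m = 0 \/ m = 1 ->
  ((p ^ r)%N%:Z = 2 * m + 1 %[mod 4])%Z -> hurwitz_moment k m 2 1 p r = 0.
Proof.
move=> m01 nm; rewrite hurwitz_momentE big1 // => t /andP[_ /eqP tm].
by rewrite (hz_on_parity m01) ?mul0r.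
Qed.

Section PrimePower.
Variables (p : nat) (m : int).
Hypotheses (p_pr : prime p) (p_odd : odd p) (m01 : m = 0 \/ m = 1).

Lemma pow_mod4 r : ((p ^ r.+2)%N%:Z = (p ^ r)%N%:Z %[mod 4])%Z.
Proof.
have [u] := sqr_mod4 p%:Z; rewrite -[r.+2]/(2 + r)%N expnD PoszM Posz_sqr => ->.
by rewrite (_ : (p%:Z %% 2)%Z = 1) ?mulrDl ?mul1r; [move: (_ * _); lia|lia].
Qed.

Definition eichler_sum r : int :=
  \sum_(i < r.+1) (2 * (p ^ i)%N%:Z - 3 * (p ^ minn i (r - i))%N%:Z).

Lemma eichler_sum_step r : eichler_sum r.+2 = p%:Z * eichler_sum r + 2 * (p ^ r.+2)%N%:Z - 4.
Proof.
rewrite /eichler_sum big_ord_recl big_ord_recr /= min0n expn0 subnn minn0 expn0.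
rewrite (eq_bigr (fun i : 'I_r.+1 => p%:Z * (2 * (p ^ i)%N%:Z - 3 * (p ^ minn i (r - i))%N%:Z))).
  by rewrite -mulr_sumr; ring.
move=> i _; have ir : (i <= r)%N by rewrite -ltnS.
rewrite /bump /= add1n subSS expnS (_ : minn i.+1 (r.+1 - i) = (minn i (r - i)).+1); last by clear - ir; lia.
by rewrite expnS !PoszM; ring.
Qed.

Lemma hmoment0E r : ((p ^ r)%N%:Z = 2 * m - 1 %[mod 4])%Z -> 6 * hmoment 0 m (p ^ r) = (eichler_sum r)%:~R.
Proof.
move=> nm; rewrite -eichler //; congr (_ * _).
rewrite (eq_bigr (fun t : int => hz ((p ^ r)%N%:Z - t ^+ 2) * 1)); last by move=> t _; rewrite mulr1.
rewrite hz_sum_widen ?leq_pmull // /hmoment big_mkcond; apply: eq_bigr => t _.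
by case: ifPn => // tm; rewrite (hz_off_parity m01) ?mul0r.
Qed.

Lemma hmoment0_step r : ((p ^ r.+2)%N%:Z = 2 * m - 1 %[mod 4])%Z ->
  hmoment 0 m (p ^ r.+2) - p%:R * hmoment 0 m (p ^ r) = (p%:R ^+ r.+2 - 2) / 3.
Proof.
move=> nm; have e1 := hmoment0E nm.
have e2 : 6 * hmoment 0 m (p ^ r) = (eichler_sum r)%:~R by apply: hmoment0E; rewrite -pow_mod4.
have pE : (p ^ r.+2)%N%:Z%:~R = p%:R ^+ r.+2 :> rat by rewrite -pmulrn natrX.
move: e1; rewrite eichler_sum_step intrB intrD !intrM -e2 pE; lra.
Qed.

Lemma hmoment0_1 : ((p ^ 1)%N%:Z = 2 * m - 1 %[mod 4])%Z -> hmoment 0 m (p ^ 1) = (p%:R - 2) / 3.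
Proof.
move=> nm; have := hmoment0E nm.
rewrite /eichler_sum !big_ord_recl big_ord0 /= /bump /= !minn0 min0n expn0 expn1 addr0.
by rewrite intrD !intrB !intrM; lra.
Qed.

Lemma parity_mul_odd (u : int) : (p%:Z * u == m %[mod 2])%Z = (u == m %[mod 2])%Z.
Proof.
have [v ->] : exists v : int, p%:Z = 2 * v + 1 by exists (p./2%:Z); lia.
by rewrite (_ : (2 * v + 1) * u = 2 * (v * u) + u); [move: (v * u); lia|ring].
Qed.

(* The extra term at [u^2 = p^r] is there because [H(0) = - 1/12] does not scale by [p]. *)
Lemma hz_scale_sqr r k (u : int) : (0 < k)%N ->
  hz (p%:Z ^+ 2 * ((p ^ r)%N%:Z - u ^+ 2)) * u%:~R ^+ k =
  p%:R * (hz ((p ^ r)%N%:Z - u ^+ 2) * u%:~R ^+ k) +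
  (if u ^+ 2 == (p ^ r)%N%:Z then (p%:R - 1) / 12%:R * u%:~R ^+ k else 0).
Proof.
move=> k0; have p0 := prime_gt0 p_pr; have [->|u0] := eqVneq u 0.
  have -> : 0%:~R ^+ k = 0 :> rat by rewrite expr0n gtn_eqF.
  by rewrite !mulr0 if_same addr0.
case: (ltrgtP (u ^+ 2) (p ^ r)%N%:Z) => [lt|gt|->].
- rewrite addr0 mulrA; congr (_ * _).
  have uE : u ^+ 2 = (absz u ^ 2)%N%:Z by rewrite -abszX gez0_abs ?sqr_ge0.
  move: lt; rewrite uE ltz_nat => lt; rewrite subzn ?(ltnW lt) // -(Posz_sqr p) -PoszM.
  rewrite !hz_pos ?muln_gt0 ?expn_gt0 ?p0 ?subn_gt0 //.
  by rewrite class_number_shifted_power //; rewrite lt0n absz_eq0.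
- rewrite addr0 !hz_neg ?mul0r ?mulr0 //; first by lia.
  by have p20 : 0 < p%:Z ^+ 2; [rewrite exprn_gt0|nia].
- by rewrite subrr mulr0 hz0; field.
Qed.

(** With [t = p u] each term scales by [p^(k+1)], except where [u^2 = p^r]. For even [r] the two
    such [u] each add [(p - 1) / 12] times [t^k = p^((r+2) k/2)]. *)
Lemma divisible_moment_step r k : (0 < k)%N -> ~~ odd k ->
  ((p ^ r.+2)%N%:Z = 2 * m - 1 %[mod 4])%Z ->
  \sum_(t <- irange (p ^ r.+2) | (p%:Z %| t)%Z && (t == m %[mod 2])%Z)
    hz ((p ^ r.+2)%N%:Z - t ^+ 2) * t%:~R ^+ k =
  p%:R ^+ k.+1 * hmoment k m (p ^ r) +
  (if odd r then 0 else 6^-1 * p%:R ^+ (r.+2 * k./2) * (p%:R - 1)).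
Proof.
move=> k0 k_even nm; have p0 := prime_gt0 p_pr; have pz : 0 < p%:Z by rewrite ltz_nat.
have nm' : ((p ^ r)%N%:Z = 2 * m - 1 %[mod 4])%Z by rewrite -pow_mod4.
pose G (u : int) : rat := p%:R ^+ k * (hz (p%:Z ^+ 2 * ((p ^ r)%N%:Z - u ^+ 2)) * u%:~R ^+ k).
transitivity (\sum_(u <- irange (p ^ r.+1) | (u == m %[mod 2])%Z) G u).
  apply: (@reindex_seq _ _ _ _ _ _ _ _ _ (fun t => (t %/ p%:Z)%Z) (fun u => p%:Z * u)); rewrite ?irange_uniq //.
    move=> t; rewrite !mem_irange => tr /andP[/dvdzP[u tE]]; subst t.
    rewrite [u * _]mulrC parity_mul_odd => um; rewrite mulKz ?lt0r_neq0 //.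
    split=> //.
      move: tr; rewrite [u * _]mulrC [(p ^ r.+2)%N]expnS PoszM -mulrN !ler_pM2l //.
    rewrite /G -[r.+2]/(2 + r)%N expnD PoszM Posz_sqr exprMn -mulrBr.
    by rewrite rmorphM exprMn; ring.
  move=> u; rewrite !mem_irange => ur um; rewrite mulKz ?lt0r_neq0 // parity_mul_odd um dvdz_mulr //.
  by split=> //; rewrite [(p ^ r.+2)%N]expnS PoszM -mulrN !ler_pM2l.
rewrite (eq_bigr (fun u : int => hz ((p ^ r)%N%:Z - u ^+ 2) * (p%:R ^+ k.+1 * u%:~R ^+ k) +
   (if u ^+ 2 == (p ^ r)%N%:Z then p%:R ^+ k * ((p%:R - 1) / 12%:R * u%:~R ^+ k) else 0))); last first.
  move=> u _; rewrite /G hz_scale_sqr // [p%:R ^+ k.+1]exprSr mulrDr; congr (_ + _); first by ring.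
  by case: ifP; rewrite ?mulr0.
rewrite big_split /= hz_sum_widen ?leq_exp2l ?prime_gt1 //; congr (_ + _).
  by rewrite /hmoment mulr_sumr; apply: eq_bigr => u _; ring.
rewrite -big_mkcondr /=.
(* A root of [u^2 = p^r] has the parity of [m] by [sqr_diff_parity] with [s = 0]. *)
rewrite (eq_bigl (fun u : int => u ^+ 2 == (p ^ r)%N%:Z)); last first.
  move=> u /=; apply: andb_idl => /eqP e; apply/eqP.
  by apply: (@sqr_diff_parity u 0 m _ m01 nm'); rewrite e expr0n subr0.
have kE : k = (2 * k./2)%N by rewrite mul2n even_halfK.
rewrite (eq_bigr (fun u : int => 12%:R^-1 * p%:R ^+ (r.+2 * k./2) * (p%:R - 1) * 1%:~R)); last first.
  move=> u /eqP uE.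
  have -> : u%:~R ^+ k = p%:R ^+ (r * k./2) :> rat.
    by rewrite {1}kE exprM -rmorphXn /= uE -pmulrn natrX exprM.
  rewrite (_ : (r.+2 * k./2 = k + r * k./2)%N) ?exprD; first by ring.
  by rewrite {2}kE; lia.
rewrite -mulr_sumr -rmorph_sum square_terms ?leq_exp2l ?prime_gt1 //=.
by case: (odd r); rewrite /= ?mulr0 //; field.
Qed.

Lemma divisible_moment_1 k : (0 < k)%N ->
  \sum_(t <- irange (p ^ 1) | (p%:Z %| t)%Z && (t == m %[mod 2])%Z)
    hz ((p ^ 1)%N%:Z - t ^+ 2) * t%:~R ^+ k = 0.
Proof.
move=> k0; apply: big1 => t /andP[/dvdzP[u ->] _].
have [->|u0] := eqVneq u 0; first by rewrite mul0r [0%:~R ^+ k]expr0n gtn_eqF ?mulr0.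
have p1 := prime_gt1 p_pr.
rewrite hz_neg ?mul0r // expn1 exprMn.
have u2 : u ^+ 2 != 0 by exact: expf_neq0.
have : 1 <= u ^+ 2 by have := sqr_ge0 u; lia.
move: (u ^+ 2) => v v1; rewrite expr2; nia.
Qed.

Lemma moment_split k r : hurwitz_moment k m 2 1 p r = hmoment k m (p ^ r) -
  \sum_(t <- irange (p ^ r) | (p%:Z %| t)%Z && (t == m %[mod 2])%Z)
    hz ((p ^ r)%N%:Z - t ^+ 2) * t%:~R ^+ k.
Proof.
rewrite hurwitz_momentE /hmoment [X in _ = X - _](bigID (fun t => (p%:Z %| t)%Z)) /=.
rewrite (eq_bigl (fun t : int => (t == m %[mod 2])%Z && ~~ (p%:Z %| t)%Z)); last by move=> t; rewrite andbC.
rewrite [X in _ = _ - X](eq_bigl (fun t : int => (t == m %[mod 2])%Z && (p%:Z %| t)%Z)); last by move=> t; rewrite andbC.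
by rewrite addrAC subrr add0r.
Qed.
End PrimePower.

(** * Moments in terms of the coefficients [alpha] *)

Section Assembly.
Variable R : realType.
Local Notation C := (Cplx R).

Lemma rc_weightE K i : (i <= K)%N -> rc_weight R K i * 4 ^+ K =
  'C(K.*2, K)%:R * ((-1) ^+ i * 'C(K.*2.+1, i.*2.+1)%:R).
Proof.
move=> iK; rewrite [RHS]mulrCA -(gbinom_pair C iK) /rc_weight.
rewrite (_ : 3%:R / 2 + K%:R - 1 = K%:R + 2^-1); last by field.
by rewrite (_ : 2^-1 + 0%:R + K%:R - 1 = K%:R - 2^-1) ?mulrA //; field.
Qed.

Definition odd_bin_moment m K (n : nat) : C :=
  \sum_(t <- irange n | (t == m %[mod 2])%Z) hcoef R (n%:Z - t ^+ 2) *
    odd_bin_poly K (t ^+ 2)%:~R (n%:Z - t ^+ 2)%:~R.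

Lemma bracket_moment m K n : bracket_coef R m K n * 4 ^+ K = 'C(K.*2, K)%:R * odd_bin_moment m K n.
Proof.
rewrite bracket_coefE mulr_suml mulr_sumr; apply: eq_bigr => t _.
rewrite -mulrA [RHS]mulrCA; congr (_ * _); rewrite /odd_bin_poly mulr_suml mulr_sumr; apply: eq_bigr => i _.
have iK : (i <= K)%N by rewrite -ltnS.
have e := rc_weightE iK.
move: e; move: (rc_weight R K i) (_%:~R ^+ i) (_%:~R ^+ (K - i)) (4 ^+ K) => w N U F e.
rewrite (_ : w * N * U * F = w * F * N * U); last by ring. rewrite e. ring.
Qed.

Lemma alpha_moment m K n : (0 < n)%N ->
  odd_bin_moment m K n = 4 ^+ K *
    (alpha_coef R K.*2 m 2 1 n - (2 ^+ K.*2.+1)^-1 * of_real (lambda_coef R K.*2 m 2 1 n)).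
Proof.
move=> n0; have even2 : ~~ odd K.*2 by rewrite odd_double.
rewrite /alpha_coef gamma_coefE // /lambda_seq gtn_eqF // doubleK.
have c0 : 'C(K.*2, K)%:R != 0 :> C.
  by rewrite pnatr_eq0 -lt0n bin_gt0 -addnn leq_addr.
have := bracket_moment m K n; move: (bracket_coef _ _ _ _) (odd_bin_moment _ _ _) => b o e.
apply: (mulfI c0); rewrite -e.
have w0 : 2 ^+ K.*2.+1 != 0 :> C by rewrite expf_neq0 // pnatr_eq0.
move: c0 w0; move: ('C(_, _)%:R) (2 ^+ K.*2.+1) (4 ^+ K) => c w f c0 w0.
by field; rewrite c0 w0.
Qed.

Lemma hmoment_expansion m K n : (0 < n)%N ->
  ratr (hmoment K.*2 m n) = \sum_(mu < K) (2 ^+ (2 * mu))^-1 * ballot C K.*2 mu *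
     (alpha_coef R (K.*2 - 2 * mu) m 2 1 n -
      (2 ^+ (K.*2 - 2 * mu).+1)^-1 * of_real (lambda_coef R (K.*2 - 2 * mu) m 2 1 n)) * n%:R ^+ mu
   + catalan C K / 2 ^+ K.*2 * n%:R ^+ K * ratr (hmoment 0 m n).
Proof.
move=> n0; have p20 j : 2 ^+ j != 0 :> C by rewrite expf_neq0 // pnatr_eq0.
have E : 2 ^+ K.*2 * ratr (hmoment K.*2 m n) =
  \sum_(mu < K.+1) ballot C K.*2 mu * n%:R ^+ mu * odd_bin_moment m (K - mu) n.
  rewrite /odd_bin_moment; under eq_bigr do rewrite mulr_sumr.
  rewrite exchange_big /= rmorph_sum mulr_sumr; apply: eq_bigr => t _.
  rewrite rmorphM /= -/(hcoef R _) mulrCA rmorphXn /= ratr_int -exprMn.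
  (* The root is taken in the complex numbers because [t^2 - n] is negative for most [t]. Then
     [n - t^2 = - s^2], and [t + s], [t - s] are the [x], [y] with sum [2 t] and product [n]. *)
  pose s : C := sqrtc (t%:~R ^+ 2 - n%:R).
  have s2 : s ^+ 2 = t%:~R ^+ 2 - n%:R by rewrite sqr_sqrtc.
  have eu : (t ^+ 2)%:~R = t%:~R ^+ 2 :> C by rewrite rmorphXn.
  have ev : (n%:Z - t ^+ 2)%:~R = - s ^+ 2 :> C by rewrite s2 opprB rmorphB rmorphXn.
  rewrite -(odd_bin_inversion K t%:~R s) mulr_sumr; apply: eq_bigr => mu _.
  have muK : (mu <= K.*2)%N by rewrite (leq_trans (leq_ord mu)) // -addnn leq_addr.
  rewrite (ballotE _ muK) eu ev (_ : t%:~R ^+ 2 - s ^+ 2 = n%:R); last by rewrite s2; ring.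
  by ring.
apply: (mulfI (p20 K.*2)); rewrite E big_ord_recr /= subnn mulrDr; congr (_ + _).
  rewrite [RHS]mulr_sumr; apply: eq_bigr => mu _; rewrite alpha_moment //.
  rewrite (_ : (K - mu).*2 = K.*2 - 2 * mu)%N; last by rewrite doubleB mul2n.
  have -> : 4 ^+ (K - mu) = 2 ^+ K.*2 / 2 ^+ (2 * mu) :> C.
    rewrite (_ : 4 = 2 ^+ 2); last by rewrite -natrX.
    by rewrite -exprM -mul2n mulnBr exprB ?unitfE ?pnatr_eq0 // leq_mul2l /= ltnW.
  by ring.
have -> : odd_bin_moment m 0 n = ratr (hmoment 0 m n).
  rewrite /odd_bin_moment /hmoment rmorph_sum; apply: eq_bigr => t _.
  by rewrite /odd_bin_poly big_ord_recl big_ord0 /= bin1 !expr0 !mulr1 addr0 mulr1.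
by rewrite ballot_mid; field; rewrite p20.
Qed.

(** [S] is the full moment at [p^r] and [S'] the contribution from [p^(r-2)]. The differences
    [L - M = 2] produce the ballot sum with factor [2^(-k)], because
    [2^(-2 mu) 2^(-(k - 2 mu) - 1) 2 = 2^(-k)]; the difference [S0 - S0'] produces the Catalan
    term. *)
Lemma moment_difference (K : nat) (b A B L M : nat -> C) (n p c S S' S0 S0' : C) :
  S = \sum_(mu < K) (2 ^+ (2 * mu))^-1 * b mu *
     (A mu - (2 ^+ (K.*2 - 2 * mu).+1)^-1 * L mu) * n ^+ mu + c / 2 ^+ K.*2 * n ^+ K * S0 ->
  S' = \sum_(mu < K) (2 ^+ (2 * mu))^-1 * b mu *
     (p ^+ (K.*2 - 2 * mu + 1) * B mu - (2 ^+ (K.*2 - 2 * mu).+1)^-1 * M mu) * n ^+ mu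
     + c / 2 ^+ K.*2 * n ^+ K * S0' ->
  (forall mu, (mu < K)%N -> L mu - M mu = 2) -> S0 - S0' = (n - 2) / 3 ->
  S - S' = c / (3 * 2 ^+ K.*2) * (n ^+ K.+1 - 2 * n ^+ K)
    - (2 ^+ K.*2)^-1 * \sum_(mu < K) b mu * n ^+ mu
    + \sum_(mu < K) (2 ^+ (2 * mu))^-1 * b mu * (A mu - p ^+ (K.*2 - 2 * mu + 1) * B mu) * n ^+ mu.
Proof.
move=> -> -> LM S00; have p20 j : 2 ^+ j != 0 :> C by rewrite expf_neq0 // pnatr_eq0.
have e1 : c / (3 * 2 ^+ K.*2) * (n ^+ K.+1 - 2 * n ^+ K) =
  c / 2 ^+ K.*2 * n ^+ K * S0 - c / 2 ^+ K.*2 * n ^+ K * S0'.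
  by rewrite -mulrBr S00 exprS; field; rewrite ?p20 ?pnatr_eq0.
have e2 : \sum_(mu < K) (2 ^+ (2 * mu))^-1 * b mu *
     (A mu - (2 ^+ (K.*2 - 2 * mu).+1)^-1 * L mu) * n ^+ mu -
  \sum_(mu < K) (2 ^+ (2 * mu))^-1 * b mu *
     (p ^+ (K.*2 - 2 * mu + 1) * B mu - (2 ^+ (K.*2 - 2 * mu).+1)^-1 * M mu) * n ^+ mu =
  - ((2 ^+ K.*2)^-1 * \sum_(mu < K) b mu * n ^+ mu)
    + \sum_(mu < K) (2 ^+ (2 * mu))^-1 * b mu * (A mu - p ^+ (K.*2 - 2 * mu + 1) * B mu) * n ^+ mu.
  rewrite mulr_sumr -sumrB -sumrN -big_split; apply: eq_bigr => mu _ /=.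
  have -> : A mu = A mu - p ^+ (K.*2 - 2 * mu + 1) * B mu + p ^+ (K.*2 - 2 * mu + 1) * B mu by rewrite subrK.
  have h := LM mu (ltn_ord mu).
  have -> : L mu = M mu + 2 by rewrite -h addrC subrK.
  have -> : 2 ^+ K.*2 = 2 ^+ (2 * mu) * 2 ^+ (K.*2 - 2 * mu) :> C.
    by rewrite -exprD subnKC // -mul2n leq_mul2l /= ltnW.
  rewrite [2 ^+ _.+1]exprS.
  move: (p20 (2 * mu)%N) (p20 (K.*2 - 2 * mu)%N).
  move: (2 ^+ (2 * mu)) (2 ^+ (K.*2 - 2 * mu)) (p ^+ _ * B mu) => u v w u0 v0.
  by field; rewrite ?u0 ?v0 ?pnatr_eq0.
rewrite opprD addrACA e2 e1; ring.
Qed.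
End Assembly.

Section PrimePowerMoment.
Variables (R : realType) (p : nat) (m : int).
Hypotheses (p_pr : prime p) (p_odd : odd p) (m01 : m = 0 \/ m = 1).
Local Notation C := (Cplx R).
Local Notation alpha l n := (alpha_coef R l m 2 1 n).

Lemma prime_power_moment (K r : nat) : (0 < K)%N -> (0 < r)%N ->
  ((p ^ r)%N%:Z = 2 * m - 1 %[mod 4])%Z ->
  ratr (hurwitz_moment K.*2 m 2 1 p r) = catalan C K / (3 * 2 ^+ K.*2)
      * ((p%:R ^+ r) ^+ K.+1 - 2 * (p%:R ^+ r) ^+ K)
    - (2 ^+ K.*2)^-1 * \sum_(mu < K) ballot C K.*2 mu * (p%:R ^+ r) ^+ mu
    + \sum_(mu < K) (2 ^+ (2 * mu))^-1 * ballot C K.*2 mu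
        * (alpha (K.*2 - 2 * mu) (p ^ r) - p%:R ^+ (K.*2 - 2 * mu + 1)
           * (if r == 1%N then 0 else alpha (K.*2 - 2 * mu) (p ^ (r - 2)))) * (p%:R ^+ r) ^+ mu
    - (if odd r then 0 else 6^-1 * p%:R ^+ (r * K) * (p%:R - 1)).
Proof.
move=> K0 r0 nm; have k0 : (0 < K.*2)%N by rewrite double_gt0.
have k_even mu : ~~ odd (K.*2 - 2 * mu) by rewrite mul2n -doubleB odd_double.
have even2 : ~~ odd K.*2 by rewrite odd_double.
have pn j : (0 < p ^ j)%N by rewrite expn_gt0 prime_gt0.
have nE j : (p ^ j)%N%:R = p%:R ^+ j :> C by rewrite natrX.
rewrite moment_split; case: r r0 nm => [|[|q]] // _ nm.
  rewrite divisible_moment_1 // subr0 /= subr0.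
  (* For [r = 1] the multiples of [p] contribute nothing, so the common lemma is applied with zero
     in place of the data at [p^(r-2)]. *)
  rewrite -[LHS]subr0.
  apply: (@moment_difference R K (ballot C K.*2) (fun mu => alpha (K.*2 - 2 * mu) (p ^ 1)) (fun=> 0)
    (fun mu => of_real (lambda_coef R (K.*2 - 2 * mu) m 2 1 (p ^ 1))) (fun=> 0)
    (p%:R ^+ 1) p%:R (catalan C K) _ 0 (ratr (hmoment 0 m (p ^ 1))) 0).
  - by rewrite hmoment_expansion // nE.
  - by rewrite mulr0 addr0 big1 // => mu _; ring.
  - by move=> mu _; rewrite subr0 lambda_prime // of_real_nat.
  - by rewrite subr0 hmoment0_1 // fmorph_div rmorphB /= !ratr_nat expr1.
rewrite divisible_moment_step // rmorphB rmorphD /= opprD addrA negbK.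
have -> : ratr (if odd q then 0 else 6^-1 * p%:R ^+ (q.+2 * K.*2./2) * (p%:R - 1)) =
  (if odd q then 0 else 6^-1 * p%:R ^+ (q.+2 * K) * (p%:R - 1)) :> C.
  rewrite doubleK; case: (odd q); first by rewrite rmorph0.
  by rewrite !rmorphM fmorphV rmorphXn rmorphB rmorph1 /= !ratr_nat.
congr (_ - _); rewrite rmorphM rmorphXn /= ratr_nat.
rewrite subSS subSS subn0 /=.
apply: (@moment_difference R K (ballot C K.*2) (fun mu => alpha (K.*2 - 2 * mu) (p ^ q.+2)) (fun mu => alpha (K.*2 - 2 * mu) (p ^ q))
  (fun mu => of_real (lambda_coef R (K.*2 - 2 * mu) m 2 1 (p ^ q.+2)))
  (fun mu => p%:R ^+ (K.*2 - 2 * mu + 1) * of_real (lambda_coef R (K.*2 - 2 * mu) m 2 1 (p ^ q)))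
  (p%:R ^+ q.+2) p%:R (catalan C K) _ _ (ratr (hmoment 0 m (p ^ q.+2))) (p%:R * ratr (hmoment 0 m (p ^ q)))).
- by rewrite hmoment_expansion // nE.
- rewrite hmoment_expansion // nE mulrDr mulr_sumr; congr (_ + _).
    apply: eq_bigr => mu _.
    (* The part [p^(2 mu)] combines with [(p^q)^mu] to [(p^(q+2))^mu], so both expansions carry the
       same power of [n]. *)
    have -> : p%:R ^+ K.*2.+1 = p%:R ^+ (K.*2 - 2 * mu + 1) * (p%:R ^+ 2) ^+ mu :> C.
      rewrite -exprM -exprD; congr (_ ^+ _).
      by have := ltn_ord mu; lia.
    rewrite -[q.+2]/(2 + q)%N [p%:R ^+ (2 + q)]exprD [(p%:R ^+ 2 * _) ^+ _]exprMn; ring.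
  have -> : p%:R ^+ K.*2.+1 = p%:R * (p%:R ^+ 2) ^+ K :> C by rewrite -exprM mul2n exprS.
  by rewrite -[q.+2]/(2 + q)%N [p%:R ^+ (2 + q)]exprD [(p%:R ^+ 2 * _) ^+ _]exprMn; ring.
- move=> mu _; rewrite -(of_real_nat R p) -of_realX -of_realM addn1.
  by rewrite -(of_real_nat R 2) -(@lambda_step p m p_pr p_odd m01 R _ q.+2 (k_even mu) isT nm) /of_real /= rmorphB /= subn2.
- have := hmoment0_step p_pr p_odd m01 nm.
  by move/(congr1 (@ratr C)); rewrite rmorphB rmorphM fmorph_div rmorphB rmorphXn /= !ratr_nat.
Qed.
End PrimePowerMoment.

Theorem theorem5p7 (R : realType) (k : nat) (m : int) (p r : nat)
    (k_ge1 : (1 <= k)%N) (k_even : ~~ odd k) (m01 : m = 0 \/ m = 1)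
    (p_prime : prime p) (p_ge3 : (3 <= p)%N) (r_ge1 : (1 <= r)%N) :
  (((p ^ r)%N%:Z = 2 * m - 1 %[mod 4])%Z ->
     ratr (hurwitz_moment k m 2 1 p r) =
       catalan (Cplx R) k./2 / (3 * 2 ^+ k)
         * (p%:R ^+ (r * k./2.+1)%N - 2 * p%:R ^+ (r * k./2)%N)
       - (if (2 %| r)%N then 1 else 0)
         * (6^-1 * p%:R ^+ (r * k./2)%N * (p%:R - 1))
       - (2 ^+ k)^-1 * \sum_(mu < k./2) ballot (Cplx R) k mu * p%:R ^+ (r * mu)%N
       + \sum_(mu < k./2)
           (2 ^+ (2 * mu)%N)^-1 * ballot (Cplx R) k mu
           * (alpha_coef R (k - 2 * mu)%N m 2 1 (p ^ r)%N
              - p%:R ^+ (k - 2 * mu + 1)%N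
                * (if r == 1%N then 0
                   else alpha_coef R (k - 2 * mu)%N m 2 1 (p ^ (r - 2))%N))
           * p%:R ^+ (r * mu)%N)
  /\
  (((p ^ r)%N%:Z = 2 * m + 1 %[mod 4])%Z ->
     hurwitz_moment k m 2 1 p r = 0).
Proof.
have p_odd : odd p by have [p2|] := even_prime p_prime; first by rewrite p2 in p_ge3.
split; last exact: hurwitz_moment_vanish.
have kE : k = k./2.*2 by rewrite even_halfK.
have K0 : (0 < k./2)%N by rewrite -double_gt0 -kE.
move=> nm; move: kE K0; move: (k./2) => K kE K0; subst k.
rewrite prime_power_moment // -!exprM dvdn2.
rewrite (eq_bigr (fun mu : 'I_K => ballot (Cplx R) K.*2 mu * p%:R ^+ (r * mu))); last first.
  by move=> mu _; rewrite -exprM.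
rewrite [X in _ + X - _](eq_bigr (fun mu : 'I_K => (2 ^+ (2 * mu)%N)^-1 * ballot (Cplx R) K.*2 mu
  * (alpha_coef R (K.*2 - 2 * mu)%N m 2 1 (p ^ r)%N - p%:R ^+ (K.*2 - 2 * mu + 1)%N
     * (if r == 1%N then 0 else alpha_coef R (K.*2 - 2 * mu)%N m 2 1 (p ^ (r - 2))%N))
  * p%:R ^+ (r * mu)%N)); last by move=> mu _; rewrite -exprM.
by case: (odd r); rewrite /= ?mul0r ?mul1r ?subr0 // addrAC; congr (_ + _); rewrite addrAC.
Qed.
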